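(* Consider the Newey and Robins plug-in estimator $\hat\psi^{\mathrm{NR}}_k$ without sample splitting of $\psi(\mathbb P)=\mathbb E_{\mathbb P}[\mathrm{Cov}_{\mathbb P}(A,Y\mid X)]$ over $\mathcal P_{(\alpha,\beta)}$ defined in the context. If $\frac{\alpha+\beta}2\ge\frac d2$, $\hat\psi^{\mathrm{NR}}_k$ is minimax rate optimal when choosing $n^{\frac d{2\alpha+2\beta}}\lesssim k\lesssim\sqrt n$. If $\frac{\alpha+\beta}2<\frac d2$, $\hat\psi^{\mathrm{NR}}_k$ cannot be minimax rate optimal for any choice of $k$; the best rate of estimation of $\psi(\mathbb P)$ for $\hat\psi^{\mathrm{NR}}_k$ is $n^{-\frac{2\alpha+2\beta}{\alpha+\beta+d}}$, which occurs when choosing $k\asymp n^{\frac d{\alpha+\beta+d}}$.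
   Context: Notation. $a\vee b=\max(a,b)$; integrals are over $[0,1]^d$. For nonnegative sequences, $a_n\lesssim b_n$ means there is a constant $C>0$ with $a_n\le Cb_n$ for all $n\ge n_0$; $a_n\gtrsim b_n$ means $b_n\lesssim a_n$; $a_n\asymp b_n$ means both. The resolution $k$ is a sequence that may depend on $n$. Wavelets. Fix a compactly supported Cohen–Daubechies–Vial type orthonormal wavelet basis $\{\Phi_{J_0m},\Psi^{\iota}_{lm'}: m\in\mathcal Z_{J_0},\,m'\in\mathcal Z_l,\,\iota\in\{0,1\}^d\setminus\{0\},\,l\ge J_0\}$ of $L^2([0,1]^d)$ of regularity $S\ge1$, $S>\alpha\vee\beta$, with $2^{J_0}\ge S$, $|\mathcal Z_l|\asymp 2^{ld}$. For $j\ge J_0$ let $V_j=\mathrm{span}\{\Phi_{jm}:m\in\mathcal Z_j\}$ ($\{\Phi_{jm}\}_m$ the orthonormal scaling functions at level $j$; the $V_j$ are nested). A resolution is a number $k=2^{jd}$, $j\ge J_0$; write $V_k,\Phi_{km},\mathcal Z_k$ for $V_j,\Phi_{jm},\mathcal Z_j$. Standard properties: $|\Phi_{km}|\lesssim\sqrt k$ uniformly with support in a set of Lebesgue measure $O(1/k)$; $V_k$ contains all polynomials of degree at most $S-1$. The projection kernel is $K_{V_k}(x,y)=\sum_{m\in\mathcal Z_k}\Phi_{km}(x)\Phi_{km}(y)$. Hölder ball. $H(\alpha,M)$ is the set of uniformly continuous $h:[0,1]^d\to\mathbb R$ with $2^{J_0(\alpha+d/2)}\max_m|\langle h,\Phi_{J_0m}\rangle|+\sup_{l\ge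 J_0,m\in\mathcal Z_l,\iota}2^{l(\alpha+d/2)}|\langle h,\Psi^\iota_{lm}\rangle|\le M$. Model. $\mathcal P_{(\alpha,\beta)}$ is the set of distributions $\mathbb P$ of $(X,A,Y)\in[0,1]^d\times\mathbb R\times\mathbb R$ with $X\sim\mathrm{Uniform}([0,1]^d)$, $A,Y\in[C_1,C_2]$ a.s., $p(x):=\mathbb E_{\mathbb P}[A\mid X=x]\in H(\alpha,M)$ and $b(x):=\mathbb E_{\mathbb P}[Y\mid X=x]\in H(\beta,M)$, where $C_1,C_2\in\mathbb R$, $\alpha,\beta,M>0$ are fixed known constants. The functional is $\psi(\mathbb P)=\mathbb E_{\mathbb P}[\mathrm{Cov}_{\mathbb P}(A,Y\mid X)]$. Estimator. Let $\mathcal D_1$ be a sample of $n$ i.i.d. observations from $\mathbb P$. Put $\hat b_k(x)=\frac1n\sum_{i\in\mathcal D_1}Y_iK_{V_k}(X_i,x)$ and $\hat\psi^{\mathrm{NR}}_k=\frac1n\sum_{i\in\mathcal D_1}A_i(Y_i-\hat b_k(X_i))$. Rates. The (known) minimax rate for squared error over $\mathcal P_{(\alpha,\beta)}$ is $r_n^*=n^{-1}$ if $\frac{\alpha+\beta}2\ge\frac d4$ and $r_n^*=n^{-\frac{4\alpha+4\beta}{2\alpha+2\beta+d}}$ if $\frac{\alpha+\beta}2<\frac d4$. For a given resolution sequence let $R_n=\sup_{\mathbb P\in\mathcal P_{(\alpha,\beta)}}\mathbb E_{\mathbb P}[(\hat\psi^{\mathrm{NR}}_k-\psi(\mathbb P))^2]$.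 The estimator is minimax rate optimal for a choice of $k$ if $R_n\lesssim r_n^*$. Its best rate is $r_n$ if some choice of $k$ gives $R_n\lesssim r_n$ while every choice gives $R_n\gtrsim r_n$; the best rate ''occurs when choosing'' certain $k$ if these give $R_n\lesssim r_n$.
   Formalization: The impossibility and best-rate claims assume that H(α,M) and H(β,M) each contain, with norm strictly below M, a function with values strictly between C1 and C2 on the cube; without this they fail, e.g. for C1=C2=0, where A=Y=0 and the risk is 0. *)

(* Defs.v *)
From HB Require Import structures.
From mathcomp Require Import all_boot all_order all_algebra.
From mathcomp Require Import all_classical all_reals all_analysis.

Set Implicit Arguments.
Unset Strict Implicit.
Unset Printing Implicit Defensive.

Import Order.TTheory GRing.Theory Num.Theory.
Import numFieldNormedType.Exports.

Local Open Scope classical_set_scope.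
Local Open Scope ring_scope.

Definition tuple_cons d (T : measurableType d) (n : nat)
    (x : T * n.-tuple T) : n.+1.-tuple T :=
  [the n.+1.-tuple T of x.1 :: x.2].

Lemma measurable_tuple_cons d (T : measurableType d) (n : nat) :
  measurable_fun [set: T * n.-tuple T] (@tuple_cons d T n).
Proof. exact: measurable_cons. Qed.

HB.instance Definition _ d (T : measurableType d) (n : nat) :=
  isMeasurableFun.Build _ _ _ _ (@tuple_cons d T n)
    (@measurable_tuple_cons d T n).

(* The law of [n] i.i.d. draws from [P]. *)
Fixpoint iid d (T : measurableType d) (R : realType) (P : probability T R)
    (n : nat) : probability (n.-tuple T) R :=
  match n with
  | 0 => dirac [tuple]
  | m.+1 => distribution (P \x iid P m)%E (@tuple_cons d T m)
  end.

Notation covariate R d := (d.-tuple (measurableTypeR R)).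

Definition cube (R : realType) (d : nat) : set (covariate R d) :=
  [set x | forall i, 0 <= tnth x i <= 1].

Definition unif_cube (R : realType) (d : nat) : probability (covariate R d) R :=
  iid (uniform_prob (@ltr01 R)) d.

(* A function on the cube is represented by a function on all of [R^d], of
   which only the values on the cube matter. *)
Definition inner_cube (R : realType) (d : nat) (f g : covariate R d -> R) : R :=
  \int[unif_cube R d]_(x in @cube R d) (f x * g x).

Definition wavelet_type (d : nat) := {ffun 'I_d -> bool}.

Definition spanned (R : realType) (d : nat) (I : finType)
    (F : I -> covariate R d -> R) (f : covariate R d -> R) : Prop :=
  exists c : I -> R,
    {ae unif_cube R d, forall x, @cube R d x -> f x = \sum_i c i * F i x}.

(* Orthonormal multiresolution bases of [L^2([0,1]^d)] of Cohen-Daubechies-Vial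
   type with regularity [S] and coarsest level [J0]; level [j] has mesh [2^-j].
   Regularity [S]: polynomials of degree at most [S - 1] are reproduced; together
   with orthogonality this gives the [S] vanishing moments of the wavelets.  No
   smoothness and no tensor product form is imposed, so the class contains the
   Cohen-Daubechies-Vial bases (and, for S = 1, the Haar basis).
   [cdv_psi l iota] is meant only for [J0 <= l] and [iota] not identically
   [false], and [cdv_phi j] only for [J0 <= j]. *)
Record cdv_basis (R : realType) (d S J0 : nat) := CdvBasis {
  cdv_idx : nat -> finType ;
  cdv_phi : forall j, cdv_idx j -> covariate R d -> R ;
  cdv_psi : forall l, wavelet_type d -> cdv_idx l -> covariate R d -> R ;
  cdv_card : exists c C : R, [/\ 0 < c, 0 < C & forall j, (J0 <= j)%N ->
    c * 2 ^+ (j * d) <= #|cdv_idx j|%:R <= C * 2 ^+ (j * d)] ;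
  cdv_phi_meas : forall j m, (J0 <= j)%N ->
    measurable_fun [set: covariate R d] (@cdv_phi j m) ;
  cdv_psi_meas : forall l iota m, (J0 <= l)%N -> iota != [ffun=> false] ->
    measurable_fun [set: covariate R d] (@cdv_psi l iota m) ;
  cdv_phi_orth : forall j (m m' : cdv_idx j), (J0 <= j)%N ->
    inner_cube (cdv_phi m) (cdv_phi m') = (m == m')%:R ;
  cdv_phi_psi_orth : forall l iota (m : cdv_idx J0) (m' : cdv_idx l),
    (J0 <= l)%N -> iota != [ffun=> false] ->
    inner_cube (cdv_phi m) (cdv_psi iota m') = 0 ;
  cdv_psi_orth : forall l iota iota' (m m' : cdv_idx l),
    (J0 <= l)%N -> iota != [ffun=> false] -> iota' != [ffun=> false] ->
    inner_cube (cdv_psi iota m) (cdv_psi iota' m') =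
      ((iota == iota') && (m == m'))%:R ;
  cdv_psi_orth_levels : forall l l' iota iota' (m : cdv_idx l) (m' : cdv_idx l'),
    (J0 <= l)%N -> (J0 <= l')%N -> l != l' ->
    iota != [ffun=> false] -> iota' != [ffun=> false] ->
    inner_cube (cdv_psi iota m) (cdv_psi iota' m') = 0 ;
  (* every square-integrable function is the L^2 limit of its expansion *)
  cdv_complete : forall f : covariate R d -> R,
    measurable_fun (@cube R d) f ->
    (\int[unif_cube R d]_(x in @cube R d) ((f x) ^+ 2)%:E < +oo)%E ->
    (\int[unif_cube R d]_(x in @cube R d)
       ((f x - (\sum_m inner_cube f (@cdv_phi J0 m) * @cdv_phi J0 m x
          + \sum_(J0 <= l < L) \sum_(iota | iota != [ffun=> false])
              \sum_m inner_cube f (@cdv_psi l iota m) * @cdv_psi l iota m x)) ^+ 2)%:E)%E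
      @[L --> \oo] --> 0%E ;
  (* V_{j+1} = V_j + span {Psi_{jm}}; in particular the V_j are nested *)
  cdv_multires : forall j (f : covariate R d -> R), (J0 <= j)%N ->
    spanned (@cdv_phi j.+1) f <->
    exists g w : covariate R d -> R, [/\
      spanned (@cdv_phi j) g,
      spanned (fun i : {iota : wavelet_type d | iota != [ffun=> false]} * cdv_idx j
                 => @cdv_psi j (val i.1) i.2) w
      & {ae unif_cube R d, forall x, @cube R d x -> f x = g x + w x}] ;
  cdv_phi_bound : exists C : R, forall j m x, (J0 <= j)%N -> @cube R d x ->
    `|@cdv_phi j m x| <= C * Num.sqrt (2 ^+ (j * d)) ;
  cdv_phi_supp : exists C : R, forall j m, (J0 <= j)%N ->
    exists x0 : covariate R d, forall x, @cube R d x -> @cdv_phi j m x != 0 ->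
      forall i, `|tnth x i - tnth x0 i| <= C / 2 ^+ j ;
  cdv_psi_supp : exists C : R, forall l iota m,
    (J0 <= l)%N -> iota != [ffun=> false] ->
    exists x0 : covariate R d, forall x, @cube R d x -> @cdv_psi l iota m x != 0 ->
      forall i, `|tnth x i - tnth x0 i| <= C / 2 ^+ l ;
  (* polynomials of total degree at most S - 1, through their monomials *)
  cdv_poly : forall j (e : 'I_d -> nat), (J0 <= j)%N -> (\sum_i e i < S)%N ->
    spanned (@cdv_phi j) (fun x => \prod_i tnth x i ^+ e i)
}.

Definition proj_kernel (R : realType) (d S J0 : nat) (W : cdv_basis R d S J0)
    (j : nat) (x y : covariate R d) : R :=
  \sum_m @cdv_phi _ _ _ _ W j m x * @cdv_phi _ _ _ _ W j m y.

Definition holder_norm (R : realType) (d S J0 : nat) (W : cdv_basis R d S J0)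
    (alpha : R) (h : covariate R d -> R) : \bar R :=
  ((2 `^ (J0%:R * (alpha + d%:R / 2))
      * \big[Num.max/0]_m `|inner_cube h (@cdv_phi _ _ _ _ W J0 m)|)%:E
   + ereal_sup [set r | exists l iota (m : cdv_idx W l),
       [/\ (J0 <= l)%N, iota != [ffun=> false]
         & r = (2 `^ (l%:R * (alpha + d%:R / 2))
                  * `|inner_cube h (cdv_psi iota m)|)%:E]])%E.

Definition unif_continuous_cube (R : realType) (d : nat) (h : covariate R d -> R) :=
  forall e : R, 0 < e -> exists2 del : R, 0 < del &
    forall x y, @cube R d x -> @cube R d y ->
      (forall i, `|tnth x i - tnth y i| < del) -> `|h x - h y| < e.

Definition holder_ball (R : realType) (d S J0 : nat) (W : cdv_basis R d S J0)
    (alpha M : R) : set (covariate R d -> R) :=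
  [set h | unif_continuous_cube h /\ (holder_norm W alpha h <= M%:E)%E].

Notation obs R d :=
  (d.-tuple (measurableTypeR R) * measurableTypeR R * measurableTypeR R)%type.

Definition obsX (R : realType) (d : nat) (z : obs R d) : covariate R d := z.1.1.
Definition obsA (R : realType) (d : nat) (z : obs R d) : R := z.1.2.
Definition obsY (R : realType) (d : nat) (z : obs R d) : R := z.2.

(* [g] is a version of the regression function x |-> E_P[f | X = x]. *)
Definition is_cond_exp (R : realType) (d : nat) (P : probability (obs R d) R)
    (f : obs R d -> R) (g : covariate R d -> R) : Prop :=
  [/\ measurable_fun [set: covariate R d] g,
      P.-integrable [set: obs R d] (fun z => (g (obsX z))%:E)
    & forall B : set (covariate R d), measurable B ->
        (\int[P]_(z in @obsX R d @^-1` B) (g (obsX z))%:E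
         = \int[P]_(z in @obsX R d @^-1` B) (f z)%:E)%E].

(* An arbitrary version of x |-> E_P[f | X = x], zero if there is none. *)
Definition cond_exp (R : realType) (d : nat) (P : probability (obs R d) R)
    (f : obs R d -> R) : covariate R d -> R :=
  xget (fun=> 0) [set g | is_cond_exp P f g].

Definition cond_cov (R : realType) (d : nat) (P : probability (obs R d) R)
    : covariate R d -> R :=
  let p := cond_exp P (@obsA R d) in
  let b := cond_exp P (@obsY R d) in
  cond_exp P (fun z => (obsA z - p (obsX z)) * (obsY z - b (obsX z))).

Definition psi_cov (R : realType) (d : nat) (P : probability (obs R d) R) : R :=
  \int[P]_z cond_cov P (obsX z).

Definition model_class (R : realType) (d S J0 : nat) (W : cdv_basis R d S J0)
    (C1 C2 alpha beta M : R) : set (probability (obs R d) R) :=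
  [set P : probability (obs R d) R |
    [/\ forall B : set (covariate R d), measurable B ->
          P (@obsX R d @^-1` B) = unif_cube R d B,
        {ae P, forall z, C1 <= obsA z <= C2 /\ C1 <= obsY z <= C2},
        exists2 p, is_cond_exp P (@obsA R d) p & holder_ball W alpha M p
      & exists2 b, is_cond_exp P (@obsY R d) b & holder_ball W beta M b]].

(* Both Hoelder balls contain a function strictly inside all the constraints.
   This always holds when C1 < C2 and 0 lies in [C1, C2]; if it fails, the model
   can be empty or reduced to a single law with A and Y constant. *)
Definition nondegenerate_model (R : realType) (d S J0 : nat) (W : cdv_basis R d S J0)
    (C1 C2 alpha beta M : R) : Prop :=
  forall gamma, gamma = alpha \/ gamma = beta ->
    exists h : covariate R d -> R, [/\ unif_continuous_cube h,
      (holder_norm W gamma h < M%:E)%E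
      & forall x, @cube R d x -> C1 < h x < C2].

Definition b_hat (R : realType) (d S J0 : nat) (W : cdv_basis R d S J0)
    (j n : nat) (z : n.-tuple (obs R d)) (x : covariate R d) : R :=
  n%:R^-1 * \sum_(i < n) obsY (tnth z i) * proj_kernel W j (obsX (tnth z i)) x.

Definition psi_NR (R : realType) (d S J0 : nat) (W : cdv_basis R d S J0)
    (j n : nat) (z : n.-tuple (obs R d)) : R :=
  n%:R^-1 * \sum_(i < n)
    obsA (tnth z i) * (obsY (tnth z i) - b_hat W j z (obsX (tnth z i))).

(* [j n] is the level of the resolution k = 2^(j n * d) used at sample size n. *)
Definition max_risk (R : realType) (d S J0 : nat) (W : cdv_basis R d S J0)
    (C1 C2 alpha beta M : R) (j : nat -> nat) (n : nat) : \bar R :=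
  ereal_sup [set r | exists2 P : probability (obs R d) R, model_class W C1 C2 alpha beta M P &
    r = (\int[iid P n]_z ((psi_NR W (j n) z - psi_cov P) ^+ 2)%:E)%E].

Definition lesssim (R : realType) (a b : nat -> \bar R) : Prop :=
  exists2 C : R, 0 < C &
    exists n0, forall n, (n0 <= n)%N -> (a n <= C%:E * b n)%E.

Definition asymp (R : realType) (a b : nat -> \bar R) : Prop :=
  lesssim a b /\ lesssim b a.

Definition level_seq (J0 : nat) (j : nat -> nat) : Prop :=
  forall n, (J0 <= j n)%N.

Definition resolution (R : realType) (d : nat) (j : nat -> nat) (n : nat)
    : \bar R := (2 ^+ (j n * d))%:E.

Definition npow (R : realType) (e : R) (n : nat) : \bar R := (n%:R `^ e)%:E.

Definition minimax_rate (R : realType) (d : nat) (alpha beta : R)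
    : nat -> \bar R :=
  if d%:R / 4 <= (alpha + beta) / 2 then npow (-1)
  else npow (- ((4 * alpha + 4 * beta) / (2 * alpha + 2 * beta + d%:R))).

Definition minimax_optimal (R : realType) (d S J0 : nat)
    (W : cdv_basis R d S J0) (C1 C2 alpha beta M : R) (j : nat -> nat) : Prop :=
  lesssim (max_risk W C1 C2 alpha beta M j) (minimax_rate d alpha beta).

Definition best_rate (R : realType) (d S J0 : nat) (W : cdv_basis R d S J0)
    (C1 C2 alpha beta M : R) (r : nat -> \bar R) : Prop :=
  (exists2 j, level_seq J0 j & lesssim (max_risk W C1 C2 alpha beta M j) r) /\
  (forall j, level_seq J0 j -> lesssim r (max_risk W C1 C2 alpha beta M j)).

(* Main.v *)
Require Import Defs.
From HB Require Import structures.
From mathcomp Require Import all_boot all_order all_algebra.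
From mathcomp Require Import all_classical all_reals all_analysis.
From mathcomp Require Import measurable_realfun.
From mathcomp Require Import ring lra.
Import Order.TTheory GRing.Theory Num.Theory.
Import numFieldNormedType.Exports.
Local Open Scope classical_set_scope.
Local Open Scope ring_scope.
Set Implicit Arguments.
Unset Strict Implicit.
Unset Printing Implicit Defensive.

(** Write [s = alpha + beta], [k = 2 ^ (j d)], and [p], [b] for the regression
    functions of [A] and [Y].  The estimator is the mean of [A Y] minus the sum
    over [m] of the products of the means of [A Phi_m(X)] and [Y Phi_m(X)].
    Expanding each product around the expectations of its factors
    ([plug_in_decomp], [targetE]) splits the error into

    - a centered mean of bounded terms, of variance of order [1 / n];
    - the projection error [D = <p, b> - sum_m <p, Phi_m> <b, Phi_m>];
    - minus [Q], a sum of [|Z_k|] products of two centered means.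

    Upper bound.  On the Hoelder balls the wavelet coefficients decay
    geometrically in the level, so [|D|] is at most of order [k ^ (- s / d)]
    ([proj_error]).  The two means in a term of [Q] use the same observations,
    so [Q] has a mean of order [k / n]; a fourth moment computation ([Ex_tsum4])
    gives [E Q ^ 2] of order at most [(k / n) ^ 2 + (k / n) ^ 3], by the
    normalization of the scaling functions and their sup bound.  Together
    ([max_risk_le]) the risk is at most of order
    [1 / n + k ^ (- 2 s / d) + (k / n) ^ 2 + (k / n) ^ 3].  Every term is at
    most of order [1 / n] for [k] between [n ^ (d / (2 s))] and [sqrt n], and, when
    [s < d], of order [n ^ (- 2 s / (s + d))] for [k] of order
    [n ^ (d / (s + d))] ([max_risk_rate]).

    Lower bound.  The risk is at least the squared bias, and the bias [D - E Q]
    is an explicit functional of [p], [b] and the conditional covariance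
    ([bias_le_risk], [nr_bias]).  Two kinds of perturbation make it large
    ([max_risk_ge]).  Reversing the sign of the conditional covariance changes
    the bias by an amount of order [k / n], so it is that large for one of the
    two signs.  Adding to [p] and [b] a plane wave of frequency at most of order [2 ^ j],
    with amplitudes [2 ^ (- j alpha)] and [2 ^ (- j beta)] and independent signs,
    the mixed second difference of the bias over the signs leaves only the value
    of the bilinear part of the bias on the wave.  By counting dimensions
    some wave keeps at least half of its squared norm outside [V_k] ([invisible_wave]), so
    this value is of order [k ^ (- s / d)] as long as [k] is below a small
    multiple of [n].  For every [k] the larger of [k / n] and [k ^ (- s / d)] is
    at least [n ^ (- s / (s + d))] ([rate_le_max_risk]).  When [s < d] the square
    of this rate exceeds both forms of the minimax rate by a power of [n]. *)

(** * Expectations of bounded measurable functions *)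

Section BoundedMeasurable.
Context {R : realType} {dT : measure_display} {T : measurableType dT}.
Implicit Types (f g : T -> R).

(** Such functions are integrable for every probability and stable under all the
    operations used below, so that integrability is never an issue. *)
Definition bm f := measurable_fun [set: T] f /\ exists C : R, forall x, `|f x| <= C.

Lemma bm_cst (c : R) : bm (fun=> c).
Proof. by split; [exact: measurable_cst | exists `|c|]. Qed.

Lemma bmD f g : bm f -> bm g -> bm (fun x => f x + g x).
Proof.
move=> [mf [C fC]] [mg [D gD]]; split; first exact: measurable_funD.
by exists (C + D) => x; rewrite (le_trans (ler_normD _ _))// lerD.
Qed.

Lemma bmM f g : bm f -> bm g -> bm (fun x => f x * g x).
Proof.
move=> [mf [C fC]] [mg [D gD]]; split; first exact: measurable_funM.
by exists (C * D) => x; rewrite normrM ler_pM.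
Qed.

Lemma bmZ c f : bm f -> bm (fun x => c * f x).
Proof. by move=> bf; apply: bmM => //; exact: bm_cst. Qed.

Lemma bmN f : bm f -> bm (fun x => - f x).
Proof.
move=> bf; rewrite (_ : (fun x => _) = (fun x => -1 * f x)); first exact: bmZ.
by apply/funext => x; rewrite mulN1r.
Qed.

Lemma bmB f g : bm f -> bm g -> bm (fun x => f x - g x).
Proof. by move=> bf bg; apply: bmD => //; exact: bmN. Qed.

Lemma bm_exp n f : bm f -> bm (fun x => f x ^+ n).
Proof.
move=> bf; elim: n => [|n IH].
  by rewrite (_ : (fun x => _) = fun=> 1); [exact: bm_cst|].
rewrite (_ : (fun x => _) = fun x => f x * f x ^+ n); first exact: bmM.
by apply/funext => x; rewrite exprS.
Qed.

Lemma bm_sum (I : Type) (s : seq I) (Q : pred I) (F : I -> T -> R) :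
  (forall i, Q i -> bm (F i)) -> bm (fun x => \sum_(i <- s | Q i) F i x).
Proof.
move=> bF; elim: s => [|i s IH].
  rewrite (_ : (fun x => _) = fun=> 0); first exact: bm_cst.
  by apply/funext => x; rewrite big_nil.
have [Qi|nQi] := boolP (Q i).
  rewrite (_ : (fun x => _) = fun x => F i x + \sum_(i <- s | Q i) F i x).
    by apply: bmD => //; exact: bF.
  by apply/funext => x; rewrite big_cons Qi.
rewrite (_ : (fun x => _) = fun x => \sum_(i <- s | Q i) F i x)//.
by apply/funext => x; rewrite big_cons (negbTE nQi).
Qed.

Lemma bm_norm f : bm f -> bm (fun x => `|f x|).
Proof.
move=> [mf [C fC]]; split.
  exact: (measurableT_comp (@normr_measurable R setT) mf).
by exists C => x; rewrite normr_id.
Qed.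

Lemma bm_indic (A : set T) : measurable A -> bm (\1_A : T -> R).
Proof.
move=> mA; split; first exact: (@measurable_indic _ T R setT A mA).
by exists 1 => x; rewrite indicE; case: (_ \in _); rewrite ?normr1 ?normr0.
Qed.

Lemma bm_restrict (A : set T) f : measurable A -> measurable_fun A f ->
  (exists C, forall x, A x -> `|f x| <= C) -> bm (f \_ A).
Proof.
move=> mA mf [C fC]; split; first by have /(measurable_restrictT f) := mA => H; exact/H.
exists `|C| => x; rewrite patchE; case: ifPn => [/set_mem/fC|_].
  by move/le_trans; apply; exact: ler_norm.
by rewrite normr0.
Qed.

End BoundedMeasurable.

Lemma bm_comp (R : realType) d1 d2 (T1 : measurableType d1)
    (T2 : measurableType d2) (f : T2 -> R) (g : T1 -> T2) :
  bm f -> measurable_fun [set: T1] g -> bm (fun x => f (g x)).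
Proof.
move=> [mf [C fC]] mg; split; first exact: measurableT_comp.
by exists C => x; exact: fC.
Qed.

Section Expectation.
Context {R : realType} {dT : measure_display} {T : measurableType dT}.
Variable P : probability T R.
Implicit Types (f g : T -> R).

Definition Ex f := \int[P]_x f x.

Lemma bm_integrable f : bm f -> P.-integrable setT (EFin \o f).
Proof.
move=> [mf [C fC]]; apply: measurable_bounded_integrable => //.
  exact: fin_num_fun_lty.
exists C; split; first exact: num_real.
by move=> M CM x _ /=; rewrite (le_trans (fC x))// ltW.
Qed.

Lemma ExE f : bm f -> (Ex f)%:E = (\int[P]_x (f x)%:E)%E.
Proof.
move=> bf; rewrite /Ex /Rintegral fineK//.
by apply: integrable_fin_num => //; exact: bm_integrable.
Qed.

Lemma eq_Ex f g : f =1 g -> Ex f = Ex g.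
Proof. by move=> fg; congr Ex; apply/funext. Qed.

Lemma Ex_cst c : Ex (fun=> c) = c.
Proof. rewrite /Ex Rintegral_cst//.
by rewrite (_ : fine _ = fine 1%E) ?mulr1//; congr fine; exact: probability_setT. Qed.

Lemma ExD f g : bm f -> bm g -> Ex (fun x => f x + g x) = Ex f + Ex g.
Proof. by move=> bf bg; apply: RintegralD => //; exact: bm_integrable. Qed.

Lemma ExB f g : bm f -> bm g -> Ex (fun x => f x - g x) = Ex f - Ex g.
Proof. by move=> bf bg; apply: RintegralB => //; exact: bm_integrable. Qed.

Lemma ExZ c f : bm f -> Ex (fun x => c * f x) = c * Ex f.
Proof. by move=> bf; apply: RintegralZl => //; exact: bm_integrable. Qed.

Lemma ExZr c f : bm f -> Ex (fun x => f x * c) = Ex f * c.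
Proof. by move=> bf; apply: RintegralZr => //; exact: bm_integrable. Qed.

Lemma Ex_sum (I : Type) (s : seq I) (Q : pred I) (F : I -> T -> R) :
  (forall i, Q i -> bm (F i)) ->
  Ex (fun x => \sum_(i <- s | Q i) F i x) = \sum_(i <- s | Q i) Ex (F i).
Proof.
move=> bF; elim: s => [|i s IH].
  by rewrite big_nil -[RHS]Ex_cst; apply: eq_Ex => x; rewrite big_nil.
rewrite big_cons; case: ifPn => Qi.
  rewrite -IH -ExD; first by apply: eq_Ex => x; rewrite big_cons Qi.
    exact: bF.
  exact: bm_sum.
by rewrite -IH; apply: eq_Ex => x; rewrite big_cons (negbTE Qi).
Qed.

Lemma Ex_le f g : bm f -> bm g -> (forall x, f x <= g x) -> Ex f <= Ex g.
Proof. by move=> bf bg fg; apply: le_Rintegral => //; exact: bm_integrable. Qed.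

Lemma Ex_le_cst f c : bm f -> (forall x, f x <= c) -> Ex f <= c.
Proof. by move=> bf fc; rewrite -[leRHS]Ex_cst; apply: Ex_le => //; exact: bm_cst. Qed.

Lemma Ex_ge0 f : (forall x, 0 <= f x) -> 0 <= Ex f.
Proof. by move=> f0; exact: Rintegral_ge0. Qed.

Lemma Ex_norm f : bm f -> `|Ex f| <= Ex (fun x => `|f x|).
Proof. by move=> bf; apply: le_normr_Rintegral => //; exact: bm_integrable. Qed.

Lemma Ex_ae f g : measurable_fun setT f -> measurable_fun setT g ->
  {ae P, forall x, f x = g x} -> Ex f = Ex g.
Proof.
move=> mf mg fg; congr fine; apply: ae_eq_integral => //.
- exact/measurable_EFinP.
- exact/measurable_EFinP.
- by apply: filterS fg => x /= ->.
Qed.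

Lemma Ex_indic (A : set T) : measurable A -> (Ex \1_A)%:E = P A.
Proof.
by move=> mA; rewrite ExE; [rewrite integral_indic// setIT | exact: bm_indic].
Qed.

(** Cauchy-Schwarz, from the discriminant of [t |-> Ex ((f - t g)^2)]. *)
Lemma Ex_CS f g : bm f -> bm g ->
  Ex (fun x => f x * g x) ^+ 2 <= Ex (fun x => f x ^+ 2) * Ex (fun x => g x ^+ 2).
Proof.
move=> bf bg.
have bff : bm (fun x => f x ^+ 2) by exact: bm_exp.
have bgg : bm (fun x => g x ^+ 2) by exact: bm_exp.
have bfg : bm (fun x => f x * g x) by exact: bmM.
set a := Ex (fun x => f x ^+ 2); set b := Ex (fun x => g x ^+ 2); set c := Ex _.
have b0 : 0 <= b by apply: Ex_ge0 => x; exact: sqr_ge0.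
have H t : 0 <= a - 2 * t * c + t ^+ 2 * b.
  have -> : a - 2 * t * c + t ^+ 2 * b = Ex (fun x => (f x - t * g x) ^+ 2).
    rewrite -ExZ// -ExZ// -ExB//; last exact: bmZ.
    rewrite -ExD; last 2 first.
    - by apply: bmB => //; exact: bmZ.
    - exact: bmZ.
    by apply: eq_Ex => x; ring.
  by apply: Ex_ge0 => x; exact: sqr_ge0.
have [b00|bn0] := eqVneq b 0.
  have [c0|cn0] := eqVneq c 0; first by rewrite c0 b00 expr0n mulr0.
  have := H ((a + 1) / (2 * c)); rewrite b00 mulr0 addr0.
  rewrite (_ : 2 * _ * _ = a + 1); last by field.
  by rewrite opprD addrA subrr add0r oppr_ge0 ler10.
have bp : 0 < b by rewrite lt_neqAle eq_sym bn0.
have := H (c / b).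
have -> : a - 2 * (c / b) * c + (c / b) ^+ 2 * b = a - c ^+ 2 / b by field.
by rewrite subr_ge0 ler_pdivrMr.
Qed.

Lemma Ex_sqr_le f : bm f -> Ex f ^+ 2 <= Ex (fun x => f x ^+ 2).
Proof.
move=> bf; have := Ex_CS bf (bm_cst 1).
rewrite (_ : Ex (fun x => 1 ^+ 2) = 1) ?mulr1.
  by rewrite (@eq_Ex (fun x => f x * 1) f)// => x; rewrite mulr1.
by rewrite expr1n Ex_cst.
Qed.

End Expectation.

Section Transfer.
Context {R : realType} {d1 d2 : measure_display}.
Context {T1 : measurableType d1} {T2 : measurableType d2}.

Lemma Ex_distribution (P : probability T1 R) (X : {mfun T1 >-> T2}) (f : T2 -> R) :
  bm f -> Ex (distribution P X) f = Ex P (fun x => f (X x)).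
Proof.
move=> bf; congr fine; rewrite integral_distribution//.
  by apply/measurable_EFinP; case: bf.
apply: (@bm_integrable _ _ _ P (fun x => f (X x))).
by apply: bm_comp => //; exact: measurable_funPT.
Qed.

Variables (P1 : probability T1 R) (P2 : probability T2 R).

Lemma bm_Ex_section (F : T1 * T2 -> R) : bm F ->
  bm (fun x => Ex P2 (fun y => F (x, y))).
Proof.
move=> bF; have [mF [C FC]] := bF.
have bFx x : bm (fun y => F (x, y)).
  by apply: bm_comp => //; exact: pair1_measurable.
split.
  apply/measurable_EFinP.
  rewrite (_ : _ \o _ = fubini_F P2 (EFin \o F)).
    by apply: measurable_fubini_F; exact: bm_integrable.
  by apply/funext => x /=; rewrite ExE.
exists C => x; rewrite (le_trans (Ex_norm _ _))//.
rewrite -(Ex_cst P2 C); apply: Ex_le => //; [exact: bm_norm|exact: bm_cst].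
Qed.

Lemma Ex_prod (F : T1 * T2 -> R) : bm F ->
  Ex (P1 \x P2)%E F = Ex P1 (fun x => Ex P2 (fun y => F (x, y))).
Proof.
move=> bF; have bFx x : bm (fun y => F (x, y)).
  by apply: bm_comp => //; exact: pair1_measurable.
apply: EFin_inj; rewrite ExE// ExE; last exact: bm_Ex_section.
rewrite -integral12_prod_meas1; last exact: bm_integrable.
by apply: eq_integral => x _; rewrite ExE.
Qed.

End Transfer.

Section IID.
Context {R : realType} {dT : measure_display} {T : measurableType dT}.
Variable P : probability T R.

Lemma Ex_iid0 (F : 0.-tuple T -> R) : bm F -> Ex (iid P 0) F = F [tuple].
Proof.
move=> bF; apply: EFin_inj; rewrite ExE//= integral_dirac// ?diracT ?mul1e//.
by apply/measurable_EFinP; case: bF.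
Qed.

Lemma bm_cons n (F : n.+1.-tuple T -> R) (x : T) : bm F ->
  bm (fun t : n.-tuple T => F [tuple of x :: t]).
Proof. by move=> bF; apply: bm_comp => //; exact: measurable_cons. Qed.

Lemma Ex_iidS n (F : n.+1.-tuple T -> R) : bm F ->
  Ex (iid P n.+1) F = Ex P (fun x => Ex (iid P n) (fun t => F [tuple of x :: t])).
Proof.
move=> bF; rewrite [LHS]Ex_distribution// Ex_prod//.
by apply: bm_comp => //; exact: measurable_tuple_cons.
Qed.

Lemma bm_Ex_cons n (F : n.+1.-tuple T -> R) : bm F ->
  bm (fun x => Ex (iid P n) (fun t => F [tuple of x :: t])).
Proof.
move=> bF.
have /(bm_Ex_section P (iid P n)) : bm (fun z : T * n.-tuple T => F (tuple_cons z)).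
  by apply: bm_comp => //; exact: measurable_tuple_cons.
by [].
Qed.

Lemma Ex_tnth n (f : T -> R) (i : 'I_n) : bm f ->
  Ex (iid P n) (fun t => f (tnth t i)) = Ex P f.
Proof.
have bt m (j : 'I_m) : bm f -> bm (fun t : m.-tuple T => f (tnth t j)).
  by move=> bf; apply: bm_comp => //; exact: measurable_tnth.
elim: n i => [[]//|n IH] i bf; rewrite Ex_iidS//; last exact: bt.
case: (unliftP ord0 i) => [j ->|->].
  rewrite -[RHS](Ex_cst P); apply: eq_Ex => x; rewrite -(IH j)//.
  by apply: eq_Ex => t; rewrite tnthS.
apply: eq_Ex => x; rewrite -[RHS](Ex_cst (iid P n)).
by apply: eq_Ex => t; rewrite tnth0.
Qed.

Lemma iid_ae n (A : T -> Prop) : {ae P, forall x, A x} ->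
  {ae iid P n, forall t, forall i, A (tnth t i)}.
Proof.
move=> [N [mN N0 AN]].
have H i : {ae iid P n, forall t, ~ N (tnth t i)}.
  have mNi : measurable [set t : n.-tuple T | N (tnth t i)].
    rewrite -[X in measurable X]setTI.
    exact: (@measurable_tnth _ T n i measurableT N mN).
  exists [set t | N (tnth t i)]; split => //; last by move=> x /= /contrapT.
  apply: (etrans (esym (Ex_indic (iid P n) mNi))); congr EFin.
  transitivity (Ex P \1_N).
    rewrite -(Ex_tnth i (bm_indic mN)).
    by apply: eq_Ex => t; rewrite !indicE.
  by apply: EFin_inj; rewrite Ex_indic.
have FF : Filter (almost_everywhere (iid P n)).
  exact: (@ae_filter_ringOfSetsType _ _ _ (iid P n)).
apply: (@filterS _ _ FF _ _ _ (@filter_forall _ _ _ _ FF H)) => t Nt i.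
by apply: contrapT => nA; apply: (Nt i); apply: AN.
Qed.

End IID.

(** * Moments of sums over an i.i.d. sample *)

Ltac bm_step :=
  match goal with
  | |- bm (fun _ => ?c) => exact: bm_cst
  | |- bm (fun x => (@?f x + @?g x)%R) => apply: (@bmD _ _ _ f g)
  | |- bm (fun x => (- @?f x)%R) => apply: (@bmN _ _ _ f)
  | |- bm (fun x => (@?f x * @?g x)%R) => apply: (@bmM _ _ _ f g)
  | |- bm (fun x => @?f x ^+ ?n) => apply: (@bm_exp _ _ _ n f)
  | |- bm (fun x => `|@?f x|) => apply: (@bm_norm _ _ _ f)
  | |- bm (fun x => \sum_(i <- _ | _) _) => apply: bm_sum => ? _
  | |- bm (fun x => ?f x) => change (bm f)
  end.
Ltac bm_tac := repeat first [solve [auto] | bm_step].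

Section SampleSums.
Context {R : realType} {dT : measure_display} {T : measurableType dT}.
Variable P : probability T R.

Definition tsum n (V : T -> R) (t : n.-tuple T) : R := \sum_(i < n) V (tnth t i).

Lemma tsum_cons n (V : T -> R) x (t : n.-tuple T) :
  tsum V [tuple of x :: t] = V x + tsum V t.
Proof.
rewrite /tsum big_ord_recl tnth0; congr (_ + _).
by apply: eq_bigr => i _; rewrite tnthS.
Qed.

Lemma bm_tsum n (V : T -> R) : bm V -> bm (@tsum n V).
Proof.
move=> bV; apply: bm_sum => i _; apply: bm_comp => //; exact: measurable_tnth.
Qed.
Hint Resolve bm_tsum : core.

Lemma Ex_tsum n (V : T -> R) : bm V -> Ex (iid P n) (tsum V) = n%:R * Ex P V.
Proof.
move=> bV; rewrite Ex_sum; last first.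
  by move=> i _; apply: bm_comp => //; exact: measurable_tnth.
rewrite (eq_bigr (fun=> Ex P V)) => [|i _]; last exact: Ex_tnth.
by rewrite sumr_const card_ord mulr_natl.
Qed.

Lemma Ex_tsum_centered n (V : T -> R) : bm V -> Ex P V = 0 ->
  Ex (iid P n) (tsum V) = 0.
Proof. by move=> bV V0; rewrite Ex_tsum// V0 mulr0. Qed.

Lemma Ex_tsum2 n (U V : T -> R) : bm U -> bm V -> Ex P U = 0 -> Ex P V = 0 ->
  Ex (iid P n) (fun t => tsum U t * tsum V t) = n%:R * Ex P (fun x => U x * V x).
Proof.
move=> bU bV U0 V0; elim: n => [|n IH].
  by rewrite Ex_iid0 ?mul0r; [rewrite /tsum !big_ord0 mul0r|bm_tac].
rewrite Ex_iidS; last by bm_tac.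
transitivity (Ex P (fun x => U x * V x + n%:R * Ex P (fun x => U x * V x))).
  apply: eq_Ex => x; rewrite -IH.
  transitivity (Ex (iid P n) (fun t => U x * V x +
      (U x * tsum V t + V x * tsum U t + tsum U t * tsum V t))).
    by apply: eq_Ex => t; rewrite !tsum_cons; ring.
  rewrite ExD; [|by bm_tac|by bm_tac].
  rewrite ExD; [|by bm_tac|by bm_tac].
  rewrite ExD; [|by bm_tac|by bm_tac].
  by rewrite Ex_cst !ExZ ?Ex_tsum_centered// ?mulr0 ?add0r//; exact: bm_tsum.
rewrite ExD; [|by bm_tac|by bm_tac].
by rewrite Ex_cst -natr1; ring.
Qed.

Definition sqnorm (I : finType) (V : I -> T -> R) (x : T) := \sum_m V m x ^+ 2.

(** By induction on [n].  With [Q] the squared norm of the old sum, [N] that of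
    the new observation and [D] their scalar product, the new square is
    [(N + 2 D + Q) ^ 2 <= N ^ 2 + Q ^ 2 + 6 N Q + 4 N D + 4 Q D], because
    [D ^ 2 <= N Q].  The last two terms are odd in an independent centered
    variable and integrate to zero; the third has mean [6 n (E N) ^ 2], and these
    add up to at most [3 n ^ 2 (E N) ^ 2]. *)
Lemma Ex_tsum4 (I : finType) (V : I -> T -> R) n :
  (forall m, bm (V m)) -> (forall m, Ex P (V m) = 0) ->
  Ex (iid P n) (fun t => (\sum_m tsum (V m) t ^+ 2) ^+ 2)
    <= 3 * n%:R ^+ 2 * Ex P (sqnorm V) ^+ 2 + n%:R * Ex P (fun x => sqnorm V x ^+ 2).
Proof.
move=> bV V0; set N := sqnorm V.
have bN : bm N by rewrite /N /sqnorm; bm_tac.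
elim: n => [|n IH].
  rewrite Ex_iid0; last by bm_tac.
  rewrite big1; first by rewrite !(expr0n, mul0r, mulr0) addr0.
  by move=> m _; rewrite /tsum big_ord0 expr0n.
pose Q (t : n.-tuple T) := \sum_m tsum (V m) t ^+ 2.
have bQ : bm Q by rewrite /Q; bm_tac.
pose c m := Ex (iid P n) (fun t => Q t * tsum (V m) t).
have EQ : Ex (iid P n) Q = n%:R * Ex P N.
  rewrite Ex_sum; last by move=> m _; bm_tac.
  rewrite Ex_sum; last by move=> m _; bm_tac.
  rewrite mulr_sumr; apply: eq_bigr => m _.
  rewrite -(eq_Ex _ (f := fun x => V m x * V m x)) => [|x]; last by rewrite expr2.
  by rewrite -Ex_tsum2.
have bL (x : T) : bm (fun t : n.-tuple T => (\sum_m tsum (V m) [tuple of x :: t] ^+ 2) ^+ 2).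
  by apply: (bm_cons (F := fun t => (\sum_m tsum (V m) t ^+ 2) ^+ 2)); bm_tac.
rewrite Ex_iidS; last by bm_tac.
apply: (@le_trans _ _ (Ex P (fun x => (N x ^+ 2 + Ex (iid P n) (fun t => Q t ^+ 2)
    + 6 * N x * Ex (iid P n) Q) + 4 * \sum_m V m x * c m))).
  apply: Ex_le; [|by bm_tac|].
    by apply: (bm_Ex_cons P (F := fun t => (\sum_m tsum (V m) t ^+ 2) ^+ 2)); bm_tac.
  move=> x.
  pose D (t : n.-tuple T) := \sum_m V m x * tsum (V m) t.
  have bD : bm D by rewrite /D; bm_tac.
  have ED : Ex (iid P n) D = 0.
    rewrite Ex_sum; last by move=> m _; bm_tac.
    by apply: big1 => m _; rewrite ExZ ?Ex_tsum_centered ?mulr0//; exact: bm_tsum.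
  have EQD : Ex (iid P n) (fun t => Q t * D t) = \sum_m V m x * c m.
    transitivity (Ex (iid P n) (fun t => \sum_m V m x * (Q t * tsum (V m) t))).
      by apply: eq_Ex => t; rewrite mulr_sumr; apply: eq_bigr => m _; ring.
    rewrite Ex_sum; last by move=> m _; bm_tac.
    by apply: eq_bigr => m _; rewrite ExZ//; bm_tac.
  apply: (@le_trans _ _ (Ex (iid P n) (fun t => N x ^+ 2 + Q t ^+ 2
      + 6 * N x * Q t + 4 * N x * D t + 4 * (Q t * D t)))).
    apply: Ex_le; [exact: bL|by bm_tac|move=> t].
    rewrite (_ : \sum_m _ = N x + 2 * D t + Q t); last first.
      rewrite /N /D /Q mulr_sumr -!big_split/=; apply: eq_bigr => m _.
      by rewrite tsum_cons; ring.
    have : D t ^+ 2 <= N x * Q t.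
      have N0 : 0 <= N x by apply: sumr_ge0 => m _; exact: sqr_ge0.
      have Q0 : 0 <= Q t by apply: sumr_ge0 => m _; exact: sqr_ge0.
      have H s : 0 <= N x - 2 * s * D t + s ^+ 2 * Q t.
        rewrite /N /D /Q !mulr_sumr -sumrB -big_split/=; apply: sumr_ge0 => m _.
        rewrite (_ : _ + _ = (V m x - s * tsum (V m) t) ^+ 2) ?sqr_ge0//.
        by ring.
      have [q0|qn0] := eqVneq (Q t) 0.
        suff -> : D t = 0 by rewrite q0 mulr0 expr0n.
        apply: big1 => m _; apply/eqP; rewrite mulf_eq0; apply/orP; right.
        move/eqP: q0; rewrite /Q psumr_eq0 => [|i _]; last exact: sqr_ge0.
        by move/allP => /(_ m (mem_index_enum _)); rewrite expf_eq0.
      have Qp : 0 < Q t by rewrite lt_neqAle eq_sym qn0.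
      have := H (D t / Q t).
      have -> : N x - 2 * (D t / Q t) * D t + (D t / Q t) ^+ 2 * Q t
          = N x - D t ^+ 2 / Q t by field.
      by rewrite subr_ge0 ler_pdivrMr.
    by nra.
  rewrite ExD; [|by bm_tac|by bm_tac].
  rewrite ExD; [|by bm_tac|by bm_tac].
  rewrite ExD; [|by bm_tac|by bm_tac].
  rewrite ExD; [|by bm_tac|by bm_tac].
  rewrite !ExZ; [|by bm_tac..].
  by rewrite Ex_cst ED EQD mulr0 addr0.
rewrite ExD; [|by bm_tac|by bm_tac].
rewrite ExD; [|by bm_tac|by bm_tac].
rewrite ExD; [|by bm_tac|by bm_tac].
rewrite ExZ; last by bm_tac.
rewrite ExZr; last by bm_tac.
rewrite ExZ; last by bm_tac.
have E0 : Ex P (fun x => \sum_m V m x * c m) = 0.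
  rewrite Ex_sum => [|m _]; last by bm_tac.
  by apply: big1 => m _; rewrite ExZr// V0 mul0r.
rewrite Ex_cst E0 EQ -[n.+1%:R]natr1.
have n0 : 0 <= n%:R :> R by [].
have := sqr_ge0 (Ex P N); move: IH; rewrite -/Q; nra.
Qed.

End SampleSums.
#[global] Hint Resolve bm_tsum : core.

(** * Mean and risk of a plug-in estimator of a sum of products of means *)

Lemma combine_risk_terms (R : realFieldType) (x y z g b X : R) :
  x <= g -> y <= X -> z <= X ->
  3 * x + 3 * b + 3 / 2 * y + 3 / 2 * z <= 3 * (g + b + X).
Proof. by move=> xg yX zX; lra. Qed.

Section PlugIn.
Context {R : realType} {dT : measure_display} {T : measurableType dT}.
Variables (P : probability T R) (n : nat) (I : finType).
Variables (w : T -> R) (u v : I -> T -> R).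
Hypothesis n0 : (0 < n)%N.
Hypotheses (bw : bm w) (bu : forall m, bm (u m)) (bv : forall m, bm (v m)).

Definition smean (V : T -> R) (t : n.-tuple T) : R := n%:R^-1 * tsum V t.

Definition centered (V : T -> R) (x : T) : R := V x - Ex P V.

Definition plug_in (t : n.-tuple T) : R :=
  smean w t - \sum_m smean (u m) t * smean (v m) t.

(** The part of second order.  Factors from different observations have mean
    zero, so its mean is [1 / n] times the sum of the covariances of [u m] and
    [v m]: up to sign, the bias of [plug_in] for [plug_in_target]. *)
Definition plug_in_quad (t : n.-tuple T) : R :=
  \sum_m smean (centered (u m)) t * smean (centered (v m)) t.

Definition plug_in_target : R := Ex P w - \sum_m Ex P (u m) * Ex P (v m).

(** The part of first order, up to an additive constant. *)
Definition plug_in_lin (x : T) : R :=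
  w x - \sum_m (Ex P (u m) * v m x + Ex P (v m) * u m x).

Let n0R : n%:R != 0 :> R. Proof. by rewrite pnatr_eq0 -lt0n. Qed.

Lemma bm_smean (V : T -> R) : bm V -> bm (smean V).
Proof. by move=> bV; rewrite /smean; bm_tac. Qed.
Hint Resolve bm_smean : core.

Lemma bm_centered (V : T -> R) : bm V -> bm (centered V).
Proof. by move=> bV; rewrite /centered; bm_tac. Qed.
Hint Resolve bm_centered : core.

Lemma bm_plug_in : bm plug_in.
Proof. by rewrite /plug_in; bm_tac. Qed.

Lemma bm_plug_in_quad : bm plug_in_quad.
Proof. by rewrite /plug_in_quad; bm_tac. Qed.

Lemma bm_plug_in_lin : bm plug_in_lin.
Proof. by rewrite /plug_in_lin; bm_tac. Qed.
Hint Resolve bm_plug_in bm_plug_in_quad bm_plug_in_lin : core.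

Lemma Ex_centered (V : T -> R) : bm V -> Ex P (centered V) = 0.
Proof. by move=> bV; rewrite ExB ?Ex_cst ?subrr//; exact: bm_cst. Qed.

Lemma Ex_centeredM (U V : T -> R) : bm U -> bm V ->
  Ex P (fun x => centered U x * centered V x)
    = Ex P (fun x => U x * V x) - Ex P U * Ex P V.
Proof.
move=> bU bV.
transitivity (Ex P (fun x => U x * V x - Ex P V * U x - Ex P U * centered V x)).
  by apply: eq_Ex => x; rewrite /centered; ring.
rewrite ExB; [|by bm_tac|by bm_tac].
rewrite ExB; [|by bm_tac|by bm_tac].
by rewrite !ExZ ?Ex_centered//; [ring|exact: bm_centered].
Qed.

Lemma smean_centered (V : T -> R) (t : n.-tuple T) :
  smean (centered V) t = smean V t - Ex P V.
Proof.
rewrite /smean /tsum /centered sumrB mulrBr sumr_const card_ord.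
by rewrite -[Ex P V *+ n]mulr_natr mulrC mulrA -[X in _ - X]mulrA [_ / _]mulrC mulrCA; field.
Qed.

Lemma Ex_smean (V : T -> R) : bm V -> Ex (iid P n) (smean V) = Ex P V.
Proof.
by move=> bV; rewrite ExZ ?Ex_tsum//; [rewrite mulrA mulVf ?mul1r|exact: bm_tsum].
Qed.

Lemma Ex_plug_in_quad : Ex (iid P n) plug_in_quad
  = n%:R^-1 * \sum_m (Ex P (fun x => u m x * v m x) - Ex P (u m) * Ex P (v m)).
Proof.
rewrite Ex_sum => [|m _]; last by bm_tac.
rewrite mulr_sumr; apply: eq_bigr => m _.
transitivity (Ex (iid P n) (fun t => n%:R^-1 ^+ 2
    * (tsum (centered (u m)) t * tsum (centered (v m)) t))).
  by apply: eq_Ex => t; rewrite /smean; ring.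
rewrite ExZ; last by bm_tac.
rewrite Ex_tsum2 ?Ex_centered ?Ex_centeredM//; [|exact: bm_centered..].
by field.
Qed.

(** [x y = x E y + y E x - E x E y + (x - E x) (y - E y)], summed over the
    products. *)
Lemma plug_in_decomp (t : n.-tuple T) : plug_in t
  = smean (centered plug_in_lin) t + plug_in_target - plug_in_quad t.
Proof.
rewrite smean_centered /plug_in_quad.
under [X in _ = _ - X]eq_bigr do rewrite !smean_centered mulrBl !mulrBr.
have -> : smean plug_in_lin t = smean w t
    - \sum_m (Ex P (u m) * smean (v m) t + Ex P (v m) * smean (u m) t).
  rewrite /smean /tsum /plug_in_lin sumrB mulrBr; congr (_ - _).
  rewrite exchange_big mulr_sumr; apply: eq_bigr => m _.
  by rewrite big_split/= -!mulr_sumr; ring.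
have -> : Ex P plug_in_lin = Ex P w - 2 * \sum_m Ex P (u m) * Ex P (v m).
  rewrite ExB; [|by bm_tac|by bm_tac]; congr (_ - _).
  rewrite Ex_sum => [|m _]; last by bm_tac.
  rewrite mulr_sumr; apply: eq_bigr => m _.
  by rewrite ExD ?ExZ//; [ring|by bm_tac..].
rewrite /plug_in /plug_in_target !big_split/= !sumrN !big_split/= !sumrN.
rewrite [X in _ = _ - (_ - X - _)](eq_bigr (fun m => Ex P (v m) * smean (u m) t)) => [|m _]; last first.
  by rewrite mulrC.
ring.
Qed.

Lemma Ex_plug_in : Ex (iid P n) plug_in = plug_in_target
  - n%:R^-1 * \sum_m (Ex P (fun x => u m x * v m x) - Ex P (u m) * Ex P (v m)).
Proof.
rewrite (eq_Ex _ plug_in_decomp) ExB; [|by bm_tac|by bm_tac].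
rewrite ExD; [|by bm_tac|by bm_tac].
by rewrite Ex_cst Ex_smean ?Ex_centered ?add0r ?Ex_plug_in_quad//; exact: bm_centered.
Qed.

Lemma plug_in_bias_le_risk (theta : R) :
  (Ex (iid P n) plug_in - theta) ^+ 2
    <= Ex (iid P n) (fun t => (plug_in t - theta) ^+ 2).
Proof.
have b : bm (fun t => plug_in t - theta) by bm_tac.
apply: le_trans (Ex_sqr_le _ b).
by rewrite ExB ?Ex_cst//; exact: bm_cst.
Qed.

(** Centering does not increase the mean of the squared norm, and multiplies its
    maximum by at most [4]. *)
Lemma Ex_smean4 (V : I -> T -> R) (a s : R) : (forall m, bm (V m)) ->
  Ex P (sqnorm V) <= a -> (forall x, sqnorm V x <= s) ->
  Ex (iid P n) (fun t => (\sum_m smean (centered (V m)) t ^+ 2) ^+ 2)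
    <= 3 * a ^+ 2 / n%:R ^+ 2 + 4 * s * a / n%:R ^+ 3.
Proof.
move=> bV Va Vs.
pose cV m := centered (V m).
have bcV m : bm (cV m) by exact: bm_centered.
have bN : bm (sqnorm V) by rewrite /sqnorm; bm_tac.
have bcN : bm (sqnorm cV) by rewrite /sqnorm; bm_tac.
have N0 (W : I -> T -> R) x : 0 <= sqnorm W x.
  by apply: sumr_ge0 => m _; exact: sqr_ge0.
have EcN : Ex P (sqnorm cV) <= Ex P (sqnorm V).
  rewrite Ex_sum => [|m _]; last by bm_tac.
  rewrite Ex_sum => [|m _]; last by bm_tac.
  apply: ler_sum => m _.
  rewrite (eq_Ex _ (g := fun x => cV m x * cV m x)) => [|x]; last by rewrite expr2.
  rewrite Ex_centeredM// (eq_Ex _ (g := fun x => V m x ^+ 2)) => [|x]; last by rewrite expr2.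
  by rewrite gerBl -expr2 sqr_ge0.
have cNs x : sqnorm cV x <= 4 * s.
  have E2 : \sum_m Ex P (V m) ^+ 2 <= s.
    apply: (@le_trans _ _ (Ex P (sqnorm V))).
      rewrite Ex_sum => [|m _]; last by bm_tac.
      by apply: ler_sum => m _; exact: Ex_sqr_le.
    by rewrite -(Ex_cst P s); apply: Ex_le => //; exact: bm_cst.
  apply: (@le_trans _ _ (\sum_m (2 * V m x ^+ 2 + 2 * Ex P (V m) ^+ 2))).
    apply: ler_sum => m _; rewrite /cV /centered.
    by have := sqr_ge0 (V m x + Ex P (V m)); lra.
  rewrite big_split/= -!mulr_sumr; have := Vs x; rewrite /sqnorm; lra.
have EN2 : Ex P (fun x => sqnorm cV x ^+ 2) <= 4 * s * a.
  apply: (@le_trans _ _ (Ex P (fun x => 4 * s * sqnorm cV x))).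
    apply: Ex_le; [by bm_tac|by bm_tac|move=> x].
    by rewrite expr2 ler_wpM2r.
  rewrite ExZ//; apply: ler_wpM2l; last exact: le_trans Va.
  by apply: le_trans (cNs point); exact: N0.
have H := Ex_tsum4 n bcV (fun m => Ex_centered (bV m)).
have n1 : 0 < n%:R :> R by rewrite ltr0n.
have -> : Ex (iid P n) (fun t => (\sum_m smean (centered (V m)) t ^+ 2) ^+ 2)
    = n%:R^-1 ^+ 4 * Ex (iid P n) (fun t => (\sum_m tsum (cV m) t ^+ 2) ^+ 2).
  rewrite -ExZ; last by bm_tac.
  apply: eq_Ex => t.
  rewrite (_ : \sum_m _ = n%:R^-1 ^+ 2 * \sum_m tsum (cV m) t ^+ 2); first by ring.
  by rewrite mulr_sumr; apply: eq_bigr => m _; rewrite /smean; ring.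
have a0 : Ex P (sqnorm cV) ^+ 2 <= a ^+ 2.
  rewrite ler_sqr ?nnegrE; [exact: le_trans Va|by apply: Ex_ge0|].
  by apply: le_trans Va; apply: Ex_ge0.
apply: (@le_trans _ _ (n%:R^-1 ^+ 4 * (3 * n%:R ^+ 2 * a ^+ 2 + n%:R * (4 * s * a)))).
  apply: ler_wpM2l; first by rewrite exprn_ge0// invr_ge0 ltW.
  apply: le_trans H _; apply: lerD.
    by apply: ler_wpM2l => //; rewrite mulr_ge0// exprn_ge0// ltW.
  by apply: ler_wpM2l => //; exact: ltW.
by rewrite le_eqVlt; apply/orP; left; apply/eqP; field.
Qed.

(** [(L + b - Q) ^ 2 <= 3 (L ^ 2 + b ^ 2 + Q ^ 2)]; the quadratic part satisfies
    [2 |Q| <= U + V] for the squared norms [U], [V] of the two vectors of centered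
    means, whose second moments were bounded above. *)
Lemma plug_in_risk_le (theta G a s : R) :
  Ex P (fun x => plug_in_lin x ^+ 2) <= G ->
  Ex P (sqnorm u) <= a -> Ex P (sqnorm v) <= a ->
  (forall x, sqnorm u x <= s) -> (forall x, sqnorm v x <= s) ->
  Ex (iid P n) (fun t => (plug_in t - theta) ^+ 2)
    <= 3 * (G / n%:R + (plug_in_target - theta) ^+ 2
            + (3 * a ^+ 2 / n%:R ^+ 2 + 4 * s * a / n%:R ^+ 3)).
Proof.
move=> EG ua va us vs.
have n1 : 0 < n%:R :> R by rewrite ltr0n.
pose U t := \sum_m smean (centered (u m)) t ^+ 2.
pose V t := \sum_m smean (centered (v m)) t ^+ 2.
have bU : bm U by rewrite /U; bm_tac.
have bV : bm V by rewrite /V; bm_tac.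
pose L t := smean (centered plug_in_lin) t.
have bL : bm L by rewrite /L; bm_tac.
apply: (@le_trans _ _ (Ex (iid P n) (fun t => 3 * (L t * L t) + 3 * (plug_in_target - theta) ^+ 2
    + (3 / 2) * U t ^+ 2 + (3 / 2) * V t ^+ 2))).
  apply: Ex_le; [by bm_tac|by bm_tac|move=> t].
  rewrite plug_in_decomp -/(L t).
  have Q : plug_in_quad t ^+ 2 <= (U t ^+ 2 + V t ^+ 2) / 2.
    have H : `|plug_in_quad t| <= (U t + V t) / 2.
      apply: le_trans (ler_norm_sum _ _ _) _.
      rewrite /U /V -big_split/= mulr_suml; apply: ler_sum => m _.
      rewrite normrM.
      set x := smean _ _; set y := smean _ _.
      rewrite -(real_normK (num_real x)) -(real_normK (num_real y)).
      by have := sqr_ge0 (`|x| - `|y|); lra.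
    rewrite -real_normK ?num_real//.
    have U0 : 0 <= U t by apply: sumr_ge0 => m _; exact: sqr_ge0.
    have V0 : 0 <= V t by apply: sumr_ge0 => m _; exact: sqr_ge0.
    apply: (@le_trans _ _ (((U t + V t) / 2) ^+ 2)).
      by rewrite ler_sqr ?nnegrE// divr_ge0// addr_ge0.
    by have := sqr_ge0 (U t - V t); lra.
  set b := plug_in_target - theta.
  rewrite (_ : _ - theta = L t + b - plug_in_quad t); last by rewrite /b; ring.
  have := sqr_ge0 (L t - b); have := sqr_ge0 (L t + plug_in_quad t).
  by have := sqr_ge0 (b + plug_in_quad t); lra.
rewrite ExD; [|by bm_tac|by bm_tac].
rewrite ExD; [|by bm_tac|by bm_tac].
rewrite ExD; [|by bm_tac|by bm_tac].
rewrite !ExZ; [|by bm_tac..].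
rewrite Ex_cst.
have EL : Ex (iid P n) (fun t => L t * L t) <= G / n%:R.
  rewrite (eq_Ex _ (g := fun t => n%:R^-1 ^+ 2
      * (tsum (centered plug_in_lin) t * tsum (centered plug_in_lin) t))); last first.
    by move=> t; rewrite /L /smean; ring.
  rewrite ExZ; last by bm_tac.
  rewrite Ex_tsum2 ?Ex_centered ?Ex_centeredM//; [|exact: bm_centered..].
  rewrite (_ : _ ^+ 2 * _ = (Ex P (fun x => plug_in_lin x * plug_in_lin x)
     - Ex P plug_in_lin * Ex P plug_in_lin) / n%:R); last by field.
  rewrite ler_pM2r ?invr_gt0//; apply: le_trans EG.
  rewrite (eq_Ex _ (g := fun x => plug_in_lin x ^+ 2)) => [|x]; last by rewrite expr2.
  by rewrite gerBl -expr2 sqr_ge0.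
have EU := Ex_smean4 bu ua us; have EV := Ex_smean4 bv va vs.
exact: combine_risk_terms EL EU EV.
Qed.

End PlugIn.

(** * The uniform law on the cube *)

Section UnifCube.
Context {R : realType}.
Notation U := (uniform_prob (@ltr01 R)).

Lemma Ex_unif1 (f : R -> R) : bm (f : measurableTypeR R -> R) -> (forall x, 0 <= f x) ->
  (Ex U f)%:E = (\int[lebesgue_measure]_(x in `[0%R, 1%R]) (f x)%:E)%E.
Proof.
move=> bf f0; rewrite ExE// integral_uniform//.
- by rewrite subr0 invr1 mul1e.
- by apply/measurable_EFinP; case: bf.
Qed.

Lemma measurable_cos_affine (a b : R) :
  measurable_fun [set: measurableTypeR R] (fun x : R => cos (a * x + b)).
Proof.
apply: continuous_measurable_fun => x.
apply: (@continuous_comp _ _ _ (fun x : R => a * x + b) cos).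
  by apply: cvgD; [apply: cvgM; [exact: cvg_cst|exact: cvg_id]|exact: cvg_cst].
exact: continuous_cos.
Qed.
Lemma sin_period_int (k : int) (x : R) : sin (2 * pi * k%:~R + x) = sin x.
Proof.
have P n (y : R) : sin (2 * pi * n%:R + y) = sin y.
  rewrite -[in RHS](periodicn (@sinD2pi R) n) addrC; congr (sin (_ + _)).
  by rewrite -[RHS]mulr_natr -[pi *+ 2]mulr_natl.
case: k => n; first exact: P.
rewrite -(P n.+1); congr sin; rewrite NegzE mulrNz -pmulrn.
ring.
Qed.

Lemma is_derive_sin_affine (a b x : R) :
  is_derive x 1 (fun x : R => sin (a * x + b)) (a * cos (a * x + b)).
Proof.
have dA : is_derive x 1 (fun x : R => a * x + b) a.
  have := is_deriveD (is_deriveZ a (is_derive_id x (1 : R))) (is_derive_cst b x (1 : R)).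
  by rewrite addr0 /GRing.scale/= mulr1.
have := @is_derive1_comp _ sin (fun x => a * x + b) x _ _ (is_derive_sin _) dA.
by rewrite mulrC.
Qed.

Lemma is_derive_cos_affine (a b x : R) :
  is_derive x 1 (fun x : R => cos (a * x + b)) (- (a * sin (a * x + b))).
Proof.
have dA : is_derive x 1 (fun x : R => a * x + b) a.
  have := is_deriveD (is_deriveZ a (is_derive_id x (1 : R))) (is_derive_cst b x (1 : R)).
  by rewrite addr0 /GRing.scale/= mulr1.
have := @is_derive1_comp _ cos (fun x => a * x + b) x _ _ (is_derive_cos _) dA.
by rewrite mulrC mulrN.
Qed.

Lemma bm_cos_affine (a b : R) :
  bm (fun x : measurableTypeR R => cos (a * x + b)).
Proof.
by split; [exact: measurable_cos_affine | exists 1 => x; exact: cos_max].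
Qed.

Lemma Ex_unif1_cos (k : int) (b : R) : k != 0 ->
  Ex U (fun x => cos (2 * pi * k%:~R * x + b)) = 0.
Proof.
move=> k0; set a := 2 * pi * k%:~R.
have a0 : a != 0 by rewrite !mulf_neq0// ?intr_eq0// gt_eqF// pi_gt0.
have bc := bm_cos_affine a b.
have b1 : bm (fun x : measurableTypeR R => 1 + cos (a * x + b)).
  by bm_tac.
suff : Ex U (fun x => 1 + cos (a * x + b)) = 1.
  rewrite ExD//; last exact: bm_cst.
  by rewrite Ex_cst => /(canRL (addKr _)); rewrite addNr.
have b0 x : 0 <= 1 + cos (a * x + b).
  have := cos_max (a * x + b); rewrite ler_norml => /andP[+ _].
  by rewrite -subr_ge0 opprK addrC.
apply: EFin_inj; rewrite Ex_unif1//.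
pose F (x : R) := x + a^-1 * sin (a * x + b).
have dF (x : R) : is_derive x 1 F (1 + cos (a * x + b)).
  have := is_deriveD (is_derive_id x (1 : R)) (is_deriveZ a^-1 (is_derive_sin_affine a b x)).
  by rewrite /GRing.scale/= mulrA mulVf// mul1r.
have cF (x : R) : {for x, continuous F}.
  apply: differentiable_continuous; apply/derivable1_diffP.
  by have [] := dF x.
rewrite (@continuous_FTC2 _ _ F)//.
- rewrite /F mulr1 mulr0 add0r sin_period_int -EFinD; congr EFin.
  by rewrite add0r addrK.
- apply: continuous_subspaceT => x.
  apply: differentiable_continuous; apply/derivable1_diffP.
  have [] // := is_deriveD (is_derive_cst (1 : R) x (1 : R)) (is_derive_cos_affine a b x).
- split.
  + by move=> x _; have [] := dF x.
  + exact/cvg_at_right_filter/cF.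
  + exact/cvg_at_left_filter/cF.
- by move=> x _; rewrite derive1E; have [_ ->] := dF x.
Qed.

Lemma unif1_ae : {ae U, forall x, 0 <= x <= 1}.
Proof.
exists (~` `[0, 1]%classic); split.
- by apply: measurableC; exact: measurable_itv.
- rewrite /uniform_prob integral_uniform_pdf setICl.
  exact: integral_set0.
- by move=> x /=; rewrite in_itv.
Qed.

Lemma unif1_itv (a r : R) : 0 <= r ->
  Ex U (\1_(`[a - r, a + r]%classic)) <= 2 * r.
Proof.
move=> r0.
have mI : measurable (`[a - r, a + r]%classic : set R) by exact: measurable_itv.
rewrite -lee_fin Ex_unif1//; last exact: bm_indic.
apply: (@le_trans _ _ (\int[lebesgue_measure]_(x in [set: R]) (\1_(`[a - r, a + r]%classic) x)%:E)%E).
  apply: ge0_subset_integral => //.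
  by apply/measurable_EFinP; have [] := bm_indic (R := R) mI.
rewrite integral_indic// setIT.
have /= mI2 := @lebesgue_measure_itv R `[a - r, a + r].
rewrite [leLHS]mI2 lte_fin; case: ifPn => _; last by rewrite lee_fin mulr_ge0.
by rewrite -EFinD lee_fin; lra.
Qed.

Section Cube.
Variable d : nat.
Notation V := (covariate R d).

Lemma cube_ae : {ae unif_cube R d, forall x, @cube R d x}.
Proof. exact: iid_ae unif1_ae. Qed.

Lemma measurable_coord (i : 'I_d) : measurable_fun [set: V] (fun x : V => tnth x i).
Proof. exact: measurable_tnth. Qed.

Lemma measurable_cube : measurable (@cube R d).
Proof.
rewrite (_ : @cube R d = \bigcap_(i in [set: 'I_d]) [set x : V | 0 <= tnth x i <= 1]).
  apply: fin_bigcap_measurable => // i _.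
  rewrite -[X in measurable X]setTI.
  apply: (measurable_coord i measurableT (Y := `[0, 1]%classic)).
  exact: measurable_itv.
by apply/seteqP; split => x /= H i; [move=> _|]; apply: H.
Qed.

(** The integral over the cube of the basis axioms is an expectation of functions
    cut off outside the cube. *)
Lemma inner_cubeE (f g : V -> R) : inner_cube f g
  = Ex (unif_cube R d) (fun x => (f \_ (@cube R d)) x * (g \_ (@cube R d)) x).
Proof.
rewrite /inner_cube Rintegral_mkcond; apply: eq_Ex => x.
by rewrite !patchE; case: ifPn => // _; rewrite mul0r.
Qed.

Definition box (x0 : V) (r : R) : set V :=
  [set x | forall i, `|tnth x i - tnth x0 i| <= r].

End Cube.

Lemma measurable_box d (x0 : covariate R d) (r : R) : measurable (box x0 r).
Proof.
rewrite (_ : box x0 r = \bigcap_(i in [set: 'I_d])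
    [set x : covariate R d | tnth x i \in `[tnth x0 i - r, tnth x0 i + r]]).
  apply: fin_bigcap_measurable => // i _.
  rewrite -[X in measurable X]setTI.
  apply: (@measurable_coord d i measurableT `[tnth x0 i - r, tnth x0 i + r]%classic).
  exact: measurable_itv.
apply/seteqP; split => x /= H i => [_|].
  by rewrite /= in_itv/= -ler_distl; exact: H.
by have := H i I; rewrite /= in_itv/= -ler_distl.
Qed.

Lemma bm_box d (x0 : covariate R d) (r : R) : bm (\1_(box x0 r) : covariate R d -> R).
Proof. by apply: bm_indic; exact: measurable_box. Qed.

Lemma Ex_box d (x0 : covariate R d) (r : R) : 0 <= r ->
  Ex (unif_cube R d) \1_(box x0 r) <= (2 * r) ^+ d.
Proof.
move=> r0; elim: d x0 => [|d IH] x0.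
  rewrite expr0; apply: Ex_le_cst => [|x]; first exact: bm_box.
  by rewrite indicE; case: (_ \in _).
rewrite [leLHS]Ex_iidS; last exact: bm_box.
pose y0 : covariate R d := [tuple of behead x0].
pose I : set R := `[tnth x0 ord0 - r, tnth x0 ord0 + r]%classic.
have mI : measurable I by exact: measurable_itv.
apply: (@le_trans _ _ (Ex U (fun x => \1_I x * (2 * r) ^+ d))).
  apply: Ex_le.
  - by apply: (bm_Ex_cons U (F := \1_(box x0 r))); exact: bm_box.
  - by have bI := bm_indic (R := R) mI; bm_tac.
  move=> x; have [Ix|nIx] := boolP (x \in I).
    rewrite indicE Ix mul1r; apply: le_trans (IH y0).
    apply: Ex_le.
    + by apply: (bm_cons (F := \1_(box x0 r))); exact: bm_box.
    + exact: bm_box.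
    move=> t; rewrite !indicE.
    case: (boolP ([tuple of x :: t] \in box x0 r)) => [/set_mem H|_]; last by [].
    rewrite mem_set// => i; have := H (lift ord0 i).
    have -> : tnth y0 i = tnth x0 (lift ord0 i).
      rewrite tnth_behead; congr tnth; apply: val_inj.
      by rewrite /= inordK ?ltnS.
    by rewrite tnthS.
  rewrite [in leRHS]indicE (negbTE nIx) mul0r; apply: Ex_le_cst => [|t].
    by apply: (bm_cons (F := \1_(box x0 r))); exact: bm_box.
  rewrite indicE; case: (boolP (_ \in _)) => // /set_mem /(_ ord0).
  move=> H; case/negP: nIx; rewrite mem_set// /I /= in_itv/= -ler_distl.
  by move: H; rewrite tnth0.
rewrite ExZr; last exact: bm_indic.
by rewrite exprS ler_wpM2r ?unif1_itv// exprn_ge0// mulr_ge0.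
Qed.

Definition dotn d (k : 'I_d -> int) (x : covariate R d) : R :=
  \sum_i (k i)%:~R * tnth x i.

Lemma measurable_dotn d (k : 'I_d -> int) : measurable_fun [set: covariate R d] (dotn k).
Proof.
apply: measurable_sum => i.
by apply: measurable_funM; [exact: measurable_cst | exact: measurable_coord].
Qed.

Definition wave d (k : 'I_d -> int) (b : R) (x : covariate R d) : R :=
  cos (2 * pi * dotn k x + b).

Lemma bm_wave d (k : 'I_d -> int) (b : R) : bm (wave k b).
Proof.
apply: (bm_comp (f := fun y : measurableTypeR R => cos (2 * pi * y + b))).
  exact: bm_cos_affine.
exact: measurable_dotn.
Qed.

(** Integrating coordinate by coordinate, the first nonzero frequency met gives a
    cosine over whole periods. *)
Lemma Ex_wave d (k : 'I_d -> int) (b : R) : (exists i, k i != 0) ->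
  Ex (unif_cube R d) (wave k b) = 0.
Proof.
elim: d k b => [|d IH] k b [i ki0]; first by case: i ki0.
rewrite [LHS]Ex_iidS; last exact: bm_wave.
pose k' j := k (lift ord0 j).
have waveS x (t : covariate R d) : wave k b [tuple of x :: t]
    = wave k' (2 * pi * (k ord0)%:~R * x + b) t.
  rewrite /wave /dotn big_ord_recl tnth0; congr cos.
  rewrite mulrDr -addrA addrC !mulrA -addrA; congr (_ + _); last by rewrite addrC.
  by congr (_ * _); apply: eq_bigr => j _; rewrite tnthS.
have [[j kj]|/forallNP k0] := pselect (exists j, k' j != 0).
  rewrite -[RHS](Ex_cst U); apply: eq_Ex => x.
  rewrite -[RHS](IH k' (2 * pi * (k ord0)%:~R * x + b)); last by exists j.
  by apply: eq_Ex => t; rewrite waveS.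
have k00 : k ord0 != 0.
  case: (unliftP ord0 i) ki0 => [j ->|->//].
  by have /negP := k0 j; rewrite /k' => /negP/[swap] ->.
rewrite -[RHS](Ex_unif1_cos b k00); apply: eq_Ex => x.
rewrite -[RHS](Ex_cst (iid U d)); apply: eq_Ex => t.
rewrite waveS /wave (_ : dotn _ _ = 0) ?mulr0 ?add0r//.
by apply: big1 => j _; have /negP := k0 j; rewrite negbK => /eqP ->; rewrite mul0r.
Qed.

Lemma wave0M d (k l : 'I_d -> int) (x : covariate R d) :
  wave k 0 x * wave l 0 x
    = (wave (fun i => k i + l i) 0 x + wave (fun i => k i - l i) 0 x) / 2.
Proof.
rewrite /wave !addr0.
have -> : dotn (fun i => k i + l i) x = dotn k x + dotn l x.
  by rewrite /dotn -big_split; apply: eq_bigr => i _; rewrite rmorphD mulrDl.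
have -> : dotn (fun i => k i - l i) x = dotn k x - dotn l x.
  by rewrite /dotn -sumrB; apply: eq_bigr => i _; rewrite rmorphB mulrBl.
rewrite (mulrDr (2 * pi) (dotn k x) (dotn l x)) (mulrBr (2 * pi) (dotn k x)).
set u := 2 * pi * dotn k x; set v := 2 * pi * dotn l x.
by rewrite (cosD u v) (cosB u v); field.
Qed.

(** Cosines whose frequencies have positive coordinates: the sum of two such
    frequencies never vanishes, their difference only when they are equal. *)
Lemma Ex_waveM_neq d (k l : 'I_d -> int) :
  (forall i, 0 < k i) -> (forall i, 0 < l i) -> (exists i, k i != l i) ->
  Ex (unif_cube R d) (fun x => wave k 0 x * wave l 0 x) = 0.
Proof.
move=> k0 l0 [i kl]; rewrite (eq_Ex _ (wave0M k l)).
rewrite ExZr; last by apply: bmD; exact: bm_wave.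
rewrite ExD; [|exact: bm_wave..].
rewrite !Ex_wave ?addr0 ?mul0r//; exists i; first by rewrite subr_eq0.
by rewrite gt_eqF// addr_gt0.
Qed.

Lemma Ex_wave_sqr d (k : 'I_d -> int) : (0 < d)%N -> (forall i, 0 < k i) ->
  Ex (unif_cube R d) (fun x => wave k 0 x * wave k 0 x) = 2^-1.
Proof.
case: d k => [//|d] k _ k0; rewrite (eq_Ex _ (wave0M k k)).
rewrite ExZr; last by apply: bmD; exact: bm_wave.
rewrite ExD; [|exact: bm_wave..].
rewrite Ex_wave; last by exists ord0; rewrite gt_eqF// addr_gt0.
rewrite (eq_Ex _ (g := fun=> 1)) ?Ex_cst ?add0r ?mul1r// => x.
rewrite /wave /dotn big1 ?mulr0 ?addr0 ?cos0// => i _.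
by rewrite subrr mul0r.
Qed.

End UnifCube.

(** * Orthonormal families of bounded functions *)

Section OrthonormalFamilies.
Context {R : realType} {dT : measure_display} {T : measurableType dT}.
Variable P : probability T R.
Implicit Types (f g : T -> R).

Lemma aeS (A B : T -> Prop) : (forall x, A x -> B x) ->
  {ae P, forall x, A x} -> {ae P, forall x, B x}.
Proof. by move=> AB; apply: (@filterS _ _ (ae_filter_ringOfSetsType P)). Qed.

Lemma aeS2 (A B C : T -> Prop) : (forall x, A x -> B x -> C x) ->
  {ae P, forall x, A x} -> {ae P, forall x, B x} -> {ae P, forall x, C x}.
Proof. by move=> ABC; apply: (@filterS2 _ _ (ae_filter_ringOfSetsType P)). Qed.

Lemma ae_forall_fin (I : finType) (A : I -> T -> Prop) :
  (forall i, {ae P, forall x, A i x}) -> {ae P, forall x, forall i, A i x}.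
Proof. exact: (@filter_forall _ _ _ _ (ae_filter_ringOfSetsType P)). Qed.

Definition ip f g : R := Ex P (fun x => f x * g x).

Lemma ipC f g : ip f g = ip g f.
Proof. by apply: eq_Ex => x; rewrite mulrC. Qed.

Lemma ipDl f g h : bm f -> bm g -> bm h -> ip (fun x => f x + g x) h = ip f h + ip g h.
Proof.
move=> bf bg bh; rewrite -ExD; [|by bm_tac..].
by apply: eq_Ex => x; rewrite mulrDl.
Qed.

Lemma ipBl f g h : bm f -> bm g -> bm h -> ip (fun x => f x - g x) h = ip f h - ip g h.
Proof.
move=> bf bg bh; rewrite -ExB; [|by bm_tac..].
by apply: eq_Ex => x; rewrite mulrBl.
Qed.

Lemma ipZl c f g : bm f -> bm g -> ip (fun x => c * f x) g = c * ip f g.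
Proof.
move=> bf bg; rewrite -ExZ; last by bm_tac.
by apply: eq_Ex => x; rewrite mulrA.
Qed.

Lemma ip_suml (I : finType) (F : I -> T -> R) g : (forall i, bm (F i)) -> bm g ->
  ip (fun x => \sum_i F i x) g = \sum_i ip (F i) g.
Proof.
move=> bF bg; rewrite -Ex_sum => [|i _]; last by bm_tac.
by apply: eq_Ex => x; rewrite mulr_suml.
Qed.

Lemma ip_ge0 f : 0 <= ip f f.
Proof. by apply: Ex_ge0 => x; rewrite -expr2 sqr_ge0. Qed.

Lemma ip_CS f g : bm f -> bm g -> ip f g ^+ 2 <= ip f f * ip g g.
Proof.
move=> bf bg; apply: le_trans (Ex_CS P bf bg) _.
by rewrite le_eqVlt; apply/orP; left; apply/eqP; congr (_ * _); apply: eq_Ex => x; rewrite expr2.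
Qed.

Lemma ip_ae f f' g g' : measurable_fun setT f -> measurable_fun setT f' ->
  measurable_fun setT g -> measurable_fun setT g' ->
  {ae P, forall x, f x = f' x} -> {ae P, forall x, g x = g' x} -> ip f g = ip f' g'.
Proof.
move=> mf mf' mg mg' ff' gg'; apply: Ex_ae; [exact: measurable_funM..|].
by apply: aeS2 ff' gg' => x -> ->.
Qed.

Section OneFamily.
Variables (I : finType) (e : I -> T -> R).
Hypothesis be : forall i, bm (e i).
Hypothesis one : forall i j, ip (e i) (e j) = (i == j)%:R.

Definition lincomb (c : I -> R) (x : T) : R := \sum_i c i * e i x.

Lemma bm_lincomb c : bm (lincomb c).
Proof. by rewrite /lincomb; bm_tac. Qed.

Lemma ip_lincombl c g : bm g -> ip (lincomb c) g = \sum_i c i * ip (e i) g.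
Proof.
move=> bg; rewrite /lincomb ip_suml//; last by move=> i; bm_tac.
by apply: eq_bigr => i _; rewrite ipZl.
Qed.

Lemma ip_lincomb_coef c i : ip (lincomb c) (e i) = c i.
Proof.
rewrite ip_lincombl// (bigD1 i)//= one eqxx mulr1 big1 ?addr0// => j ji.
by rewrite one (negbTE ji) mulr0.
Qed.

(** [f] minus its projection has a nonnegative square norm. *)
Lemma bessel f : bm f -> \sum_i ip f (e i) ^+ 2 <= ip f f.
Proof.
move=> bf; pose c i := ip f (e i).
have bc := bm_lincomb c.
have E1 : ip (lincomb c) f = \sum_i ip f (e i) ^+ 2.
  by rewrite ip_lincombl//; apply: eq_bigr => i _; rewrite ipC -expr2.
have E2 : ip (lincomb c) (lincomb c) = \sum_i ip f (e i) ^+ 2.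
  rewrite ip_lincombl//; apply: eq_bigr => i _.
  by rewrite ipC ip_lincomb_coef -expr2.
have := ip_ge0 (fun x => f x - lincomb c x).
rewrite ipBl//; last by bm_tac.
rewrite [X in X - _]ipC [X in _ - X]ipC !ipBl// E1 E2 [ip f (lincomb c)]ipC ?E1.
by rewrite subrr subr0 subr_ge0.
Qed.

End OneFamily.

(** Parseval for two orthonormal bases of one space: the coefficients of one
    basis in the other form an orthogonal matrix. *)
Lemma change_orthonormal (I J : finType) (e : I -> T -> R) (f : J -> T -> R) p b :
  (forall i, bm (e i)) -> (forall i, bm (f i)) ->
  (forall i j, ip (e i) (e j) = (i == j)%:R) ->
  (forall i j, ip (f i) (f j) = (i == j)%:R) ->
  (forall i, exists c, {ae P, forall x, e i x = lincomb f c x}) ->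
  (forall i, exists c, {ae P, forall x, f i x = lincomb e c x}) ->
  bm p -> bm b ->
  \sum_i ip p (e i) * ip b (e i) = \sum_k ip p (f k) * ip b (f k).
Proof.
move=> be bf one onf ef fe bp bb.
have expand (K L : finType) (u : K -> T -> R) (v : L -> T -> R) g i :
    (forall i, bm (u i)) -> (forall i, bm (v i)) ->
    (forall i j, ip (v i) (v j) = (i == j)%:R) ->
    (exists c, {ae P, forall x, u i x = lincomb v c x}) -> bm g ->
    ip g (u i) = \sum_k ip (u i) (v k) * ip g (v k).
  move=> bu bv onv [c uc] bg.
  have bc := bm_lincomb bv c.
  have uE h : bm h -> ip (u i) h = ip (lincomb v c) h.
    by move=> bh; apply: ip_ae uc _; [case: (bu i)|case: bc|case: bh|case: bh|exact: aeW].
  rewrite ipC uE// ip_lincombl//; apply: eq_bigr => k _.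
  by rewrite uE// ip_lincomb_coef// ipC.
transitivity (\sum_i \sum_k ip (e i) (f k) * ip b (f k) * ip p (e i)).
  by apply: eq_bigr => i _; rewrite (expand _ _ e f b)// mulr_sumr; apply: eq_bigr => k _; rewrite mulrC.
rewrite exchange_big; apply: eq_bigr => k _.
rewrite (expand _ _ f e p)// mulr_suml; apply: eq_bigr => i _.
by rewrite [ip (f k) (e i)]ipC; ring.
Qed.

End OrthonormalFamilies.

(** * Bounded versions of the multiresolution basis *)

Section Multiresolution.
Context {R : realType} {d S J0 : nat}.
Variable W : cdv_basis R d S J0.
Notation V := (covariate R d).
Notation mu := (unif_cube R d).
Notation Q := (@cube R d).
Notation phi := (@cdv_phi _ _ _ _ W).
Notation psi := (@cdv_psi _ _ _ _ W).

(** Functions on the cube are only constrained there; cutting them off outside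
    makes those with bounds on the cube bounded everywhere. *)
Definition res (f : V -> R) : V -> R := f \_ Q.

Lemma res_in f x : Q x -> res f x = f x.
Proof. by move=> Qx; rewrite /res patchE mem_set. Qed.

Lemma res_out f x : ~ Q x -> res f x = 0.
Proof. by move=> Qx; rewrite /res patchE memNset. Qed.

Lemma resP f g : (forall x, Q x -> f x = g x) -> res f = res g.
Proof.
move=> fg; apply/funext => x; have [Qx|nQ] := pselect (Q x).
  by rewrite !res_in// fg.
by rewrite !res_out.
Qed.

Lemma res_ae f g : {ae mu, forall x, Q x -> f x = g x} ->
  {ae mu, forall x, res f x = res g x}.
Proof.
apply: aeS => x fg; have [Qx|nQ] := pselect (Q x).
  by rewrite !res_in// fg.
by rewrite !res_out.
Qed.

Lemma res_ae_id f : {ae mu, forall x, res f x = f x}.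
Proof. by apply: aeS (@cube_ae R d) => x; exact: res_in. Qed.

Lemma inner_cube_ip f g : inner_cube f g = ip mu (res f) (res g).
Proof. exact: inner_cubeE. Qed.

Lemma bm_res (f : V -> R) : measurable_fun Q f -> (exists C : R, forall x, Q x -> `|f x| <= C) ->
  bm (res f).
Proof. by move=> mf fC; apply: bm_restrict => //; exact: measurable_cube. Qed.

Lemma measurable_res (f : V -> R) : measurable_fun [set: V] f -> measurable_fun [set: V] (res f).
Proof.
move=> mf; have mQ := @measurable_cube R d.
by have /(measurable_restrictT f) H := mQ; apply/H; exact: measurable_funTS.
Qed.

Lemma bm_res_bm f : bm f -> bm (res f).
Proof.
move=> [mf [C fC]]; split; first exact: measurable_res.
exists C => x; have [Qx|nQ] := pselect (Q x); first by rewrite res_in.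
by rewrite res_out// normr0; exact: le_trans (fC x).
Qed.

Definition wtype := {iota : wavelet_type d | iota != [ffun=> false]}.
Lemma wtypeP (w : wtype) : val w != [ffun=> false].
Proof. by case: w. Qed.

Definition widx (l : nat) := (wtype * cdv_idx W l)%type.

Definition rphi j (m : cdv_idx W j) : V -> R := res (phi m).
Definition raw_psi l (i : widx l) : V -> R := res (psi (val i.1) i.2).

Lemma rphi_bound : exists2 C : R, 0 <= C & forall j (m : cdv_idx W j) x, (J0 <= j)%N ->
  rphi m x ^+ 2 <= C * 2 ^+ (j * d).
Proof.
have [C HC] := cdv_phi_bound W.
exists (C ^+ 2) => [|j m x J0j]; first exact: sqr_ge0.
have [Qx|nQ] := pselect (Q x); last first.
  by rewrite /rphi res_out// expr0n mulr_ge0 ?sqr_ge0// exprn_ge0.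
rewrite /rphi res_in//; have := HC j m x J0j Qx.
have p0 : 0 <= 2 ^+ (j * d) :> R by exact: exprn_ge0.
rewrite -[in X in _ -> _ <= _ * X](sqr_sqrtr p0) -exprMn -[X in _ -> X <= _]real_normK ?num_real// => H.
by rewrite ler_sqr ?nnegrE//; exact: le_trans H.
Qed.

Lemma bm_rphi j (m : cdv_idx W j) : (J0 <= j)%N -> bm (rphi m).
Proof.
move=> J0j; have [C HC] := cdv_phi_bound W.
apply: bm_res.
  by apply: measurable_funTS; exact: cdv_phi_meas.
by exists (C * Num.sqrt (2 ^+ (j * d))) => x Qx; exact: HC.
Qed.

Lemma raw_psi_meas l (i : widx l) : (J0 <= l)%N -> measurable_fun [set: V] (raw_psi i).
Proof.
move=> J0l; apply: measurable_res.
by have := cdv_psi_meas i.2 J0l (wtypeP i.1). Qed.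

Lemma spanned_res (I : finType) (F : I -> V -> R) f : spanned F f ->
  exists c, {ae mu, forall x, res f x = lincomb (fun i => res (F i)) c x}.
Proof.
move=> [c H]; exists c; apply: aeS H => x H; have [Qx|nQ] := pselect (Q x).
  by rewrite res_in// H//; apply: eq_bigr => i _; rewrite res_in.
by rewrite res_out// /lincomb big1// => i _; rewrite res_out// mulr0.
Qed.

Lemma spanned_mem (I : finType) (F : I -> V -> R) i : spanned F (F i).
Proof.
exists (fun k => (k == i)%:R); apply: aeW => x _.
rewrite (bigD1 i)//= eqxx mul1r big1 ?addr0// => k ki.
by rewrite (negbTE ki) mul0r.
Qed.

Lemma spanned0 (I : finType) (F : I -> V -> R) : spanned F (fun=> 0).
Proof. by exists (fun=> 0); apply: aeW => x _; rewrite big1// => i _; rewrite mul0r. Qed.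

Lemma phi_refine j (m : cdv_idx W j) : (J0 <= j)%N ->
  exists c, {ae mu, forall x, rphi m x = lincomb (@rphi j.+1) c x}.
Proof.
move=> J0j; apply: spanned_res; apply/(@cdv_multires _ _ _ _ W j _ J0j).
exists (phi m), (fun=> 0); split; [exact: spanned_mem|exact: spanned0|].
by apply: aeW => x _; rewrite addr0.
Qed.

Lemma psi_refine j (i : widx j) : (J0 <= j)%N ->
  exists c, {ae mu, forall x, raw_psi i x = lincomb (@rphi j.+1) c x}.
Proof.
move=> J0j; apply: spanned_res; apply/(@cdv_multires _ _ _ _ W j _ J0j).
exists (fun=> 0), (psi (val i.1) i.2); split; [exact: spanned0| |].
  exact: (spanned_mem (fun i : widx j => psi (val i.1) i.2)).
by apply: aeW => x _; rewrite add0r.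
Qed.

(** [V_(j+1)] is spanned by [V_j] and the wavelets of level [j]: one half of the
    multiresolution property, the other being [phi_refine] and [psi_refine]. *)
Lemma phi_split j (m : cdv_idx W j.+1) : (J0 <= j)%N -> exists c c',
  {ae mu, forall x, rphi m x = lincomb (@rphi j) c x + lincomb (@raw_psi j) c' x}.
Proof.
move=> J0j.
have /(@cdv_multires _ _ _ _ W j _ J0j) [g [w [/spanned_res[c gc] /spanned_res[c' wc] H]]] :=
  spanned_mem (@cdv_phi _ _ _ _ W j.+1) m.
exists c, c'; have {}H := res_ae H.
apply: (aeS2 _ H (aeS2 (fun x => @conj _ _) gc wc)) => x Hx [<- <-].
rewrite /rphi Hx.
have [Qx|nQ] := pselect (Q x); first by rewrite !res_in.
by rewrite !res_out// addr0.
Qed.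

(** The wavelets carry no explicit sup bound; one holds almost everywhere because
    they are combinations of the finer scaling functions.  The last condition
    keeps the support: a version that is only equal almost everywhere would lose
    it. *)
Definition is_bounded_psi l (i : widx l) (g : V -> R) :=
  [/\ bm g, {ae mu, forall x, raw_psi i x = g x}
    & forall x, g x != 0 -> Q x /\ psi (val i.1) i.2 x != 0].

Definition rpsi l (i : widx l) : V -> R := xget (fun=> 0) [set g | is_bounded_psi i g].

Lemma rpsiP l (i : widx l) : (J0 <= l)%N -> is_bounded_psi i (rpsi i).
Proof.
move=> J0l; rewrite /rpsi; case: xgetP => [g -> //|] /forallNP[].
have [c psic] := psi_refine i J0l.
have bL : bm (lincomb (@rphi l.+1) c).
  by apply: bm_lincomb => m; apply: bm_rphi; exact: leqW.
have [mL [B LB]] := bL.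
have mraw := raw_psi_meas i J0l.
pose A := [set x | `|raw_psi i x| <= B].
have mA : measurable A.
  rewrite -[A]setTI.
  have mn := measurableT_comp (@normr_measurable R setT) mraw.
  rewrite (_ : A = (Num.Def.normr \o raw_psi i) @^-1` `]-oo, B]%classic).
    by apply: (mn measurableT); exact: measurable_itv.
  by apply/seteqP; split => x /=; rewrite /A /= in_itv.
exists (raw_psi i \_ A); split.
- apply: bm_restrict => //; first exact: measurable_funTS.
  by exists B.
- apply: aeS psic => x H; rewrite patchE mem_set// /A /= H; exact: LB.
- move=> x; rewrite patchE; case: ifPn => [_|_]; last by rewrite eqxx.
  rewrite /raw_psi; have [Qx|nQ] := pselect (Q x); first by rewrite res_in.
  by rewrite res_out// eqxx.
Qed.

Lemma bm_rpsi l (i : widx l) : (J0 <= l)%N -> bm (rpsi i).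
Proof. by move=> /(rpsiP i)[]. Qed.

Lemma inner_psi f l (i : widx l) : (J0 <= l)%N -> measurable_fun [set: V] (res f) ->
  inner_cube f (psi (val i.1) i.2) = ip mu (res f) (rpsi i).
Proof.
move=> J0l mf; rewrite inner_cube_ip.
have [[mr _] rae _] := rpsiP i J0l.
by apply: ip_ae => //; [exact: raw_psi_meas|exact: aeW].
Qed.

Lemma rphi_on j (m m' : cdv_idx W j) : (J0 <= j)%N ->
  ip mu (rphi m) (rphi m') = (m == m')%:R.
Proof. by move=> J0j; rewrite -inner_cube_ip cdv_phi_orth. Qed.

Lemma ip_rpsi l l' (i : widx l) (i' : widx l') : (J0 <= l)%N -> (J0 <= l')%N ->
  ip mu (rpsi i) (rpsi i') = inner_cube (psi (val i.1) i.2) (psi (val i'.1) i'.2).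
Proof.
move=> J0l J0l'; rewrite inner_psi//; last exact: raw_psi_meas.
have [[mr _] rae _] := rpsiP i J0l; have [[mr' _] rae' _] := rpsiP i' J0l'.
by apply: ip_ae => //; [exact: raw_psi_meas|apply: aeS rae => x H; exact: esym|exact: aeW].
Qed.

Lemma rpsi_on l (i i' : widx l) : (J0 <= l)%N -> ip mu (rpsi i) (rpsi i') = (i == i')%:R.
Proof.
by move=> J0l; rewrite ip_rpsi// cdv_psi_orth ?wtypeP//.
Qed.

Lemma rpsi_levels l l' (i : widx l) (i' : widx l') : (J0 <= l)%N -> (J0 <= l')%N ->
  l != l' -> ip mu (rpsi i) (rpsi i') = 0.
Proof. by move=> J0l J0l' ll'; rewrite ip_rpsi// cdv_psi_orth_levels//; exact: wtypeP. Qed.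

Lemma phi_split_rpsi j (m : cdv_idx W j.+1) : (J0 <= j)%N -> exists c c',
  {ae mu, forall x, rphi m x = lincomb (@rphi j) c x + lincomb (@rpsi j) c' x}.
Proof.
move=> J0j; have [c [c' H]] := phi_split m J0j; exists c, c'.
have H2 : {ae mu, forall x, forall i : widx j, raw_psi i x = rpsi i x}.
  by apply: ae_forall_fin => i; have [] := rpsiP i J0j.
apply: aeS2 H H2 => x -> Hi; congr (_ + _).
by apply: eq_bigr => i _; rewrite Hi.
Qed.

(** By induction on [j], the level-[j] scaling functions lie in the span of the
    coarsest ones and of the wavelets of lower levels. *)
Lemma rphi_rpsi_orth j l (m : cdv_idx W j) (i : widx l) : (J0 <= j)%N -> (j <= l)%N ->
  ip mu (rphi m) (rpsi i) = 0.
Proof.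
move=> J0j; rewrite -(subnKC J0j) in m *.
move: (j - J0)%N m => k {j J0j}; elim: k => [|k IH] m jl.
  rewrite addn0 in m jl *.
  rewrite -inner_psi//; first by rewrite cdv_phi_psi_orth//; exact: wtypeP.
  by have [] := bm_rphi m (leqnn J0).
rewrite addnS in m jl *.
have J0l : (J0 <= l)%N by rewrite (leq_trans _ jl)// -addnS leq_addr.
have J0k : (J0 <= J0 + k)%N by exact: leq_addr.
have [c [c' H]] := phi_split_rpsi m J0k.
have b1 : bm (lincomb (@rphi (J0 + k)) c) by apply: bm_lincomb => ?; exact: bm_rphi.
have b2 : bm (lincomb (@rpsi (J0 + k)) c') by apply: bm_lincomb => ?; exact: bm_rpsi.
have b3 := bm_rpsi i J0l.
transitivity (ip mu (fun x => lincomb (@rphi (J0 + k)) c x + lincomb (@rpsi (J0 + k)) c' x) (rpsi i)).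
  apply: ip_ae H _.
  - by have [] := bm_rphi m (leqW J0k).
  - by have [] := bmD b1 b2.
  - by case: b3.
  - by case: b3.
  - exact: aeW.
rewrite ipDl// ip_lincombl//; last by move=> ?; exact: bm_rphi.
rewrite ip_lincombl//; last by move=> ?; exact: bm_rpsi.
rewrite big1 ?add0r => [|m' _]; last by rewrite IH ?mulr0// ltnW.
apply: big1 => i' _; rewrite rpsi_levels ?mulr0//.
by rewrite neq_ltn jl.
Qed.

(** The inner product of the projections of [f] and [g] on [V_j], and on the span
    of the wavelets of level [l]. *)
Definition phi_form j f g := \sum_m ip mu f (@rphi j m) * ip mu g (@rphi j m).
Definition psi_form l f g := \sum_(i : widx l) ip mu f (rpsi i) * ip mu g (rpsi i).

(** The scaling functions and the wavelets of level [j] form an orthonormal basis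
    of [V_(j+1)], as the scaling functions of level [j + 1] do. *)
Lemma phi_formS j f g : (J0 <= j)%N -> bm f -> bm g ->
  phi_form j.+1 f g = phi_form j f g + psi_form j f g.
Proof.
move=> J0j bf bg.
pose e (s : cdv_idx W j + widx j) : V -> R :=
  match s with inl m => rphi m | inr i => rpsi i end.
have be s : bm (e s) by case: s => s; [exact: bm_rphi|exact: bm_rpsi].
have J0j1 := leqW J0j.
rewrite /phi_form /psi_form (@change_orthonormal _ _ _ mu _ _ _ e)//.
- by rewrite big_sumType.
- by move=> m; exact: bm_rphi.
- by move=> m m'; exact: rphi_on.
- case=> [m|i] [m'|i'] /=.
  + exact: rphi_on.
  + exact: rphi_rpsi_orth.
  + by rewrite ipC; exact: rphi_rpsi_orth.
  + exact: rpsi_on.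
- move=> m; have [c [c' H]] := phi_split_rpsi m J0j.
  exists (fun s => match s with inl m => c m | inr i => c' i end).
  by apply: aeS H => x ->; rewrite /lincomb big_sumType.
- case=> [m|i] /=; first exact: phi_refine.
  have [c H] := psi_refine i J0j; have [_ H' _] := rpsiP i J0j.
  by exists c; apply: aeS2 H H' => x <- <-.
Qed.

Lemma phi_form_le j f : (J0 <= j)%N -> bm f -> phi_form j f f <= ip mu f f.
Proof.
move=> J0j bf; apply: le_trans (bessel _ _ bf).
- by apply: ler_sum => m _; rewrite -expr2.
- by move=> m; exact: bm_rphi.
- by move=> m m'; exact: rphi_on.
Qed.

End Multiresolution.

(** * Completeness and the projection error on Hoelder balls *)

Section Completeness.
Context {R : realType} {d S J0 : nat}.
Variable W : cdv_basis R d S J0.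
Notation V := (covariate R d).
Notation mu := (unif_cube R d).
Notation Q := (@cube R d).

Lemma sum_widx l (F : wavelet_type d -> cdv_idx W l -> R) :
  \sum_(iota | iota != [ffun=> false]) \sum_m F iota m
    = \sum_(i : widx W l) F (val i.1) i.2.
Proof.
rewrite (reindex_omap (val : @wtype d -> wavelet_type d) insub); last first.
  by move=> i Pi; rewrite insubT.
rewrite (eq_bigl xpredT) => [|[i Pi]]; last by rewrite /= insubT Pi /= eqxx.
by rewrite pair_big.
Qed.

Definition expansion (f : V -> R) (L : nat) (x : V) : R :=
  lincomb (@rphi _ _ _ _ W J0) (fun m => ip mu f (rphi m)) x
  + \sum_(J0 <= l < L) lincomb (@rpsi _ _ _ _ W l) (fun i => ip mu f (rpsi i)) x.

Lemma big_nat_cond_le (F : nat -> R) L :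
  \sum_(J0 <= l < L) F l = \sum_(J0 <= l < L | (J0 <= l)%N) F l.
Proof. by rewrite big_nat_cond [RHS]big_nat_cond; apply: eq_bigl => l; case: (J0 <= l)%N. Qed.

Lemma bm_expansion f L : bm (expansion f L).
Proof.
apply: bmD; first by apply: bm_lincomb => m; exact: bm_rphi.
rewrite (_ : (fun x => _) = fun x => \sum_(J0 <= l < L | (J0 <= l)%N)
    lincomb (@rpsi _ _ _ _ W l) (fun i => ip mu f (rpsi i)) x).
  by apply: bm_sum => l J0l; apply: bm_lincomb => i; exact: bm_rpsi.
by apply/funext => x; rewrite big_nat_cond_le.
Qed.

(** Telescoping [phi_formS] from the coarsest level. *)
Lemma ip_expansion f g L : (J0 <= L)%N -> bm f -> bm g ->
  ip mu (expansion f L) g = phi_form W L f g.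
Proof.
move=> J0L bf bg; rewrite -(subnKC J0L); elim: (L - J0)%N => [|k IH].
  rewrite addn0 /expansion.
  rewrite (_ : ip _ _ _ = ip mu (lincomb (@rphi _ _ _ _ W J0) (fun m => ip mu f (rphi m))) g).
    rewrite ip_lincombl// => [|m]; last exact: bm_rphi.
    by apply: eq_bigr => m _; rewrite [ip mu (rphi m) g]ipC.
  by apply: eq_Ex => x; rewrite big_geq// addr0.
rewrite addnS phi_formS ?leq_addr// -IH.
pose wv := lincomb (@rpsi _ _ _ _ W (J0 + k)) (fun i => ip mu f (rpsi i)).
have bw : bm wv by apply: bm_lincomb => i; apply: bm_rpsi; exact: leq_addr.
have be := bm_expansion f (J0 + k).
transitivity (ip mu (fun x => expansion f (J0 + k) x + wv x) g).
  by apply: eq_Ex => x; rewrite /expansion big_nat_recr ?leq_addr//= addrA.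
rewrite ipDl//; congr (_ + _).
rewrite /wv ip_lincombl// => [|i]; last by apply: bm_rpsi; exact: leq_addr.
by apply: eq_bigr => i _; rewrite [ip mu (rpsi i) g]ipC.
Qed.

(** The completeness of the basis, transferred to the bounded versions of the
    wavelets. *)
Lemma expansion_cvg f : bm f ->
  (Ex mu (fun x => (f x - expansion f L x) ^+ 2))%:E @[L --> \oo] --> 0%E.
Proof.
move=> bf; have [mf [C fC]] := bf.
have mQ := @measurable_cube R d.
have fin : (\int[mu]_(x in Q) ((f x) ^+ 2)%:E < +oo)%E.
  apply: (@le_lt_trans _ _ (\int[mu]_x ((f x) ^+ 2)%:E)%E).
    apply: ge0_subset_integral => //.
    - by apply/measurable_EFinP; exact: measurable_funX.
    - by move=> x _; rewrite lee_fin sqr_ge0.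
  by rewrite -ExE ?ltry//; exact: bm_exp.
have := cdv_complete W (measurable_funTS mf) fin.
apply: cvg_trans; apply: near_eq_cvg; apply: nearW => L.
pose raw x := lincomb (@rphi _ _ _ _ W J0) (fun m => ip mu f (rphi m)) x
  + \sum_(J0 <= l < L) lincomb (@raw_psi _ _ _ _ W l) (fun i => ip mu f (rpsi i)) x.
have ipf g : measurable_fun setT g -> ip mu (res f) g = ip mu f g.
  move=> mg; apply: ip_ae => //; [exact: measurable_res|exact: res_ae_id|exact: aeW].
rewrite ExE; last by apply/bm_exp/bmB => //; exact: bm_expansion.
transitivity (\int[mu]_x ((res f x - raw x) ^+ 2)%:E)%E.
  rewrite [LHS]integral_mkcond; apply: eq_integral => x _.
  have [Qx|nQ] := pselect (Q x); last first.
    rewrite patchE memNset// res_out// /raw /lincomb.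
    rewrite big1 => [|m _]; last by rewrite /rphi res_out// mulr0.
    rewrite big1 ?addr0 ?subr0 ?expr0n// => l _.
    by rewrite big1// => i _; rewrite /raw_psi res_out// mulr0.
  rewrite patchE mem_set// res_in//; congr (((_ - (_ + _)) ^+ 2)%:E).
    apply: eq_bigr => m _; rewrite /rphi res_in// inner_cube_ip ipf//.
    by have [] := bm_rphi m (leqnn J0).
  apply: eq_big_nat => l /andP[J0l _]; rewrite sum_widx; apply: eq_bigr => i _.
  rewrite /raw_psi res_in// inner_psi//; last exact: measurable_res.
  by rewrite ipf//; have [] := bm_rpsi i J0l.
have mraw : measurable_fun [set: V] raw.
  apply: measurable_funD.
    by have [] : bm (lincomb (@rphi _ _ _ _ W J0) (fun m => ip mu f (rphi m)));
      [apply: bm_lincomb => m; exact: bm_rphi|].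
  rewrite (_ : (fun x => _) = fun x => \sum_(J0 <= l < L) if (J0 <= l)%N then
      lincomb (@raw_psi _ _ _ _ W l) (fun i => ip mu f (rpsi i)) x else 0); last first.
    by apply/funext => x; apply: eq_big_nat => l /andP[->].
  apply: measurable_sum => l; case: (boolP (J0 <= l)%N) => J0l; last exact: measurable_cst.
  apply: measurable_sum => i; apply: measurable_funM; first exact: measurable_cst.
  exact: raw_psi_meas.
apply: ae_eq_integral => //.
- by apply/measurable_EFinP/measurable_funX/measurable_funB => //; exact: measurable_res.
- apply/measurable_EFinP; have [] // : bm (fun x => (f x - expansion f L x) ^+ 2).
  by apply/bm_exp/bmB => //; exact: bm_expansion.
have H : {ae mu, forall x, forall l : 'I_L, (J0 <= l)%N -> forall i : widx W l, raw_psi i x = rpsi i x}.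
  apply: ae_forall_fin => l; have [J0l|_] := boolP (J0 <= l)%N; last exact: aeW.
  suff : {ae mu, forall x, forall i : widx W l, raw_psi i x = rpsi i x} by exact: aeS.
  by apply: ae_forall_fin => i; have [] := rpsiP i J0l.
apply: (aeS2 _ (res_ae_id f) H) => x rx Hx _; rewrite rx; congr (((_ - (_ + _)) ^+ 2)%:E).
apply: eq_big_nat => l /andP[J0l lL]; apply: eq_bigr => i _.
by rewrite (Hx (Ordinal lL)).
Qed.

(** The expansions of [f] converge to [f] in mean square, so that
    [phi_form L f g] tends to [ip f g] by Cauchy-Schwarz. *)
Lemma phi_form_limit_le f g j (b : R) : (J0 <= j)%N -> bm f -> bm g ->
  (forall L, (j <= L)%N -> `|phi_form W L f g - phi_form W j f g| <= b) ->
  `|ip mu f g - phi_form W j f g| <= b.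
Proof.
move=> J0j bf bg H; apply/ler_addgt0Pl => e e0.
have G0 := ip_ge0 mu g.
pose K := ip mu g g + 1.
have K0 : 0 < K by rewrite ltr_wpDl.
have e2K : 0 < e ^+ 2 / K by rewrite divr_gt0// exprn_gt0.
have /fine_cvgP[_ /cvgrPdist_le/(_ _ e2K)[N _ HN]] := expansion_cvg bf.
pose L := maxn N j.
have jL : (j <= L)%N by rewrite leq_maxr.
have {HN} := HN L (leq_maxl _ _); rewrite /= sub0r normrN ger0_norm; last first.
  by apply: Ex_ge0 => x; exact: sqr_ge0.
move=> HL; have bE := bm_expansion f L.
have E : ip mu f g - phi_form W L f g = ip mu (fun x => f x - expansion f L x) g.
  by rewrite ipBl// ip_expansion// (leq_trans J0j).
apply: (@le_trans _ _ (`|ip mu f g - phi_form W L f g| + `|phi_form W L f g - phi_form W j f g|)).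
  by apply: le_trans (ler_normD _ _); rewrite addrA subrK.
rewrite addrC [leRHS]addrC; apply: lerD; first exact: H.
rewrite E -ler_sqr ?nnegrE//; last exact: ltW.
rewrite real_normK ?num_real//.
apply: le_trans (ip_CS _ _ _) _ => //; first exact: bmB.
apply: (@le_trans _ _ (e ^+ 2 / K * K)); last by rewrite divfK ?gt_eqF.
apply: ler_pM => //; first exact: ip_ge0.
by rewrite lerDl.
Qed.

End Completeness.

Section HolderProjection.
Context {R : realType} {d S J0 : nat}.
Variable W : cdv_basis R d S J0.
Notation V := (covariate R d).
Notation mu := (unif_cube R d).

Lemma holder_coef alpha M (h : V -> R) l (i : widx W l) :
  (holder_norm W alpha h <= M%:E)%E -> measurable_fun [set: V] (res h) -> (J0 <= l)%N ->
  2 `^ (l%:R * (alpha + d%:R / 2)) * `|ip mu (res h) (rpsi i)| <= M.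
Proof.
move=> hM mh J0l; rewrite -inner_psi// -lee_fin; apply: le_trans hM.
rewrite /holder_norm -[leLHS]add0e; apply: leeD.
  rewrite lee_fin mulr_ge0 ?powR_ge0//.
  by elim/big_ind: _ => // x y x0 y0; rewrite le_max x0.
apply: ereal_sup_ubound; exists l, (val i.1), i.2; split => //; exact: wtypeP.
Qed.

Lemma card_idx_le : exists2 C : R, 0 < C & forall j, (J0 <= j)%N ->
  #|cdv_idx W j|%:R <= C * 2 ^+ (j * d).
Proof.
have [c [C [c0 C0 H]]] := cdv_card W; exists C => // j /H /andP[].
by [].
Qed.

Lemma card_idx_ge : exists2 c : R, 0 < c & forall j, (J0 <= j)%N ->
  c * 2 ^+ (j * d) <= #|cdv_idx W j|%:R.
Proof.
have [c [C [c0 C0 H]]] := cdv_card W; exists c => // j /H /andP[].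
by [].
Qed.

(** Each of the [2 ^ (l d)] wavelets of level [l] contributes at most
    [M ^ 2 2 ^ (- l (alpha + beta + d))]; the levels above [j] then form a
    geometric series. *)
Lemma proj_error alpha beta M : 0 < alpha + beta -> exists2 C : R, 0 <= C &
  forall f g j, bm (res f) -> bm (res g) -> (holder_norm W alpha f <= M%:E)%E ->
    (holder_norm W beta g <= M%:E)%E -> (J0 <= j)%N ->
    `|ip mu (res f) (res g) - phi_form W j (res f) (res g)|
      <= C * (2 `^ (- (alpha + beta))) ^+ j.
Proof.
move=> ab0; have [C C0 HC] := card_idx_le.
pose rho : R := 2 `^ (- (alpha + beta)).
have rho0 : 0 < rho by rewrite powR_gt0.
have rho1 : rho < 1.
  rewrite /rho powRN invf_lt1 ?powR_gt0//.
  rewrite -[ltLHS](_ : 1 `^ (alpha + beta) = 1 :> R); last by rewrite powR1.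
  by apply: gt0_ltr_powR; rewrite ?nnegrE// ltr1n.
pose K := #|{: @wtype d}|%:R * C * M ^+ 2.
have K0 : 0 <= K.
  by apply: mulr_ge0; [apply: mulr_ge0 => //; exact: ltW|exact: sqr_ge0].
exists (K / (1 - rho)) => [|f g j bf bg fM gM J0j].
  by rewrite divr_ge0// subr_ge0 ltW.
have level l : (J0 <= l)%N -> `|psi_form W l (res f) (res g)| <= K * rho ^+ l.
  move=> J0l; apply: le_trans (ler_norm_sum _ _ _) _.
  pose a := 2 `^ (l%:R * (alpha + d%:R / 2)) : R.
  pose b := 2 `^ (l%:R * (beta + d%:R / 2)) : R.
  have a0 : 0 < a by rewrite powR_gt0.
  have b0 : 0 < b by rewrite powR_gt0.
  have ab : a * b = 2 ^+ (l * d) / rho ^+ l.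
    rewrite /a /b -powRD; last by rewrite pnatr_eq0 implybT.
    rewrite -mulrDr addrACA -splitr mulrDr powRD; last by rewrite pnatr_eq0 implybT.
    rewrite mulrC; congr (_ * _).
      by rewrite -natrM powR_mulrn.
    by rewrite /rho powRN exprVn invrK [l%:R * _]mulrC powRrM powR_mulrn// powR_ge0.
  have term (i : widx W l) : `|ip mu (res f) (rpsi i) * ip mu (res g) (rpsi i)| <= M ^+ 2 / (a * b).
    have [mf _] := bf; have [mg _] := bg.
    have fi := holder_coef i fM mf J0l; have gi := holder_coef i gM mg J0l.
    rewrite ler_pdivlMr ?mulr_gt0// normrM expr2.
    rewrite mulrC mulrACA; by apply: ler_pM => //; apply: mulr_ge0 => //; exact: ltW.
  apply: le_trans (ler_sum _ (fun i _ => term i)) _.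
  rewrite sumr_const -mulr_natl card_prod natrM ab.
  rewrite invf_div /K.
  rewrite (_ : _ * C * _ * _ = #|{: @wtype d}|%:R * (C * 2 ^+ (l * d)) * (M ^+ 2 * (rho ^+ l / 2 ^+ (l * d)))); last first.
    by field; rewrite expf_neq0// pnatr_eq0.
  apply: ler_wpM2r.
    by rewrite mulr_ge0 ?sqr_ge0// divr_ge0 ?exprn_ge0// ltW.
  by apply: ler_wpM2l => //; exact: HC.
apply: phi_form_limit_le => // L jL.
suff : `|phi_form W L (res f) (res g) - phi_form W j (res f) (res g)|
    <= K * rho ^+ j * (1 - rho ^+ (L - j)) / (1 - rho).
  move/le_trans; apply; rewrite -/rho mulrAC [leRHS]mulrAC.
  rewrite ler_piMr//; last by rewrite gerBl exprn_ge0// ltW.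
  by rewrite divr_ge0 ?subr_ge0 ?(ltW rho1)// mulr_ge0// exprn_ge0// ltW.
rewrite -(subnKC jL) addKn; elim: (L - j)%N => [|k IH].
  by rewrite addn0 subrr normr0 expr0 subrr mulr0 mul0r.
have J0k : (J0 <= j + k)%N by rewrite (leq_trans J0j) ?leq_addr.
rewrite addnS phi_formS// -addrA addrCA.
apply: le_trans (ler_normD _ _) _.
apply: le_trans (lerD (level _ J0k) IH) _.
rewrite le_eqVlt; apply/orP; left; apply/eqP.
rewrite exprD exprS; field.
by rewrite subr_eq0 gt_eqF.
Qed.

End HolderProjection.

(** * Vanishing moments and the Hoelder norm of a plane wave *)

Section CosTaylor.
Context {R : realType}.

Lemma antiderivative_poly (p : {poly R}) (c : R) :
  exists q : {poly R}, [/\ q^`() = p, q.[0] = c & (size q <= (size p).+1)%N].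
Proof.
exists (\poly_(i < (size p).+1) (if i == 0%N then c else p`_i.-1 / i%:R)); split.
- apply/polyP => i; rewrite coef_deriv coef_poly ltnS /=.
  case: ltnP => [ip|pi]; last by rewrite mul0rn nth_default.
  by rewrite -[LHS]mulr_natr divfK// pnatr_eq0.
- by rewrite horner_coef0 coef_poly.
- exact: size_poly.
Qed.

(** Integrating from [0] the approximation of [- sin (u + b) = cos (u + (b + pi / 2))]
    of order [n]; the phase makes the induction go through with the cosine alone. *)
Lemma cos_taylor (n : nat) (b : R) : exists p : {poly R},
  (size p <= n)%N /\ forall u, `|cos (u + b) - p.[u]| <= `|u| ^+ n.
Proof.
elim: n b => [|n IH] b.
  exists 0; split=> [|u]; first by rewrite size_poly0.
  by rewrite horner0 subr0 expr0 cos_max.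
have [p [sp Hp]] := IH (b + pi / 2).
have [q [dq q0 sq]] := antiderivative_poly p (cos b).
exists q; split=> [|u]; first by rewrite (leq_trans sq).
pose F (u : R) := cos (u + b) - q.[u].
pose dF (u : R) := cos (u + (b + pi / 2)) - p.[u].
have DF (x : R) : is_derive x 1 F (dF x).
  have D1 := is_derive_cos_affine 1 b x.
  have D2 : is_derive x 1 (horner q) p.[x].
    apply: DeriveDef; first exact: derivable_horner.
    by rewrite -derive1E -derivE dq.
  have := is_deriveB D1 D2.
  rewrite mul1r /dF addrA cosDpihalf mul1r.
  rewrite (_ : (fun y : R => cos (1 * y + b)) - horner q = F)//.
  by apply/funext => y; rewrite /F !fctE mul1r.
have F0 : F 0 = 0 by rewrite /F add0r q0 subrr.
have cF (x : R) : {for x, continuous F}.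
  by apply: differentiable_continuous; apply/derivable1_diffP; have [] := DF x.
have bound c : `|c| <= `|u| -> `|dF c * u| <= `|u| ^+ n.+1.
  move=> cu; rewrite normrM exprSr ler_wpM2r//.
  by apply: le_trans (Hp c) _; rewrite lerXn2r ?nnegrE.
rewrite -/(F u); have [u0|u0] := leP 0 u.
  have [c + E] := MVT_segment u0 (fun x _ => DF x) (continuous_subspaceT cF).
  rewrite in_itv/= => /andP[c0 cu]; rewrite -[F u]subr0 -F0 E subr0.
  by apply: bound; rewrite !ger0_norm.
have [c + E] := MVT_segment (ltW u0) (fun x _ => DF x) (continuous_subspaceT cF).
rewrite in_itv/= => /andP[uc c0]; rewrite -normrN -[- F u]add0r -F0 E sub0r mulrN normrN.
by apply: bound; rewrite !ler0_norm ?lerN2// ltW.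
Qed.

End CosTaylor.

Section VanishingMoments.
Context {R : realType} {d S J0 : nat}.
Variable W : cdv_basis R d S J0.
Notation V := (covariate R d).
Notation mu := (unif_cube R d).

(** Coordinate functions, cut off outside the cube so as to be bounded. *)
Definition rcoord (r : 'I_d) : V -> R := res (fun x : V => tnth x r).

Lemma bm_rcoord r : bm (rcoord r).
Proof.
apply: bm_res; first by apply: measurable_funTS; exact: measurable_coord.
exists 1 => x Qx; have /andP[x0 x1] := Qx r.
by rewrite ger0_norm.
Qed.

Definition monomial (e : 'I_d -> nat) (x : V) : R := \prod_r rcoord r x ^+ e r.

Lemma bm_prod (I : eqType) (s : seq I) (F : I -> V -> R) :
  (forall i, bm (F i)) -> bm (fun x => \prod_(i <- s) F i x).
Proof.
move=> bF; elim: s => [|i s IH].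
  rewrite (_ : (fun x => _) = fun=> 1); first exact: bm_cst.
  by apply/funext => x; rewrite big_nil.
rewrite (_ : (fun x => _) = fun x => F i x * \prod_(i <- s) F i x).
  exact: bmM.
by apply/funext => x; rewrite big_cons.
Qed.

Lemma bm_monomial e : bm (monomial e).
Proof. by apply: bm_prod => r; apply: bm_exp; exact: bm_rcoord. Qed.

Variables (l : nat) (i : widx W l).
Hypothesis J0l : (J0 <= l)%N.

(** The monomial lies in [V_J0], to which every wavelet is orthogonal. *)
Lemma monomial_orth e : (\sum_r e r < S)%N -> ip mu (monomial e) (rpsi i) = 0.
Proof.
move=> eS; have [c H] := spanned_res (cdv_poly W (leqnn J0) eS).
have bi := bm_rpsi i J0l.
have bL : bm (lincomb (@rphi _ _ _ _ W J0) c) by apply: bm_lincomb => m; exact: bm_rphi.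
transitivity (ip mu (lincomb (@rphi _ _ _ _ W J0) c) (rpsi i)).
  apply: ip_ae; [by case: (bm_monomial e)|by case: bL|by case: bi|by case: bi| |exact: aeW].
  apply: (aeS2 _ (@cube_ae R d) H) => x Qx; rewrite res_in// /lincomb => <-.
  by apply: eq_bigr => r _; rewrite /rcoord res_in.
rewrite ip_lincombl// => [|m]; last exact: bm_rphi.
by apply: big1 => m _; rewrite rphi_rpsi_orth ?mulr0.
Qed.

Definition lin_form (kappa : 'I_d -> R) (c : R) (x : V) : R :=
  \sum_r kappa r * rcoord r x - c.

Lemma bm_lin_form kappa c : bm (lin_form kappa c).
Proof.
have b := bm_rcoord.
apply: bmB; last exact: bm_cst.
by apply: bm_sum => r _; apply: bmZ.
Qed.

(** Each factor [lin_form] is multiplied out into the monomial, raising its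
    degree by at most one. *)
Lemma lin_form_pow_orth kappa c n e : (n + \sum_r e r < S)%N ->
  ip mu (fun x => lin_form kappa c x ^+ n * monomial e x) (rpsi i) = 0.
Proof.
have bi := bm_rpsi i J0l; have bl := bm_lin_form kappa c.
have bmono := bm_monomial.
elim: n e => [|n IH] e eS.
  by rewrite -(monomial_orth eS); apply: eq_Ex => x; rewrite expr0 mul1r.
pose e' r s := (e s + (s == r))%N.
have e'S r : (n + \sum_s e' r s < S)%N.
  have E1 : (\sum_(s < d) (s == r) = 1)%N.
    by rewrite (bigD1 r)//= eqxx big1 ?addn0// => s /negbTE ->.
  by rewrite /e' big_split/= E1 addn1 addnS -addSn.
have mS r x : monomial (e' r) x = rcoord r x * monomial e x.
  rewrite /monomial (bigD1 r)//= [in RHS](bigD1 r)//= /e' eqxx addn1 exprS -mulrA.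
  congr (_ * (_ * _)); apply: eq_bigr => s sr.
  by rewrite (negbTE sr) addn0.
have bn r : bm (fun x => lin_form kappa c x ^+ n * monomial (e' r) x).
  by apply: bmM => //; exact: bm_exp.
have bn' : bm (fun x => lin_form kappa c x ^+ n * monomial e x).
  by apply: bmM => //; exact: bm_exp.
transitivity (ip mu (fun x => \sum_r kappa r * (lin_form kappa c x ^+ n * monomial (e' r) x)
    - c * (lin_form kappa c x ^+ n * monomial e x)) (rpsi i)).
  apply: eq_Ex => x; congr (_ * _).
  rewrite exprSr -mulrA {2}/lin_form mulrBl mulrBr; congr (_ - _); last by ring.
  rewrite mulr_suml mulr_sumr; apply: eq_bigr => r _.
  by rewrite mS; ring.
rewrite ipBl//; [|by apply: bm_sum => r _; exact: bmZ|exact: bmZ].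
rewrite ip_suml// => [|r]; last exact: bmZ.
rewrite ipZl// IH ?mulr0 ?subr0; last by apply: ltn_trans eS; rewrite addSn.
by apply: big1 => r _; rewrite ipZl// IH ?mulr0.
Qed.

Lemma lin_form_poly_orth kappa c (p : {poly R}) : (size p <= S)%N ->
  ip mu (fun x => p.[lin_form kappa c x]) (rpsi i) = 0.
Proof.
move=> pS; have bi := bm_rpsi i J0l; have bl := bm_lin_form kappa c.
transitivity (ip mu (fun x => \sum_(n < size p) p`_n * lin_form kappa c x ^+ n) (rpsi i)).
  by apply: eq_Ex => x; rewrite horner_coef.
rewrite ip_suml// => [|n]; last by apply: bmZ; exact: bm_exp.
apply: big1 => n _; rewrite ipZl//; last exact: bm_exp.
have -> : ip mu (fun x => lin_form kappa c x ^+ n) (rpsi i)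
    = ip mu (fun x => lin_form kappa c x ^+ n * monomial (fun=> 0%N) x) (rpsi i).
  apply: eq_Ex => x; rewrite /monomial.
  by rewrite (eq_bigr (fun=> 1)) ?big1_eq ?mulr1.
rewrite lin_form_pow_orth ?mulr0// big1 ?addn0//.
exact: leq_trans pS.
Qed.

End VanishingMoments.

Lemma powR2_le (R : realType) (a b : R) : a <= b -> 2 `^ a <= 2 `^ b :> R.
Proof. by move=> ab; apply: ler_powR => //; rewrite ler1n. Qed.

Lemma powR2_le1 (R : realType) (a : R) : a <= 0 -> 2 `^ a <= 1 :> R.
Proof. by move=> /powR2_le; rewrite powRr0. Qed.

Section WaveNorm.
Context {R : realType} {d S J0 : nat}.
Variable W : cdv_basis R d S J0.
Notation V := (covariate R d).
Notation mu := (unif_cube R d).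
Notation Q := (@cube R d).

Lemma rpsi_supp : exists2 C : R, 0 <= C & forall l (i : widx W l), (J0 <= l)%N ->
  exists x0 : V, forall x, rpsi i x != 0 -> Q x /\ box x0 (C / 2 ^+ l) x.
Proof.
have [C HC] := cdv_psi_supp W; exists `|C| => // l i J0l.
have [x0 H] := HC l (val i.1) i.2 J0l (wtypeP i.1).
exists x0 => x xn0; have [_ _ /(_ x xn0)[Qx psix]] := rpsiP i J0l.
split=> // r; apply: le_trans (H x Qx psix r) _.
by rewrite ler_pM2r ?invr_gt0 ?exprn_gt0// ler_norm.
Qed.

(** Cauchy-Schwarz on the support of the wavelet, a set of measure of order
    [2 ^ (- l d)]. *)
Lemma ip_rpsi_small : exists2 C : R, 0 <= C & forall l (i : widx W l) g (e : R),
  (J0 <= l)%N -> bm g -> 0 <= e ->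
  (forall x, rpsi i x != 0 -> `|g x| <= e) ->
  2 ^+ (l * d) * ip mu g (rpsi i) ^+ 2 <= C * e ^+ 2.
Proof.
have [C C0 HC] := rpsi_supp; exists ((2 * C) ^+ d) => [|l i g e J0l bg e0 ge].
  by rewrite exprn_ge0// mulr_ge0.
have [x0 H] := HC l i J0l; have bi := bm_rpsi i J0l.
pose B := box x0 (C / 2 ^+ l); have bB : bm (\1_B : V -> R) by exact: bm_box.
have p0 : 0 < 2 ^+ l :> R by rewrite exprn_gt0.
pose h x : R := Num.max (- e) (Num.min e (g x)).
have hE x : `|g x| <= e -> h x = g x.
  rewrite ler_norml => /andP[g1 g2]; rewrite /h min_r// max_r//.
have h_le x : `|h x| <= e.
  rewrite ler_norml /h le_max lexx/= ge_max ge_min lexx/= andbT.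
  by rewrite (le_trans _ e0)// oppr_le0.
have bh : bm h.
  split; last by exists e.
  have [mg _] := bg.
  by apply: measurable_maxr; [exact: measurable_cst|apply: measurable_minr; [exact: measurable_cst|]].
have -> : ip mu g (rpsi i) = ip mu (fun x => \1_B x * h x) (rpsi i).
  apply: eq_Ex => x; have [->|xn0] := eqVneq (rpsi i x) 0; first by rewrite !mulr0.
  have [_ Bx] := H x xn0.
  by rewrite indicE mem_set// mul1r hE// ge.
have := ip_CS mu (bmM bB bh) bi; rewrite rpsi_on// eqxx mulr1.
have : ip mu (fun x => \1_B x * h x) (fun x => \1_B x * h x) <= e ^+ 2 * (2 * (C / 2 ^+ l)) ^+ d.
  apply: (@le_trans _ _ (Ex mu (fun x => e ^+ 2 * \1_B x))).
    apply: Ex_le; [by bm_tac|by bm_tac|move=> x].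
    rewrite indicE; case: (x \in B); rewrite ?mul0r ?mulr0// !mul1r mulr1.
    by rewrite -expr2 -[h x ^+ 2]real_normK ?num_real// ler_sqr ?nnegrE.
  rewrite ExZ// ler_wpM2l ?sqr_ge0// Ex_box// divr_ge0// ltW//.
move=> H1 H2; have := le_trans H2 H1; rewrite -(ler_pM2l (exprn_gt0 d p0)) -exprM.
move/le_trans; apply; rewrite le_eqVlt; apply/orP; left; apply/eqP.
rewrite exprM mulrCA -exprMn mulrC; congr (_ ^+ d * _).
by field; rewrite gt_eqF.
Qed.

(** At levels [l > j] the wavelets see only the remainder of the Taylor expansion
    of order [S] of the cosine at the center of their support, which is at most of
    order [2 ^ ((j - l) S)], with [S > gamma]; at levels [l <= j] the bound of the
    wave by [1] suffices. *)
Lemma wave_holder (gamma c1 : R) : 0 < gamma -> gamma < S%:R -> 0 <= c1 ->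
  exists2 K : R, 0 <= K & forall (j : nat) (k : 'I_d -> int), (J0 <= j)%N ->
    (forall r, `|(k r)%:~R| <= c1 * 2 ^+ j) ->
    (holder_norm W gamma (fun x => (2 `^ (- (j%:R * gamma)) * wave k 0 x)%R) <= K%:E)%E.
Proof.
move=> g0 gS c10.
have [C C0 HC] := rpsi_supp; have [D D0 HD] := ip_rpsi_small.
pose A := 2 * pi * d%:R * c1 * C.
have A0 : 0 <= A by rewrite !mulr_ge0// ?pi_ge0.
pose K1 := D * (1 + A ^+ S ^+ 2).
have K10 : 0 <= K1 by rewrite mulr_ge0// addr_ge0// sqr_ge0.
exists (2 `^ (J0%:R * (gamma + d%:R / 2)) + (1 + K1)) => [|j k J0j kj].
  by rewrite !addr_ge0// powR_ge0.
pose s : R := 2 `^ (- (j%:R * gamma)).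
have s0 : 0 < s by rewrite powR_gt0.
have s1 : s <= 1.
  by apply: powR2_le1; rewrite oppr_le0 mulr_ge0// ltW.
have bw := bm_wave (R := R) k 0.
pose h x := s * wave k 0 x.
have bh : bm h by exact: bmZ.
rewrite /holder_norm EFinD; apply: leeD.
  rewrite lee_fin -[leRHS]mulr1 ler_wpM2l ?powR_ge0//.
  apply/bigmax_leP; split=> // m _; rewrite inner_cube_ip.
  have bm0 := bm_rphi m (leqnn J0).
  have brh := bm_res_bm bh.
  rewrite -(@ler_sqr _ _ 1) ?nnegrE// expr1n real_normK ?num_real//.
  apply: le_trans (ip_CS _ brh bm0) _; rewrite rphi_on// eqxx mulr1.
  apply: Ex_le_cst => [|x]; first by bm_tac.
  have [Qx|nQ] := pselect (Q x); last by rewrite res_out// mulr0.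
  rewrite res_in// -expr2 /h exprMn mulr_ile1 ?sqr_ge0//.
    by rewrite expr_le1// ltW.
  by rewrite -real_normK ?num_real// expr_le1// cos_max.
apply: ge_ereal_sup => _ [l [iota [m [J0l iota0 ->]]]].
pose i : widx W l := (exist _ iota iota0, m).
rewrite lee_fin.
have -> : inner_cube h (cdv_psi iota m) = ip mu h (rpsi i).
  have bi := bm_rpsi i J0l; have [mh _] := bh.
  rewrite (inner_psi i J0l (measurable_res mh)); apply: ip_ae => //.
  - exact: measurable_res.
  - by case: bi.
  - by case: bi.
  - exact: res_ae_id.
  - exact: aeW.
have bi := bm_rpsi i J0l.
rewrite /h ipZl//; set w := ip mu _ _.
pose q : R := 2 `^ (l%:R * (gamma + d%:R / 2)).
have q0 : 0 < q by rewrite powR_gt0.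
have qs : (q * s) ^+ 2 = 2 `^ (2 * ((l%:R - j%:R) * gamma)) * 2 ^+ (l * d).
  rewrite /q /s -powRD; last by rewrite pnatr_eq0 implybT.
  rewrite -[LHS]powR_mulrn ?powR_ge0// -[X in _ = _ * X]powR_mulrn//.
  rewrite -powRrM -powRD; last by rewrite pnatr_eq0 implybT.
  by congr (_ `^ _); rewrite natrM; field.
(* all bounds on coefficients are squared, and [t <= 1 + t ^ 2] *)
suff : (q * (s * `|w|)) ^+ 2 <= K1.
  move=> H; rewrite -/q normrM (ger0_norm (ltW s0)).
  apply: (@le_trans _ _ (1 + (q * (s * `|w|)) ^+ 2)); last by rewrite lerD2l.
  have := sqr_ge0 (q * (s * `|w|) - 1); set t := q * _; nra.
rewrite mulrA exprMn qs -mulrA real_normK ?num_real//.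
have [lj|jl] := leqP l j.
  have := HD l i (wave k 0) 1 J0l bw ler01 (fun x _ => cos_max _).
  rewrite expr1n mulr1 -/w => Hw.
  apply: (@le_trans _ _ (1 * D)).
    apply: ler_pM => //; first by rewrite mulr_ge0 ?sqr_ge0// exprn_ge0.
    apply: powR2_le1.
    by rewrite pmulr_rle0// pmulr_lle0// subr_le0 ler_nat.
  by rewrite mul1r /K1 ler_peMr// lerDl sqr_ge0.
have [x0 Hx0] := HC l i J0l.
pose kappa r : R := 2 * pi * (k r)%:~R.
pose om0 := \sum_r kappa r * tnth x0 r.
have [p [sp Hp]] := cos_taylor S om0.
pose u := lin_form kappa om0.
have bu : bm u by exact: bm_lin_form.
have bp : bm (fun x => p.[u x]).
  rewrite (_ : (fun x => _) = fun x => \sum_(n < size p) p`_n * u x ^+ n).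
    by apply: bm_sum => n _; apply: bmZ; exact: bm_exp.
  by apply/funext => x; rewrite horner_coef.
have wE : w = ip mu (fun x => wave k 0 x - p.[u x]) (rpsi i).
  by rewrite ipBl// lin_form_poly_orth// subr0.
pose e : R := (A * (2 ^+ j / 2 ^+ l)) ^+ S.
have p0 n : 0 < 2 ^+ n :> R by rewrite exprn_gt0.
have AA0 : 0 <= A * (2 ^+ j / 2 ^+ l) by rewrite mulr_ge0// divr_ge0// ltW.
have e0 : 0 <= e by rewrite exprn_ge0.
have close x : rpsi i x != 0 -> `|wave k 0 x - p.[u x]| <= e.
  move=> /Hx0 [Qx Bx].
  have uE : u x = \sum_r kappa r * (tnth x r - tnth x0 r).
    rewrite /u /lin_form /om0 -sumrB; apply: eq_bigr => r _.
    by rewrite /rcoord res_in// mulrBr.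
  have -> : wave k 0 x = cos (u x + om0).
    rewrite /wave addr0 /u /lin_form subrK /dotn mulr_sumr; congr cos.
    by apply: eq_bigr => r _; rewrite /rcoord res_in// /kappa mulrA.
  apply: le_trans (Hp _) _; apply: lerXn2r; rewrite ?nnegrE//.
  rewrite uE; apply: le_trans (ler_norm_sum _ _ _) _.
  apply: (@le_trans _ _ (\sum_(r < d) 2 * pi * (c1 * 2 ^+ j) * (C / 2 ^+ l))).
    apply: ler_sum => r _; rewrite normrM.
    apply: ler_pM => //.
    rewrite /kappa normrM ger0_norm ?mulr_ge0 ?pi_ge0//.
    by rewrite ler_wpM2l ?mulr_ge0 ?pi_ge0.
  rewrite sumr_const card_ord -mulr_natl /A le_eqVlt; apply/orP; left; apply/eqP.
  by field; rewrite gt_eqF.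
have Hw := HD l i _ e J0l (bmB bw bp) e0 close.
rewrite -wE in Hw.
apply: le_trans (ler_wpM2l (powR_ge0 _ _) Hw) _.
rewrite mulrCA /K1 ler_wpM2l//.
rewrite /e exprMn exprMn mulrCA.
apply: (@le_trans _ _ (A ^+ S ^+ 2 * 1)); last by rewrite mulr1 lerDr.
rewrite ler_wpM2l ?sqr_ge0//.
have -> : 2 ^+ j / 2 ^+ l = 2 `^ (- (l%:R - j%:R)) :> R.
  rewrite opprB powRB; last by rewrite pnatr_eq0 implybT.
  by rewrite !powR_mulrn.
rewrite -!powR_mulrn ?powR_ge0// -!powRrM -powRD; last by rewrite pnatr_eq0 implybT.
apply: powR2_le1.
have lj0 : 0 <= l%:R - j%:R :> R by rewrite subr_ge0 ler_nat ltnW.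
rewrite (_ : _ + _ = - (2 * ((l%:R - j%:R) * (S%:R - gamma)))); last by ring.
by rewrite oppr_le0 !mulr_ge0// subr_ge0 ltW.
Qed.

End WaveNorm.

(** * Uniformly continuous functions on the cube *)

Section UnifContinuous.
Context {R : realType} {d : nat}.
Notation V := (covariate R d).
Notation Q := (@cube R d).

Definition scale_pt (a : R) (x : V) : V := [tuple a * tnth x i | i < d].

(** Walking from the origin to [x] in [N] equal steps, each of which changes [h]
    by at most [1]. *)
Lemma unif_continuous_bounded (h : V -> R) : unif_continuous_cube h ->
  exists C : R, forall x, Q x -> `|h x| <= C.
Proof.
move=> /(_ 1 ltr01)[del del0 H].
pose N := (Num.truncn del^-1).+1.
have N0 : 0 < N%:R :> R by rewrite ltr0n.
have Ndel : N%:R^-1 < del.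
  rewrite invf_plt ?posrE//; exact: truncnS_gt.
pose z : V := [tuple 0 | i < d].
exists (`|h z| + N%:R) => x Qx.
pose y (k : nat) := scale_pt (k%:R / N%:R) x.
have yQ k : (k <= N)%N -> Q (y k).
  move=> kN i; rewrite tnth_mktuple; have /andP[x0 x1] := Qx i.
  have k0 : 0 <= k%:R / N%:R :> R by rewrite divr_ge0.
  have k1 : k%:R / N%:R <= 1 :> R by rewrite ler_pdivrMr// mul1r ler_nat.
  by rewrite mulr_ge0//= mulr_ile1.
have step k : (k <= N)%N -> `|h (y k)| <= `|h z| + k%:R.
  elim: k => [_|k IH kN].
    rewrite addr0 (_ : y 0 = z)//; apply: eq_from_tnth => i.
    by rewrite !tnth_mktuple !mul0r.
  have : `|h (y k.+1) - h (y k)| < 1.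
    apply: H; [exact: yQ|by apply: yQ; exact: ltnW|move=> i].
    rewrite !tnth_mktuple -mulrBl -mulrBl -natrB// subSnn mul1r.
    have /andP[x0 x1] := Qx i.
    have iN0 : 0 <= N%:R^-1 :> R by rewrite invr_ge0 ltW.
    rewrite ger0_norm ?mulr_ge0//.
    by apply: le_lt_trans Ndel; rewrite ler_piMr.
  move=> /ltW Hk; rewrite -[h (y k.+1)](subrK (h (y k))).
  apply: le_trans (ler_normD _ _) _.
  have := IH (ltnW kN); rewrite -natr1; lra.
have := step N (leqnn _); rewrite (_ : y N = x)//.
by apply: eq_from_tnth => i; rewrite tnth_mktuple divff ?mul1r// gt_eqF.
Qed.

Definition cell (n : nat) (v : {ffun 'I_d -> 'I_n.+2}) : set V :=
  [set x | forall i, (v i)%:R <= n.+1%:R * tnth x i < (v i).+1%:R].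

Definition grid_pt (n : nat) (v : {ffun 'I_d -> 'I_n.+2}) : V :=
  [tuple (v i)%:R / n.+1%:R | i < d].

Lemma measurable_cell n v : measurable (@cell n v).
Proof.
rewrite (_ : cell v = \bigcap_(i in [set: 'I_d])
    [set x : V | (v i)%:R / n.+1%:R <= tnth x i < (v i).+1%:R / n.+1%:R]).
  apply: fin_bigcap_measurable => // i _.
  rewrite -[X in measurable X]setTI.
  apply: (@measurable_coord R d i measurableT
    `[(v i)%:R / n.+1%:R, (v i).+1%:R / n.+1%:R[%classic).
  exact: measurable_itv.
have n0 : 0 < n.+1%:R :> R by rewrite ltr0n.
apply/seteqP; split => x H i; [move=> _; move: (H i)|move: (H i I)];
  by rewrite /= ler_pdivrMr// ltr_pdivlMr// [tnth x i * _]mulrC.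
Qed.

(** Approximation by step functions on finer and finer grids. *)
Lemma unif_continuous_measurable (h : V -> R) : unif_continuous_cube h ->
  measurable_fun Q h.
Proof.
move=> uh.
pose hn n (x : V) : R := \sum_(v : {ffun 'I_d -> 'I_n.+2}) h (grid_pt v) * \1_(cell v) x.
have mhn n : measurable_fun Q (hn n).
  apply: measurable_funTS; apply: measurable_sum => v.
  apply: measurable_funM; first exact: measurable_cst.
  by have [] := bm_indic (R := R) (measurable_cell v).
apply: (measurable_fun_cvg (h := hn)) => // x Qx.
apply/cvgrPdist_lt => e e0.
have [del del0 H] := uh e e0.
exists (Num.truncn del^-1) => // n /= Nn.
have n0 : 0 < n.+1%:R :> R by rewrite ltr0n.
have ndel : n.+1%:R^-1 < del.
  rewrite invf_plt ?posrE//; apply: lt_le_trans (truncnS_gt _) _.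
  by rewrite ler_nat ltnS.
have nx0 i : 0 <= n.+1%:R * tnth x i.
  by have /andP[x0 _] := Qx i; rewrite mulr_ge0.
have tl i : (Num.truncn (n.+1%:R * tnth x i) < n.+2)%N.
  rewrite ltnS -(ler_nat R); have /andP[+ _] := truncn_itv (nx0 i).
  move/le_trans; apply; have /andP[_ x1] := Qx i.
  by rewrite ler_piMr// ltW.
pose v : {ffun 'I_d -> 'I_n.+2} := [ffun i => Ordinal (tl i)].
have vx : cell v x by move=> i; rewrite ffunE /=; exact: truncn_itv.
have -> : hn n x = h (grid_pt v).
  rewrite /hn (bigD1 v)//= indicE mem_set// mulr1 big1 ?addr0// => w wv.
  rewrite indicE memNset ?mulr0// => wx; case/negP: wv; apply/eqP/ffunP => i.
  apply: val_inj; rewrite ffunE /=; apply/esym/truncn_def.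
  exact: wx.
apply: H => // [i|i].
  rewrite tnth_mktuple divr_ge0//= ler_pdivrMr// mul1r ler_nat -ltnS.
  exact: ltn_ord.
have /andP[v1 v2] := vx i.
rewrite tnth_mktuple ger0_norm; last first.
  by rewrite subr_ge0 ler_pdivrMr// mulrC.
apply: le_lt_trans ndel; rewrite -(ler_pM2l n0) mulrBr mulrCA divff ?gt_eqF// mulr1.
by rewrite lerBlDr addrC natr1 ltW.
Qed.

Lemma unif_continuousD (f g : V -> R) : unif_continuous_cube f -> unif_continuous_cube g ->
  unif_continuous_cube (fun x => f x + g x).
Proof.
move=> uf ug e e0; have e20 : 0 < e / 2 by rewrite divr_gt0.
have [df df0 Hf] := uf _ e20; have [dg dg0 Hg] := ug _ e20.
exists (Num.min df dg) => [|x y Qx Qy xy]; first by rewrite lt_min df0.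
rewrite opprD addrACA; apply: le_lt_trans (ler_normD _ _) _.
rewrite [ltRHS]splitr; apply: ltrD.
  by apply: Hf => // i; have := xy i; rewrite lt_min => /andP[].
by apply: Hg => // i; have := xy i; rewrite lt_min => /andP[].
Qed.

Lemma unif_continuousZ (c : R) (f : V -> R) : unif_continuous_cube f ->
  unif_continuous_cube (fun x => c * f x).
Proof.
move=> uf e e0; have c0 : 0 < `|c| + 1 by rewrite ltr_wpDl.
have [df df0 Hf] := uf _ (divr_gt0 e0 c0).
exists df => // x y Qx Qy xy; rewrite -mulrBr normrM.
apply: (@le_lt_trans _ _ ((`|c| + 1) * `|f x - f y|)).
  by rewrite ler_wpM2r// lerDl.
by rewrite mulrC -ltr_pdivlMr//; exact: Hf.
Qed.

Lemma cos_lipschitz (a b : R) : `|cos a - cos b| <= `|a - b|.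
Proof.
wlog ab : a b / b <= a.
  by move=> H; have [/H//|/ltW/H] := leP b a; rewrite distrC [`|b - a|]distrC.
have cc (x : R) : {for x, continuous (@cos R)} by exact: continuous_cos.
have [c _ ->] := MVT_segment ab (fun x _ => is_derive_cos x) (continuous_subspaceT cc).
by rewrite normrM normrN ler_piMl// sin_max.
Qed.

Lemma unif_continuous_wave (k : 'I_d -> int) (b : R) : unif_continuous_cube (wave k b).
Proof.
move=> e e0; pose A : R := \sum_i `|2 * pi * (k i)%:~R| + 1.
have A0 : 0 < A by rewrite ltr_wpDl// sumr_ge0.
exists (e / A) => [|x y _ _ xy]; first by rewrite divr_gt0.
apply: le_lt_trans (cos_lipschitz _ _) _.
rewrite opprD addrACA subrr addr0 -mulrBr /dotn -sumrB mulr_sumr.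
apply: le_lt_trans (ler_norm_sum _ _ _) _.
apply: (@le_lt_trans _ _ (\sum_i `|2 * pi * (k i)%:~R| * (e / A))).
  apply: ler_sum => i _; rewrite -mulrBr mulrA normrM ler_wpM2l// ltW//.
rewrite -mulr_suml mulrCA -[ltRHS]mulr1 ltr_pM2l// ltr_pdivrMr// mul1r /A.
by rewrite ltrDl.
Qed.

End UnifContinuous.

(** * Regression functions with a planted wave *)

Section HolderCombination.
Context {R : realType} {d S J0 : nat}.
Variable W : cdv_basis R d S J0.
Notation V := (covariate R d).
Notation mu := (unif_cube R d).
Notation Q := (@cube R d).

Lemma resD (f g : V -> R) x : res (fun x => f x + g x) x = res f x + res g x.
Proof.
have [Qx|nQ] := pselect (Q x); first by rewrite !res_in.
by rewrite !res_out// addr0.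
Qed.

Lemma resZ c (f : V -> R) x : res (fun x => c * f x) x = c * res f x.
Proof.
have [Qx|nQ] := pselect (Q x); first by rewrite !res_in.
by rewrite !res_out// mulr0.
Qed.

Lemma holder_norm_lin gamma (s t a b : R) (f g : V -> R) :
  bm (res f) -> bm (res g) ->
  (holder_norm W gamma f <= a%:E)%E -> (holder_norm W gamma g <= b%:E)%E ->
  (holder_norm W gamma (fun x => s * f x + t * g x)%R <= (`|s| * a + `|t| * b)%:E)%E.
Proof.
move=> bf bg; rewrite /holder_norm.
set C : R := 2 `^ _; pose A h := \big[Num.max/0]_m `|inner_cube h (@cdv_phi _ _ _ _ W J0 m)|.
rewrite -!/(A _).
set Bf := ereal_sup _; set Bg := ereal_sup [set r | _]; set Bh := ereal_sup [set r | _].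
have C0 : 0 <= C by exact: powR_ge0.
have A0 h : 0 <= A h.
  by rewrite /A; elim/big_ind: _ => // x y x0 y0; rewrite le_max x0.
move=> fa gb.
have Bfa : (Bf <= (a - C * A f)%:E)%E.
  by rewrite EFinB leeBrDr// addeC.
have Bgb : (Bg <= (b - C * A g)%:E)%E.
  by rewrite EFinB leeBrDr// addeC.
have ipl e : bm e ->
    ip mu (res (fun x => s * f x + t * g x)) e = s * ip mu (res f) e + t * ip mu (res g) e.
  move=> be; rewrite -!ipZl// -ipDl//; [|exact: bmZ..].
  by apply: eq_Ex => x; rewrite resD !resZ.
have norm_lin (x y : R) : `|s * x + t * y| <= `|s| * `|x| + `|t| * `|y|.
  by rewrite -!normrM; exact: ler_normD.
have Ah : A (fun x => s * f x + t * g x) <= `|s| * A f + `|t| * A g.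
  apply/bigmax_leP; split=> [|m _]; first by rewrite addr_ge0// mulr_ge0.
  rewrite inner_cube_ip ipl; last exact: bm_rphi.
  apply: le_trans (norm_lin _ _) _; apply: lerD; rewrite ler_wpM2l// -inner_cube_ip.
    exact: (le_bigmax _ (fun m => `|inner_cube f (cdv_phi m)|)).
  exact: (le_bigmax _ (fun m => `|inner_cube g (cdv_phi m)|)).
have Bhab : (Bh <= (`|s| * (a - C * A f) + `|t| * (b - C * A g))%:E)%E.
  apply: ge_ereal_sup => _ [l [iota [m [J0l iota0 ->]]]].
  pose i : widx W l := (exist _ iota iota0, m).
  have mf : measurable_fun [set: V] (res f) by case: bf.
  have mg : measurable_fun [set: V] (res g) by case: bg.
  have mh : measurable_fun [set: V] (res (fun x => s * f x + t * g x)).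
    rewrite (_ : res _ = fun x => s * res f x + t * res g x).
      by have [] := bmD (bmZ s bf) (bmZ t bg).
    by apply/funext => x; rewrite resD !resZ.
  have bi := bm_rpsi i J0l.
  rewrite (inner_psi i J0l mh) ipl// -!(inner_psi i)//= lee_fin.
  set q := 2 `^ _; have q0 : 0 <= q by exact: powR_ge0.
  have Hf : q * `|inner_cube f (cdv_psi iota m)| <= a - C * A f.
    rewrite -lee_fin; apply: le_trans Bfa; apply: ereal_sup_ubound.
    by exists l, iota, m.
  have Hg : q * `|inner_cube g (cdv_psi iota m)| <= b - C * A g.
    rewrite -lee_fin; apply: le_trans Bgb; apply: ereal_sup_ubound.
    by exists l, iota, m.
  apply: (@le_trans _ _ (q * (`|s| * `|inner_cube f (cdv_psi iota m)|
      + `|t| * `|inner_cube g (cdv_psi iota m)|))); first by rewrite ler_wpM2l.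
  rewrite mulrDr; apply: lerD; rewrite mulrCA ler_wpM2l//.
have CAh : ((C * A (fun x => s * f x + t * g x)%R)%:E <= (C * (`|s| * A f + `|t| * A g))%:E)%E.
  by rewrite lee_fin; exact: ler_wpM2l.
apply: le_trans (leeD CAh Bhab) _.
rewrite -EFinD lee_fin le_eqVlt; apply/orP; left; apply/eqP; ring.
Qed.

Lemma eq_holder_norm gamma (f g : V -> R) : (forall x, Q x -> f x = g x) ->
  holder_norm W gamma f = holder_norm W gamma g.
Proof.
move=> fg.
have E h : inner_cube f h = inner_cube g h by rewrite !inner_cube_ip (resP fg).
rewrite /holder_norm; congr ((_ * _)%:E + ereal_sup _)%E.
  by apply: eq_bigr => m _; rewrite E.
apply/seteqP; split => r [l [iota [m [J0l iota0 ->]]]];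
  by exists l, iota, m; split => //; rewrite E.
Qed.

Lemma share_le (a b : R) : 0 <= a -> 0 <= b -> b / (4 * (a + 1)) * a <= b / 4.
Proof.
move=> a0 b0; have a1 : 0 < a + 1 by rewrite ltr_wpDl.
rewrite (_ : _ * a = b / 4 * (a / (a + 1))); last by field; rewrite gt_eqF.
rewrite ler_piMr ?divr_ge0// ler_pdivrMr// mul1r.
by rewrite lerDl.
Qed.

(** Shrinking [h] towards the constant [(C1 + C2) / 2] moves it uniformly away
    from [C1] and [C2] while keeping its norm below [M]; the remaining room
    accommodates a small multiple of a wave. *)
Lemma planted_wave (gamma M C1 C2 c1 : R) : (0 < d)%N -> 0 < gamma -> gamma < S%:R -> 0 <= c1 ->
  (exists h : V -> R, [/\ unif_continuous_cube h, (holder_norm W gamma h < M%:E)%E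
      & forall x, Q x -> C1 < h x < C2]) ->
  exists (h : V -> R) (sigma e : R), [/\ 0 < sigma, 0 < e, bm (res h) &
    forall (j : nat) (k : 'I_d -> int) (s : R), (J0 <= j)%N ->
      (forall r, `|(k r)%:~R| <= c1 * 2 ^+ j) -> `|s| <= 1 ->
      let g x := h x + s * e * 2 `^ (- (j%:R * gamma)) * wave k 0 x in
      holder_ball W gamma M g /\ forall x, Q x -> C1 + sigma <= g x <= C2 - sigma].
Proof.
move=> d0 g0 gS c10 [h [uh hM hC]].
have mh := unif_continuous_measurable uh.
have bh : bm (res h).
  by apply: bm_res => //; exact: unif_continuous_bounded.
have C12 : C1 < C2.
  pose z : V := [tuple 0 | i < d].
  have Qz : Q z by move=> i; rewrite tnth_mktuple lexx ler01.
  by have /andP[/lt_trans] := hC z Qz; apply.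
have [K K0 HK] := wave_holder W g0 gS c10.
(* the constant function is the wave of frequency zero, so its norm is finite *)
pose k0 : 'I_d -> int := fun=> 0.
pose u : V -> R := wave k0 0.
have uE x : u x = 1.
  rewrite /u /wave /dotn big1 ?mulr0 ?addr0 ?cos0// => i _.
  by rewrite /k0 mul0r.
have bu : bm (res u) by apply: bm_res_bm; exact: bm_wave.
pose D := 2 `^ (J0%:R * gamma) * K.
have D0 : 0 <= D by rewrite mulr_ge0// powR_ge0.
have uD : (holder_norm W gamma u <= D%:E)%E.
  have H0 : forall r, `|(k0 r)%:~R| <= c1 * 2 ^+ J0.
    by move=> r; rewrite /k0 normr0 mulr_ge0// exprn_ge0.
  have := HK J0 k0 (leqnn _) H0.
  have bw : bm (res (fun x => 2 `^ (- (J0%:R * gamma)) * wave k0 0 x)).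
    by apply/bm_res_bm/bmZ; exact: bm_wave.
  move=> H; have := holder_norm_lin (2 `^ (J0%:R * gamma)) 0 bw bw H H.
  rewrite normr0 mul0r addr0 ger0_norm ?powR_ge0//.
  rewrite (_ : holder_norm W gamma (fun x => _) = holder_norm W gamma u)//.
  apply: eq_holder_norm => x _; rewrite mul0r addr0 mulrA -powRD; last by rewrite pnatr_eq0 implybT.
  by rewrite subrr powRr0 mul1r.
have [m hm mM] : exists2 m, (holder_norm W gamma h <= m%:E)%E & m < M.
  move: hM; case: (holder_norm W gamma h) => [r rM| //|_].
    by exists r => //; rewrite -lte_fin.
  by exists (M - 1); [exact: leNye|rewrite ltrBlDr ltrDl].
pose c0 := (C1 + C2) / 2.
pose D' := `|m| + `|c0| * D.
have D'0 : 0 <= D' by rewrite addr_ge0// mulr_ge0.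
(* a quarter of the room [delta] left by the norm of [h] goes to the shrinking,
   and another to the wave *)
pose delta := M - m; have delta0 : 0 < delta by rewrite subr_gt0.
pose t := Num.min 1 (delta / (4 * (D' + 1))).
have t0 : 0 < t by rewrite lt_min ltr01 divr_gt0// mulr_gt0// ltr_wpDl.
have t1 : t <= 1 by rewrite ge_min lexx.
have tD : t * D' <= delta / 4.
  apply: (le_trans _ (share_le D'0 (ltW delta0))).
  by rewrite ler_wpM2r// ge_min lexx orbT.
pose sigma := t * (C2 - C1) / 8.
have sigma0 : 0 < sigma by rewrite divr_gt0// mulr_gt0// subr_gt0.
pose e := Num.min sigma (delta / (4 * (K + 1))).
have e0 : 0 < e by rewrite lt_min sigma0 divr_gt0// mulr_gt0// ltr_wpDl.
have eK : e * K <= delta / 4.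
  apply: (le_trans _ (share_le K0 (ltW delta0))).
  by rewrite ler_wpM2r// ge_min lexx orbT.
have esigma : e <= sigma by rewrite ge_min lexx.
pose h' x := (1 - t) * h x + (t * c0) * u x.
have bh' : bm (res h').
  rewrite (_ : res _ = fun x => (1 - t) * res h x + (t * c0) * res u x).
    by apply: bmD; exact: bmZ.
  by apply/funext => x; rewrite resD !resZ.
have uh' : unif_continuous_cube h'.
  apply: unif_continuousD; apply: unif_continuousZ => //.
  exact: unif_continuous_wave.
have nh' : (holder_norm W gamma h' <= (m + delta / 4)%:E)%E.
  apply: le_trans (holder_norm_lin _ _ bh bu hm uD) _.
  have -> : `|1 - t| = 1 - t by rewrite ger0_norm ?subr_ge0.
  rewrite lee_fin normrM (ger0_norm (ltW t0)).
  have : (1 - t) * m <= m + t * `|m|.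
    rewrite mulrBl mul1r lerD2l -mulrN; apply: ler_wpM2l; first exact: ltW.
    by rewrite -normrN ler_norm.
  move: tD; rewrite /D' mulrDr mulrA; lra.
exists h', sigma, e; split => // j k s J0j kj s1 g.
have bw : bm (res (fun x => 2 `^ (- (j%:R * gamma)) * wave k 0 x)).
  by apply/bm_res_bm/bmZ; exact: bm_wave.
have gE x : g x = 1 * h' x + (s * e) * (2 `^ (- (j%:R * gamma)) * wave k 0 x).
  by rewrite /g mul1r !mulrA.
split.
  split.
    apply: unif_continuousD => //; apply: unif_continuousZ.
    exact: unif_continuous_wave.
  rewrite (_ : holder_norm W gamma g = holder_norm W gamma (fun x =>
      1 * h' x + (s * e) * (2 `^ (- (j%:R * gamma)) * wave k 0 x))); last first.
    by apply: eq_holder_norm => x _; exact: gE.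
  apply: le_trans (holder_norm_lin _ _ bh' bw nh' (HK j k J0j kj)) _.
  rewrite lee_fin normr1 mul1r normrM (ger0_norm (ltW e0)).
  have : `|s| * e * K <= delta / 4.
    by apply: le_trans eK; rewrite -mulrA ler_piMl// mulr_ge0// ltW.
  by rewrite /delta; lra.
move=> x Qx.
have small : `|s * e * 2 `^ (- (j%:R * gamma)) * wave k 0 x| <= sigma.
  apply: le_trans esigma; rewrite !normrM (ger0_norm (ltW e0)) (ger0_norm (powR_ge0 _ _)).
  have p1 : 2 `^ (- (j%:R * gamma)) <= 1 :> R.
    by apply: powR2_le1; rewrite oppr_le0 mulr_ge0// ltW.
  rewrite -mulrA -mulrA mulrCA; apply: ler_piMr; first exact: ltW.
  have w1 : `|wave k 0 x| <= 1 by exact: cos_max.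
  have p0 : 0 <= 2 `^ (- (j%:R * gamma)) :> R by exact: powR_ge0.
  have := mulr_ile1 p0 (normr_ge0 _) p1 w1.
  by apply: mulr_ile1; rewrite ?mulr_ge0.
have /andP[h1 h2] := hC x Qx.
move: small; rewrite ler_norml => /andP[w1 w2]; rewrite /g; move: w1 w2.
set w := (s * e * _ * _) => w1 w2.
rewrite /h' uE mulr1 /c0.
have a1 : 0 <= (1 - t) * (h x - C1) by rewrite mulr_ge0// subr_ge0// ltW.
have a2 : 0 <= (1 - t) * (C2 - h x) by rewrite mulr_ge0// subr_ge0// ltW.
have a3 : t * (C2 - C1) = 8 * sigma by rewrite /sigma; field.
by apply/andP; split; nra.
Qed.

End HolderCombination.

(** * A frequency invisible to the scaling functions *)

Section InvisibleFrequency.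
Context {R : realType} {d S J0 : nat}.
Variable W : cdv_basis R d S J0.
Notation mu := (unif_cube R d).

(** By Bessel, orthonormal waves share a total squared projection of at most
    [dim V_j]; with twice as many waves as dimensions, one of them keeps half
    of its squared norm, which is [1 / 2] before normalization, outside [V_j]. *)
Lemma invisible_wave (hd : (0 < d)%N) : exists2 c1 : R, 0 <= c1 &
  forall j, (J0 <= j)%N -> exists k : 'I_d -> int,
    (forall r, `|(k r)%:~R| <= c1 * 2 ^+ j) /\
    4^-1 <= ip mu (wave k 0) (wave k 0) - phi_form W j (wave k 0) (wave k 0).
Proof.
have [C C0 HC] := card_idx_le W.
(* with [N = c 2 ^ j] there are [N ^ d > 2 C 2 ^ (j d)] frequencies, at least
   twice the dimension of [V_j] *)
pose c := (Num.truncn (2 * C)).+2.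
have cC : 2 * C < c%:R by apply: lt_le_trans (truncnS_gt _) _; rewrite ler_nat.
exists c%:R => // j J0j.
pose N := (c * 2 ^ j)%N.
pose k (a : {ffun 'I_d -> 'I_N}) (r : 'I_d) : int := (a r).+1.
have kN a r : `|(k a r)%:~R| <= c%:R * 2 ^+ j :> R.
  rewrite /k -pmulrn ger0_norm ?ler0n// -natrX -natrM ler_nat.
  exact: ltn_ord.
have k0 a r : 0 < k a r by [].
suff [a Ha] : exists a, phi_form W j (wave (k a) 0) (wave (k a) 0) <= 4^-1.
  exists (k a); split=> [r|]; first exact: kN.
  rewrite [X in X - _](Ex_wave_sqr hd (k0 a)); lra.
apply/not_existsP => H.
pose e a x : R := Num.sqrt 2 * wave (k a) 0 x.
have bw a : bm (wave (R := R) (k a) 0) by exact: bm_wave.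
have be a : bm (e a) by exact: bmZ.
have s2 : Num.sqrt 2 * Num.sqrt 2 = 2 :> R by rewrite -expr2 sqr_sqrtr.
have ipe a g : bm g -> ip mu (e a) g = Num.sqrt 2 * ip mu (wave (k a) 0) g.
  by move=> bg; rewrite ipZl.
have one a b : ip mu (e a) (e b) = (a == b)%:R.
  rewrite ipe// ipC ipe// mulrA s2.
  have [->|ab] := eqVneq a b.
    by rewrite [ip _ _ _](Ex_wave_sqr hd (k0 b)) divff.
  rewrite [ip _ _ _](Ex_waveM_neq (k0 b) (k0 a)) ?mulr0//.
  apply: contrapT => /forallNP nE; case/eqP: ab; apply/ffunP => r.
  have /negP := nE r; rewrite negbK => /eqP [] H1.
  by apply/val_inj.
have bphi m := bm_rphi (W := W) m J0j.
have upper : \sum_a phi_form W j (wave (k a) 0) (wave (k a) 0) <= C * 2 ^+ (j * d) / 2.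
  rewrite exchange_big/=.
  apply: (@le_trans _ _ (\sum_(m : cdv_idx W j) 2^-1)); last first.
    by rewrite sumr_const -[leLHS]mulr_natl ler_pM2r ?invr_gt0// HC.
  apply: ler_sum => m _.
  have := bessel be one (bphi m); rewrite rphi_on// eqxx.
  rewrite (eq_bigr (fun a => 2 * (ip mu (wave (k a) 0) (rphi m) * ip mu (wave (k a) 0) (rphi m)))).
    by rewrite -mulr_sumr => H1; rewrite -(ler_pM2l (ltr0Sn R 1)) divff.
  by move=> a _; rewrite ipC ipe// exprMn expr2 s2 expr2.
have lower : (N ^ d)%:R / 4 <= \sum_a phi_form W j (wave (k a) 0) (wave (k a) 0).
  rewrite (_ : (N ^ d)%:R / 4 = \sum_(a : {ffun 'I_d -> 'I_N}) 4^-1 :> R).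
    by apply: ler_sum => a _; rewrite ltW// ltNge; apply/negP; exact: H.
  by rewrite sumr_const card_ffun !card_ord mulr_natl.
have := le_trans lower upper; apply/negP; rewrite -ltNge.
rewrite (_ : C * _ / 2 = (2 * C) * 2 ^+ (j * d) / 4); last by field.
rewrite ltr_pM2r ?invr_gt0//.
apply: (@lt_le_trans _ _ (c%:R * 2 ^+ (j * d))).
  by rewrite ltr_pM2r// exprn_gt0.
rewrite -natrX -natrM ler_nat /N expnMn -expnM leq_mul2r.
apply/orP; right; by rewrite -{1}[c]expn1 leq_exp2l.
Qed.

End InvisibleFrequency.

(** * Conditional expectations given the covariate *)

Section Observations.
Context {R : realType} {d : nat}.
Notation V := (covariate R d).

Lemma measurable_obsX : measurable_fun [set: obs R d] (@obsX R d).
Proof. exact: measurableT_comp. Qed.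

Lemma measurable_obsA : measurable_fun [set: obs R d] (@obsA R d).
Proof. exact: measurableT_comp. Qed.

Lemma measurable_obsY : measurable_fun [set: obs R d] (@obsY R d).
Proof. exact: measurable_snd. Qed.

HB.instance Definition _ := isMeasurableFun.Build _ _ _ _ (@obsX R d) measurable_obsX.

Lemma measurable_obsX_preimage (B : set V) : measurable B -> measurable (@obsX R d @^-1` B).
Proof. by move=> mB; rewrite -[X in measurable X]setTI; exact: measurable_obsX. Qed.

End Observations.

Section CondExp.
Context {R : realType} {d : nat}.
Notation V := (covariate R d).
Variable P : probability (obs R d) R.
Notation X := (@obsX R d).
Notation lawX := (distribution P X).

Lemma integral_lawX (g : V -> R) (B : set V) : measurable_fun [set: V] g ->
  P.-integrable [set: obs R d] (fun z => (g (X z))%:E) -> measurable B ->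
  (\int[lawX]_(x in B) (g x)%:E = \int[P]_(z in X @^-1` B) (g (X z))%:E)%E.
Proof.
move=> mg ig mB; rewrite integral_pushforward//.
  by apply/measurable_EFinP; exact: measurable_funTS.
by apply: integrableS ig => //; exact: measurable_obsX_preimage.
Qed.

Lemma integrable_lawX (g : V -> R) : measurable_fun [set: V] g ->
  P.-integrable [set: obs R d] (fun z => (g (X z))%:E) ->
  lawX.-integrable [set: V] (fun x => (g x)%:E).
Proof.
move=> mg ig; apply: integrable_pushforward => //; exact/measurable_EFinP.
Qed.

(** The Radon-Nikodym derivative of the image under [X] of [f dP] with respect
    to the law of [X]. *)
Lemma cond_exp_exists (f : obs R d -> R) :
  P.-integrable [set: obs R d] (EFin \o f) -> exists g, is_cond_exp P f g.
Proof.
move=> intf.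
pose nu := pushforward (induced_charge intf) X.
have dom : nu `<< lawX.
  apply/null_content_dominatesP => A mA A0.
  rewrite /nu /pushforward /induced_charge.
  apply: null_set_integral => //; first exact: measurable_obsX_preimage.
  by apply: measurable_funTS; exact: measurable_int intf.
pose h0 := Radon_Nikodym nu lawX; pose h := h0 (@measurable_obsX R d).
have hint : lawX.-integrable [set: V] h by exact: Radon_Nikodym_integrable.
have hE x : (fine (h x))%:E = h x by rewrite fineK//; exact: Radon_Nikodym_fin_num.
have mh : measurable_fun [set: V] (fun x => fine (h x)).
  apply/measurable_EFinP; rewrite (_ : _ \o _ = h); first exact: measurable_int hint.
  by apply/funext => x /=; rewrite hE.
have ig : P.-integrable [set: obs R d] (fun z => (fine (h (X z)))%:E).
  apply/integrableP; split.
    by apply/measurable_EFinP; exact: (measurableT_comp mh (@measurable_obsX R d)).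
  have /integrableP[_] := hint.
  rewrite ge0_integral_pushforward//; last first.
    by apply: measurableT_comp => //; exact: measurable_int hint.
  by rewrite preimage_setT => H; under eq_integral do rewrite hE.
exists (fun x => fine (h x)); split=> // B mB.
rewrite -(integral_lawX mh ig mB).
transitivity (\int[lawX]_(x in B) h x)%E.
  by apply: eq_integral => x _; rewrite hE.
have E m : nu B = (\int[lawX]_(x in B) h0 m x)%E.
  by have := Radon_Nikodym_integral dom mB; apply.
by rewrite -E.
Qed.

Lemma cond_expP (f : obs R d -> R) : (exists g, is_cond_exp P f g) ->
  is_cond_exp P f (cond_exp P f).
Proof. by move=> [g Hg]; rewrite /cond_exp; case: xgetP => [h -> //|/(_ g)]. Qed.

Lemma ae_lawX (A : V -> Prop) : {ae lawX, forall x, A x} -> {ae P, forall z, A (X z)}.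
Proof.
move=> [N [mN N0 AN]]; exists (X @^-1` N); split => //.
  exact: measurable_obsX_preimage.
by move=> z /= nA; apply: AN.
Qed.

Lemma cond_exp_unique (f : obs R d -> R) g1 g2 : is_cond_exp P f g1 -> is_cond_exp P f g2 ->
  {ae P, forall z, g1 (X z) = g2 (X z)}.
Proof.
move=> [m1 i1 H1] [m2 i2 H2].
have H : ae_eq lawX [set: V] (EFin \o g1) (EFin \o g2).
  apply: integral_ae_eq => //.
  - exact: integrable_lawX.
  - exact/measurable_EFinP.
  - by move=> E _ mE; rewrite !integral_lawX// H1// H2.
apply: (@ae_lawX (fun x => g1 x = g2 x)).
by apply: aeS H => x /(_ I) [].
Qed.

(** The defining identity of the conditional expectation on the whole space.  The
    integrand may be unbounded on a null set, as [A] and [Y] may be. *)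
Lemma mean_cond_exp (f f' : obs R d -> R) : measurable_fun [set: obs R d] f -> bm f' ->
  {ae P, forall z, f z = f' z} -> \int[P]_z cond_exp P f (X z) = Ex P f'.
Proof.
move=> mf bf' ff'; have [mf' _] := bf'.
have intf : P.-integrable [set: obs R d] (EFin \o f).
  have i' := bm_integrable P bf'.
  apply/integrableP; split; first exact/measurable_EFinP.
  have /integrableP[_] := i'; congr (_ < _)%E; apply: ae_eq_integral => //.
  - by apply: measurableT_comp => //; exact/measurable_EFinP.
  - by apply: measurableT_comp => //; exact/measurable_EFinP.
  - by apply: aeS ff' => z /= -> _.
have [_ _ H] := cond_expP (cond_exp_exists intf).
rewrite /Rintegral; have := H setT measurableT; rewrite preimage_setT => ->.
by apply: Ex_ae.
Qed.

(** If [f] and [g (X)] have the same integral over every event [X \in B], then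
    also against every bounded function of [X]: approximate it within [1 / n]
    by functions taking finitely many values. *)
Lemma pull_out (f : obs R d -> R) (g q : V -> R) : bm f -> bm g -> bm q ->
  (forall B, measurable B -> Ex P (fun z => \1_B (X z) * (f z - g (X z))) = 0) ->
  Ex P (fun z => q (X z) * f z) = Ex P (fun z => q (X z) * g (X z)).
Proof.
move=> bf bg bq H.
have mX := @measurable_obsX R d.
have bgX : bm (fun z => g (X z)) by exact: bm_comp bg mX.
have bqX : bm (fun z => q (X z)) by exact: bm_comp bq mX.
have bindX (B : set V) : measurable B -> bm (fun z => \1_B (X z) : R).
  by move=> mB; exact: bm_comp (bm_indic mB) mX.
pose D z := f z - g (X z).
have bD : bm D by exact: bmB.
suff : Ex P (fun z => q (X z) * D z) = 0.
  rewrite (eq_Ex _ (g := fun z => q (X z) * f z - q (X z) * g (X z))); last first.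
    by move=> z; rewrite mulrBr.
  rewrite ExB; [|exact: bmM..].
  by move/eqP; rewrite subr_eq0 => /eqP.
have [mq [C qC]] := bq; have [_ [M DM]] := bD.
have C0 : 0 <= C by apply: le_trans (qC point).
have M0 : 0 <= M by apply: le_trans (DM point).
apply/eqP; rewrite -normr_le0; apply/ler_addgt0Pl => e e0; rewrite addr0.
pose n := (Num.truncn (M / e)).+1.
have n0 : 0 < n%:R :> R by rewrite ltr0n.
have Mn : M / n%:R <= e.
  rewrite ler_pdivrMr// mulrC -ler_pdivrMr// ltW//; exact: truncnS_gt.
pose K := (Num.truncn (n%:R * (2 * C))).+1.
pose lev x := Num.truncn (n%:R * (q x + C)).
have qC0 x : 0 <= n%:R * (q x + C).
  apply: mulr_ge0; first exact: ltW.
  have := qC x; rewrite ler_norml => /andP[+ _].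
  by rewrite -subr_ge0 opprK.
pose B (k : nat) := [set x : V | k%:R / n%:R - C <= q x < k.+1%:R / n%:R - C].
have mB k : measurable (B k).
  rewrite -[B k]setTI.
  exact: (mq measurableT `[k%:R / n%:R - C, k.+1%:R / n%:R - C[%classic (measurable_itv _)).
have BP k x : B k x <-> lev x = k.
  rewrite /B /= lerBlDr ltrBrDr ler_pdivrMr// ltr_pdivlMr// mulrC; split.
    exact: truncn_def.
  by move=> <-; exact: truncn_itv.
pose qn x : R := \sum_(k < K) k%:R / n%:R * \1_(B k) x - C.
have qnE x : qn x = (lev x)%:R / n%:R - C.
  have lK : (lev x < K)%N.
    rewrite ltnS; apply: le_truncn; rewrite ler_pM2l// mulr_natl mulr2n lerD2r.
    by apply: le_trans (qC x); exact: ler_norm.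
  rewrite /qn (bigD1 (Ordinal lK))//= indicE mem_set; last exact/BP.
  rewrite mulr1 big1 ?addr0// => k kl; rewrite indicE memNset ?mulr0//.
  by move=> /BP E; case/eqP: kl; apply: val_inj.
have close x : `|q x - qn x| <= n%:R^-1.
  rewrite qnE opprB addrA ger0_norm; last first.
    rewrite subr_ge0 ler_pdivrMr// mulrC.
    by have /andP[] := truncn_itv (qC0 x).
  rewrite lerBlDl -{2}[n%:R^-1]mul1r -mulrDl natr1 ler_pdivlMr// mulrC ltW//.
  by have /andP[] := truncn_itv (qC0 x).
have En : Ex P (fun z => qn (X z) * D z) = 0.
  rewrite (eq_Ex _ (g := fun z => \sum_(k < K) k%:R / n%:R * (\1_(B k) (X z) * D z)
      - C * (\1_setT (X z) * D z))); last first.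
    move=> z; rewrite /qn mulrBl mulr_suml indicT mul1r; congr (_ - _).
    by apply: eq_bigr => k _; rewrite mulrA.
  have bBD k : bm (fun z => \1_(B k) (X z) * D z) by apply: bmM => //; exact: bindX.
  rewrite ExB; last 2 first.
  - by apply: bm_sum => k _; exact: bmZ.
  - by apply/bmZ/bmM => //; exact: bindX.
  rewrite Ex_sum => [|k _]; last exact: bmZ.
  rewrite ExZ; last by apply: bmM => //; exact: bindX.
  rewrite H// mulr0 subr0 big1// => k _.
  by rewrite ExZ// H// mulr0.
have bqn : bm (fun z => qn (X z)).
  apply: bmB; last exact: bm_cst.
  by apply: bm_sum => k _; apply: bmZ; exact: bindX.
rewrite -[X in `|X|]subr0 -En -ExB; [|exact: bmM..].
apply: le_trans (Ex_norm _ _) _; first by apply: bmB; exact: bmM.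
apply: le_trans Mn; apply: Ex_le_cst => [|z].
  by apply: bm_norm; apply: bmB; exact: bmM.
rewrite -mulrBl normrM mulrC; exact: ler_pM.
Qed.

End CondExp.

(** * Risk and bias of the estimator under one law of the model *)

Section Clip.
Context {R : realType}.
Variables C1 C2 : R.

(** [A] and [Y] are only almost surely bounded; clipping them changes nothing
    almost surely and makes them bounded everywhere. *)
Definition clip (a : R) : R := Num.max C1 (Num.min C2 a).

Lemma clip_id a : C1 <= a <= C2 -> clip a = a.
Proof. by move=> /andP[a1 a2]; rewrite /clip min_r// max_r. Qed.

Lemma clip_bound a : `|clip a| <= `|C1| + `|C2|.
Proof.
rewrite /clip; have [_|] := leP (Num.min C2 a) C1; first by rewrite lerDl.
have [a2|a2] := leP C2 a => a1; first by rewrite lerDr.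
rewrite ler_norml; apply/andP; split.
  have : - `|C1| <= C1 by rewrite lerNl -normrN ler_norm.
  by have := normr_ge0 C2; lra.
have : C2 <= `|C2| by rewrite ler_norm.
by have := normr_ge0 C1; lra.
Qed.

Lemma bm_clip d (T : measurableType d) (f : T -> R) : measurable_fun [set: T] f ->
  bm (fun x => clip (f x)).
Proof.
move=> mf; split; last by exists (`|C1| + `|C2|) => x; exact: clip_bound.
apply: measurable_maxr; first exact: measurable_cst.
by apply: measurable_minr; first exact: measurable_cst.
Qed.

End Clip.

Section OneLaw.
Context {R : realType} {d S J0 : nat}.
Variable W : cdv_basis R d S J0.
Variables (C1 C2 : R).
Notation V := (covariate R d).
Notation mu := (unif_cube R d).
Notation X := (@obsX R d).
Variable P : probability (obs R d) R.

Hypothesis PX : forall B : set V, measurable B -> P (X @^-1` B) = mu B.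
Hypothesis PAY : {ae P, forall z, C1 <= obsA z <= C2 /\ C1 <= obsY z <= C2}.
Variables p b : V -> R.
Hypotheses (cep : is_cond_exp P (@obsA R d) p) (ceb : is_cond_exp P (@obsY R d) b).
Hypotheses (up : unif_continuous_cube p) (ub : unif_continuous_cube b).

Definition cA (z : obs R d) : R := clip C1 C2 (obsA z).
Definition cY (z : obs R d) : R := clip C1 C2 (obsY z).

Lemma bm_cA : bm cA. Proof. by apply: bm_clip; exact: measurable_obsA. Qed.
Lemma bm_cY : bm cY. Proof. by apply: bm_clip; exact: measurable_obsY. Qed.

Lemma bm_comp_obsX (g : V -> R) : bm g -> bm (fun z => g (X z)).
Proof. by move=> bg; exact: bm_comp bg (@measurable_obsX R d). Qed.

Lemma bm_reg (g : V -> R) : measurable_fun [set: V] g -> unif_continuous_cube g -> bm (res g).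
Proof.
move=> mg ug; apply: bm_res; first exact: measurable_funTS.
exact: unif_continuous_bounded.
Qed.

Let bp : bm (res p). Proof. by have [mp _ _] := cep; exact: bm_reg. Qed.
Let bb : bm (res b). Proof. by have [mb _ _] := ceb; exact: bm_reg. Qed.

Lemma ae_obsX (A : V -> Prop) : {ae mu, forall x, A x} -> {ae P, forall z, A (X z)}.
Proof.
move=> [N [mN N0 AN]]; exists (X @^-1` N); split; last by move=> z nA; apply: AN.
  exact: measurable_obsX_preimage.
by rewrite PX.
Qed.

Lemma Ex_obsX (g : V -> R) : bm g -> Ex P (fun z => g (X z)) = Ex mu g.
Proof.
move=> bg; rewrite -Ex_distribution//; congr fine.
by apply: eq_measure_integral => A mA _; exact: PX.
Qed.

Lemma cA_ae : {ae P, forall z, obsA z = cA z}.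
Proof. by apply: aeS PAY => z [HA _]; rewrite /cA clip_id. Qed.

Lemma cY_ae : {ae P, forall z, obsY z = cY z}.
Proof. by apply: aeS PAY => z [_ HY]; rewrite /cY clip_id. Qed.

Lemma integral_obsX_event (B : set V) (h h' : obs R d -> R) : measurable B ->
  measurable_fun [set: obs R d] h -> bm h' -> {ae P, forall z, h z = h' z} ->
  (\int[P]_(z in X @^-1` B) (h z)%:E)%E = (Ex P (fun z => \1_B (X z) * h' z))%:E.
Proof.
move=> mB mh bh' hh'.
have mXB := measurable_obsX_preimage mB.
have bind : bm (fun z => \1_B (X z) : R) by exact: bm_comp_obsX (bm_indic mB).
rewrite ExE; last exact: bmM.
rewrite [LHS]integral_mkcond; apply: ae_eq_integral => //.
- have /(measurable_restrictT (fun z => (h z)%:E)) mr := mXB; apply/mr.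
  by apply: measurable_funTS; exact/measurable_EFinP.
- by apply/measurable_EFinP; have [] := bmM bind bh'.
- apply: aeS hh' => z hz _; rewrite patchE indicE.
  case: ifPn => zB; first by rewrite mem_set ?mul1r ?hz//; exact: (set_mem zB).
  by move: zB; rewrite notin_setE => zB; rewrite memNset ?mul0r.
Qed.

Lemma pull_out_reg (f cf : obs R d -> R) (g q : V -> R) : is_cond_exp P f g ->
  measurable_fun [set: obs R d] f -> bm cf -> {ae P, forall z, f z = cf z} ->
  bm (res g) -> bm q ->
  Ex P (fun z => q (X z) * cf z) = ip mu q (res g).
Proof.
move=> [mg ig H] mf bcf fcf bg bq.
have bgX := bm_comp_obsX bg.
rewrite (pull_out bcf bg bq) => [|B mB].
  by apply: (Ex_obsX (g := fun x => q x * res g x)); exact: bmM.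
have mXB := measurable_obsX_preimage mB.
have bind : bm (fun z => \1_B (X z) : R) by exact: bm_comp_obsX (bm_indic mB).
have gae : {ae P, forall z, g (X z) = res g (X z)}.
  apply: (ae_obsX (A := fun x => g x = res g x)).
  by apply: aeS (res_ae_id g) => x ->.
have mgX : measurable_fun [set: obs R d] (fun z => g (X z)).
  exact: (measurableT_comp mg (@measurable_obsX R d)).
have := H B mB; rewrite (integral_obsX_event mB mgX bgX gae).
rewrite (integral_obsX_event mB mf bcf fcf) => HB0; have {HB0} HB := EFin_inj HB0.
rewrite (eq_Ex _ (g := fun z => \1_B (X z) * cf z - \1_B (X z) * res g (X z))).
  by rewrite ExB; [rewrite HB subrr|exact: bmM|exact: bmM].
by move=> z; rewrite mulrBr.
Qed.

Lemma pull_outA (q : V -> R) : bm q -> Ex P (fun z => q (X z) * cA z) = ip mu q (res p).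
Proof.
by move=> bq; apply: (pull_out_reg cep) => //; [exact: measurable_obsA|exact: bm_cA|exact: cA_ae].
Qed.

Lemma pull_outY (q : V -> R) : bm q -> Ex P (fun z => q (X z) * cY z) = ip mu q (res b).
Proof.
by move=> bq; apply: (pull_out_reg ceb) => //; [exact: measurable_obsY|exact: bm_cY|exact: cY_ae].
Qed.

(** [E (Cov (A, Y | X)) = E (A Y) - E (p(X) b(X))]; the arbitrary versions of the
    regression functions in the definition agree almost surely with [p] and [b]. *)
Lemma psi_covE : psi_cov P = Ex P (fun z => cA z * cY z) - ip mu (res p) (res b).
Proof.
rewrite /psi_cov /cond_cov.
have Hp' := cond_expP (ex_intro _ _ cep); have Hb' := cond_expP (ex_intro _ _ ceb).
set p' := cond_exp P (@obsA R d) in Hp' *; set b' := cond_exp P (@obsY R d) in Hb' *.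
have pX := bm_comp_obsX bp; have bX := bm_comp_obsX bb.
have bA := bm_cA; have bY := bm_cY.
have pae : {ae P, forall z, p' (X z) = res p (X z)}.
  apply: aeS2 (cond_exp_unique Hp' cep) (ae_obsX (res_ae_id p)) => z.
  by move=> -> ->.
have bae : {ae P, forall z, b' (X z) = res b (X z)}.
  apply: aeS2 (cond_exp_unique Hb' ceb) (ae_obsX (res_ae_id b)) => z.
  by move=> -> ->.
rewrite (mean_cond_exp (f' := fun z => (cA z - res p (X z)) * (cY z - res b (X z)))).
- rewrite (eq_Ex _ (g := fun z => cA z * cY z - res b (X z) * cA z
      - res p (X z) * cY z + res p (X z) * res b (X z))); last by move=> z; ring.
  rewrite ExD; [|by bm_tac|by bm_tac].
  rewrite ExB; [|by bm_tac|by bm_tac].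
  rewrite ExB; [|by bm_tac|by bm_tac].
  rewrite pull_outA// pull_outY//.
  rewrite (Ex_obsX (g := fun x => res p x * res b x)); last exact: bmM.
  by rewrite [ip mu (res b) _]ipC -/(ip mu (res p) (res b)); ring.
- have [mp' _ _] := Hp'; have [mb' _ _] := Hb'.
  apply: measurable_funM; apply: measurable_funB.
  + exact: measurable_obsA.
  + exact: (measurableT_comp mp' (@measurable_obsX R d)).
  + exact: measurable_obsY.
  + exact: (measurableT_comp mb' (@measurable_obsX R d)).
- by apply: bmM; apply: bmB.
- apply: aeS2 (aeS2 (fun z => @conj _ _) cA_ae cY_ae) (aeS2 (fun z => @conj _ _) pae bae).
  by move=> z [-> ->] [-> ->].
Qed.

Section AtLevel.
Variable j : nat.
Hypothesis J0j : (J0 <= j)%N.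
Notation I := (cdv_idx W j).

Definition obs_w (z : obs R d) : R := cA z * cY z.
Definition obs_u (m : I) (z : obs R d) : R := cA z * rphi m (X z).
Definition obs_v (m : I) (z : obs R d) : R := cY z * rphi m (X z).

Let bphiX (m : I) : bm (fun z => rphi m (X z)).
Proof. by apply: bm_comp_obsX; exact: bm_rphi. Qed.

Lemma bm_obs_w : bm obs_w. Proof. exact: (bmM bm_cA bm_cY). Qed.
Lemma bm_obs_u m : bm (obs_u m). Proof. exact: (bmM bm_cA (bphiX m)). Qed.
Lemma bm_obs_v m : bm (obs_v m). Proof. exact: (bmM bm_cY (bphiX m)). Qed.

(** The kernel is a sum of products of scaling functions, so the double sum over
    the sample splits into products of means. *)
Lemma psi_NR_plug_in n (t : n.-tuple (obs R d)) : psi_NR W j t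
  = plug_in (fun z => obsA z * obsY z) (fun m z => obsA z * @cdv_phi _ _ _ _ W j m (X z))
      (fun m z => obsY z * @cdv_phi _ _ _ _ W j m (X z)) t.
Proof.
rewrite /psi_NR /plug_in /smean /tsum.
under eq_bigr do rewrite mulrBr.
rewrite sumrB mulrBr; congr (_ - _).
under [RHS]eq_bigr do rewrite mulrACA -mulrA mulr_suml mulr_sumr.
rewrite -mulr_sumr exchange_big/= mulr_sumr [RHS]mulr_sumr; apply: eq_bigr => i _.
congr (_ * _); rewrite /b_hat /proj_kernel mulrCA -mulr_sumr; congr (_ * _).
rewrite mulr_sumr.
under eq_bigr do rewrite 2!mulr_sumr.
rewrite exchange_big/=; apply: eq_bigr => m _.
by rewrite mulr_sumr; apply: eq_bigr => l _; ring.
Qed.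

Lemma psi_NR_ae n : {ae iid P n, forall t : n.-tuple (obs R d),
  psi_NR W j t = plug_in obs_w obs_u obs_v t}.
Proof.
have XQ : {ae P, forall z, @cube R d (X z)} by apply: ae_obsX; exact: cube_ae.
have := iid_ae n (aeS2 (fun z => @conj _ _) XQ (aeS2 (fun z => @conj _ _) cA_ae cY_ae)).
apply: aeS => t H; rewrite psi_NR_plug_in /plug_in /smean /tsum.
congr (_ * _ - _).
  by apply: eq_bigr => i _; have [_ [-> ->]] := H i.
apply: eq_bigr => m _; congr (_ * _ * (_ * _)).
  by apply: eq_bigr => i _; have [Qx [-> _]] := H i; rewrite /obs_u /rphi res_in.
by apply: eq_bigr => i _; have [Qx [_ ->]] := H i; rewrite /obs_v /rphi res_in.
Qed.

Lemma measurable_psi_NR n : measurable_fun [set: n.-tuple (obs R d)] (@psi_NR _ _ _ _ W j n).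
Proof.
have msmean (V : obs R d -> R) : measurable_fun [set: obs R d] V ->
    measurable_fun [set: n.-tuple (obs R d)] (smean V).
  move=> mV; apply: measurable_funM; first exact: measurable_cst.
  apply: measurable_sum => i.
  exact: (measurableT_comp mV (measurable_tnth i)).
have mphi m : measurable_fun [set: obs R d] (fun z => @cdv_phi _ _ _ _ W j m (X z)).
  exact: (measurableT_comp (cdv_phi_meas m J0j) (@measurable_obsX R d)).
rewrite (_ : @psi_NR _ _ _ _ W j n = @plug_in R _ (obs R d) n I
    (fun z : obs R d => obsA z * obsY z)
    (fun m (z : obs R d) => obsA z * @cdv_phi _ _ _ _ W j m (X z))
    (fun m (z : obs R d) => obsY z * @cdv_phi _ _ _ _ W j m (X z))); last first.
  by apply/funext => t; exact: psi_NR_plug_in.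
have mA := @measurable_obsA R d; have mY := @measurable_obsY R d.
apply: measurable_funB; first by apply: msmean; exact: measurable_funM.
by apply: measurable_sum => m; apply: measurable_funM; apply: msmean; exact: measurable_funM.
Qed.

Lemma riskE n (theta : R) :
  (\int[iid P n]_z ((psi_NR W j z - theta) ^+ 2)%:E
    = (Ex (iid P n) (fun t => (plug_in obs_w obs_u obs_v t - theta) ^+ 2))%:E)%E.
Proof.
have bpl : bm (plug_in (n := n) obs_w obs_u obs_v).
  by apply: bm_plug_in; [exact: bm_obs_w|exact: bm_obs_u|exact: bm_obs_v].
have b2 : bm (fun t => (plug_in (n := n) obs_w obs_u obs_v t - theta) ^+ 2).
  by apply/bm_exp/bmB => //; exact: bm_cst.
rewrite ExE//; apply: ae_eq_integral => //.
- apply/measurable_EFinP; apply: measurable_funX; apply: measurable_funB.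
    exact: measurable_psi_NR.
  exact: measurable_cst.
- by apply/measurable_EFinP; case: b2.
- by apply: aeS (psi_NR_ae n) => t ->.
Qed.

Lemma Ex_obs_u m : Ex P (obs_u m) = ip mu (res p) (rphi m).
Proof.
rewrite ipC -pull_outA; last exact: bm_rphi.
by apply: eq_Ex => z; rewrite /obs_u mulrC.
Qed.

Lemma Ex_obs_v m : Ex P (obs_v m) = ip mu (res b) (rphi m).
Proof.
rewrite ipC -pull_outY; last exact: bm_rphi.
by apply: eq_Ex => z; rewrite /obs_v mulrC.
Qed.

Lemma targetE : plug_in_target P obs_w obs_u obs_v - psi_cov P
  = ip mu (res p) (res b) - phi_form W j (res p) (res b).
Proof.
rewrite /plug_in_target psi_covE /phi_form.
under eq_bigr do rewrite Ex_obs_u Ex_obs_v.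
by rewrite /obs_w; ring.
Qed.

(** The bias consists of the projection error and of a term of order [k / n]
    due to the observations that enter both means of a product. *)
Lemma bias_le_risk n : (0 < n)%N ->
  (((ip mu (res p) (res b) - phi_form W j (res p) (res b)
    - n%:R^-1 * (Ex P (fun z => cA z * cY z * \sum_(m : I) rphi m (X z) ^+ 2)
        - phi_form W j (res p) (res b))) ^+ 2)%R%:E
  <= \int[iid P n]_z ((psi_NR W j z - psi_cov P) ^+ 2)%:E)%E.
Proof.
move=> n0; rewrite riskE lee_fin.
have E : \sum_m (Ex P (fun z => obs_u m z * obs_v m z) - Ex P (obs_u m) * Ex P (obs_v m))
    = Ex P (fun z => cA z * cY z * \sum_(m : I) rphi m (X z) ^+ 2)
      - phi_form W j (res p) (res b).
  rewrite sumrB; congr (_ - _); last first.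
    by apply: eq_bigr => m _; rewrite Ex_obs_u Ex_obs_v.
  rewrite -Ex_sum; last by move=> m _; apply: bmM; [exact: bm_obs_u|exact: bm_obs_v].
  apply: eq_Ex => z; rewrite mulr_sumr; apply: eq_bigr => m _.
  by rewrite /obs_u /obs_v; ring.
have := plug_in_bias_le_risk P n bm_obs_w bm_obs_u bm_obs_v (psi_cov P).
by rewrite (Ex_plug_in P n0 bm_obs_w bm_obs_u bm_obs_v) addrAC targetE E.
Qed.

Let B : R := `|C1| + `|C2|.
Let B0 : 0 <= B. Proof. by rewrite addr_ge0. Qed.

Lemma sqr_le_pM (x c : R) : 0 <= x -> 0 <= c -> x ^+ 2 <= x * c -> x <= c.
Proof.
move=> x0 c0; rewrite expr2; have [->//|xn0] := eqVneq x 0.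
by rewrite ler_pM2l// lt_neqAle eq_sym xn0.
Qed.

Lemma cA_sqr z : cA z ^+ 2 <= B ^+ 2.
Proof. by rewrite -real_normK ?num_real// ler_sqr ?nnegrE//; exact: clip_bound. Qed.

Lemma cY_sqr z : cY z ^+ 2 <= B ^+ 2.
Proof. by rewrite -real_normK ?num_real// ler_sqr ?nnegrE//; exact: clip_bound. Qed.

(** A conditional expectation does not increase the second moment. *)
Lemma reg_sqr_le (g : V -> R) (f : obs R d -> R) : bm g -> bm f ->
  Ex P (fun z => g (X z) * f z) = ip mu g g -> (forall z, f z ^+ 2 <= B ^+ 2) ->
  ip mu g g <= B ^+ 2.
Proof.
move=> bg bf E fB; have bgX := bm_comp_obsX bg.
apply: sqr_le_pM; [exact: ip_ge0|exact: sqr_ge0|].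
rewrite -{1}E; apply: le_trans (Ex_CS P bgX bf) _.
have -> : Ex P (fun z => g (X z) ^+ 2) = ip mu g g.
  rewrite (Ex_obsX (g := fun x => g x ^+ 2)); last exact: bm_exp.
  by apply: eq_Ex => x; rewrite expr2.
apply: ler_wpM2l; first exact: ip_ge0.
by apply: Ex_le_cst => //; exact: bm_exp.
Qed.

Let pB : ip mu (res p) (res p) <= B ^+ 2.
Proof. exact: (reg_sqr_le bp bm_cA (pull_outA bp) cA_sqr). Qed.

Let bB : ip mu (res b) (res b) <= B ^+ 2.
Proof. exact: (reg_sqr_le bb bm_cY (pull_outY bb) cY_sqr). Qed.

Definition proj (g : V -> R) : V -> R := lincomb (@rphi _ _ _ _ W j) (fun m => ip mu g (rphi m)).

Lemma bm_proj g : bm (proj g).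
Proof. by apply: bm_lincomb => m; exact: bm_rphi. Qed.

Lemma ip_proj g : ip mu (proj g) (proj g) = phi_form W j g g.
Proof.
have bphi (m : I) := bm_rphi m J0j.
rewrite ip_lincombl//; last exact: bm_proj.
apply: eq_bigr => m _; congr (_ * _).
by rewrite ipC /proj ip_lincomb_coef// => m1 m2; exact: rphi_on.
Qed.

Lemma Ex_mul_proj_le (f : obs R d -> R) (g : V -> R) : bm f -> bm g ->
  (forall z, f z ^+ 2 <= B ^+ 2) -> ip mu g g <= B ^+ 2 ->
  Ex P (fun z => (f z * proj g (X z)) ^+ 2) <= B ^+ 4.
Proof.
move=> bf bg fB gB; have bpj := bm_proj g; have bpX := bm_comp_obsX bpj.
apply: (@le_trans _ _ (Ex P (fun z => B ^+ 2 * proj g (X z) ^+ 2))).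
  apply: Ex_le; [by apply/bm_exp/bmM|by apply/bmZ/bm_exp|move=> z].
  by rewrite exprMn ler_wpM2r// sqr_ge0.
rewrite ExZ; last exact: bm_exp.
rewrite (Ex_obsX (g := fun x => proj g x ^+ 2)); last exact: bm_exp.
rewrite (eq_Ex _ (g := fun x => proj g x * proj g x)) => [|x]; last by rewrite expr2.
rewrite -[Ex mu _]/(ip mu (proj g) (proj g)) ip_proj.
rewrite (_ : B ^+ 4 = B ^+ 2 * B ^+ 2) ?ler_wpM2l ?sqr_ge0//; last by ring.
exact: le_trans (phi_form_le W J0j bg) gB.
Qed.

(** The linear part is [A Y - Y Pi p(X) - A Pi b(X)] with [Pi] the projection on
    [V_j]; each term has second moment at most [B ^ 4] since [Pi] is a contraction. *)
Lemma plug_in_lin_sqr : Ex P (fun z => plug_in_lin P obs_w obs_u obs_v z ^+ 2) <= 9 * B ^+ 4.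
Proof.
have bA := bm_cA; have bY := bm_cY.
have bpX := bm_comp_obsX (bm_proj (res p)); have bbX := bm_comp_obsX (bm_proj (res b)).
have linE z : plug_in_lin P obs_w obs_u obs_v z
    = cA z * cY z - cY z * proj (res p) (X z) - cA z * proj (res b) (X z).
  rewrite /plug_in_lin /obs_w big_split/= opprD addrA; congr (_ - _ - _);
    rewrite /proj /lincomb mulr_sumr; apply: eq_bigr => m _.
    by rewrite Ex_obs_u /obs_v; ring.
  by rewrite Ex_obs_v /obs_u; ring.
apply: (@le_trans _ _ (Ex P (fun z => 3 * B ^+ 4 + 3 * (cY z * proj (res p) (X z)) ^+ 2
    + 3 * (cA z * proj (res b) (X z)) ^+ 2))).
  apply: Ex_le.
  - by apply: bm_exp; apply: bm_plug_in_lin; [exact: bm_obs_w|exact: bm_obs_u|exact: bm_obs_v].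
  - by bm_tac.
  move=> z; rewrite linE.
  have H4 : (cA z * cY z) ^+ 2 <= B ^+ 4.
    rewrite exprMn (_ : B ^+ 4 = B ^+ 2 * B ^+ 2); last by ring.
    by apply: ler_pM; rewrite ?sqr_ge0// ?cA_sqr ?cY_sqr.
  move: H4; set x := cA z * cY z; set y := cY z * _; set t := cA z * _ => H4.
  have := sqr_ge0 (x + y); have := sqr_ge0 (x + t); have := sqr_ge0 (y - t); nra.
rewrite ExD; [|by bm_tac|by bm_tac].
rewrite ExD; [|by bm_tac|by bm_tac].
rewrite !ExZ; [|by bm_tac..].
rewrite Ex_cst -[B * _]/(B ^+ 4).
have H1 := Ex_mul_proj_le bY bp cY_sqr pB; have H2 := Ex_mul_proj_le bA bb cA_sqr bB.
by move: H1 H2; move: (Ex _ _) (Ex _ _) (B ^+ 4) => x1 x2 x3 *; lra.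
Qed.

Lemma Ex_sqnorm_le (f : obs R d -> R) : bm f -> (forall z, f z ^+ 2 <= B ^+ 2) ->
  Ex P (sqnorm (fun (m : I) z => f z * rphi m (X z))) <= B ^+ 2 * #|I|%:R.
Proof.
move=> bf fB.
rewrite Ex_sum; last by move=> m _; apply/bm_exp/bmM.
rewrite mulr_natr -sumr_const; apply: ler_sum => m _.
have bphi := bm_rphi m J0j.
apply: (@le_trans _ _ (Ex P (fun z => B ^+ 2 * rphi m (X z) ^+ 2))).
  apply: Ex_le; [by apply/bm_exp/bmM|by apply/bmZ/bm_exp|move=> z].
  by rewrite exprMn ler_wpM2r// sqr_ge0.
rewrite ExZ; last exact: bm_exp.
rewrite (Ex_obsX (g := fun x => rphi m x ^+ 2)); last exact: bm_exp.
rewrite (eq_Ex _ (g := fun x => rphi m x * rphi m x)) => [|x]; last by rewrite expr2.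
by rewrite -[Ex mu _]/(ip mu (rphi m) (rphi m)) rphi_on// eqxx mulr1.
Qed.

Lemma sqnorm_le (f : obs R d -> R) (c : R) : (forall z, f z ^+ 2 <= B ^+ 2) ->
  (forall (m : I) x, rphi m x ^+ 2 <= c) ->
  forall z, sqnorm (fun (m : I) z => f z * rphi m (X z)) z <= B ^+ 2 * #|I|%:R * c.
Proof.
move=> fB phic z; rewrite mulrAC mulr_natr -sumr_const; apply: ler_sum => m _.
by rewrite exprMn; apply: ler_pM; rewrite ?sqr_ge0.
Qed.

Lemma risk_le n (c : R) : (0 < n)%N -> (forall (m : I) x, rphi m x ^+ 2 <= c) ->
  (\int[iid P n]_z ((psi_NR W j z - psi_cov P) ^+ 2)%:E <=
   (3 * (9 * B ^+ 4 / n%:R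
      + (ip mu (res p) (res b) - phi_form W j (res p) (res b)) ^+ 2
      + (3 * (B ^+ 2 * #|I|%:R) ^+ 2 / n%:R ^+ 2
         + 4 * (B ^+ 2 * #|I|%:R * c) * (B ^+ 2 * #|I|%:R) / n%:R ^+ 3)))%:E)%E.
Proof.
move=> n0 phic; rewrite riskE lee_fin -targetE.
apply: (plug_in_risk_le n0 bm_obs_w bm_obs_u bm_obs_v).
- exact: plug_in_lin_sqr.
- exact: (Ex_sqnorm_le bm_cA cA_sqr).
- exact: (Ex_sqnorm_le bm_cY cY_sqr).
- exact: sqnorm_le cA_sqr phic.
- exact: sqnorm_le cY_sqr phic.
Qed.

End AtLevel.
End OneLaw.

(** * Upper bound for the maximal risk *)

Section UpperBound.
Context {R : realType} {d S J0 : nat}.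
Variable W : cdv_basis R d S J0.
Variables (C1 C2 alpha beta M : R).
Hypothesis ab0 : 0 < alpha + beta.
Notation rho := (2 `^ (- (alpha + beta))).

Let bound_arith (B4 D K1 K2 N k n rj x : R) : 0 <= B4 -> 0 <= D -> 0 <= K1 -> 0 <= K2 ->
  0 < n -> 0 <= N -> 0 <= k -> N <= K1 * k -> 0 <= rj -> x ^+ 2 <= (D * rj) ^+ 2 ->
  3 * (9 * B4 / n + x ^+ 2 + (3 * (B4 * N ^+ 2) / n ^+ 2
     + 4 * (B4 * N ^+ 2 * (K2 * k)) / n ^+ 3))
  <= (27 * B4 + 3 * D ^+ 2 + 9 * B4 * K1 ^+ 2 + 12 * B4 * K1 ^+ 2 * K2)
     * (n^-1 + rj ^+ 2 + (k ^+ 2 / n ^+ 2 + k ^+ 3 / n ^+ 3)).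
Proof.
move=> B0 D0 K10 K20 n0 N0 k0 NK r0 xD.
have ni0 : 0 <= n^-1 by rewrite invr_ge0 ltW.
rewrite -!exprVn; move: ni0; set i := n^-1 => i0.
have N2 : N ^+ 2 <= K1 ^+ 2 * k ^+ 2 by rewrite -exprMn ler_sqr ?nnegrE// mulr_ge0.
rewrite exprMn in xD.
have e1 : B4 * N ^+ 2 * i ^+ 2 <= B4 * (K1 ^+ 2 * k ^+ 2) * i ^+ 2.
  by rewrite ler_wpM2r ?sqr_ge0// ler_wpM2l.
have e2 : B4 * N ^+ 2 * (K2 * k) * i ^+ 3 <= B4 * (K1 ^+ 2 * k ^+ 2) * (K2 * k) * i ^+ 3.
  by rewrite ler_wpM2r ?exprn_ge0// ler_wpM2r ?mulr_ge0// ler_wpM2l.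
set Q := _ + _ + _ + _.
have Q1 : 27 * B4 <= Q.
  by rewrite /Q -!addrA lerDl !addr_ge0 ?mulr_ge0 ?sqr_ge0.
have Q2 : 3 * D ^+ 2 <= Q.
  by rewrite /Q [27 * _ + _]addrC -!addrA lerDl !addr_ge0 ?mulr_ge0 ?sqr_ge0.
have Q3 : 9 * B4 * K1 ^+ 2 <= Q.
  by rewrite /Q -!addrA [_ + (_ + (_ + _))]addrA [X in _ <= _ + X]addrC
     [_ + (_ + _)]addrA lerDr addr_ge0 ?addr_ge0 ?mulr_ge0 ?sqr_ge0.
have Q4 : 12 * B4 * K1 ^+ 2 * K2 <= Q by rewrite /Q lerDr !addr_ge0 ?mulr_ge0 ?sqr_ge0.
have t1 := ler_wpM2r i0 Q1.
have t2 := ler_wpM2r (sqr_ge0 rj) Q2.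
have t3 := ler_wpM2r (mulr_ge0 (sqr_ge0 k) (sqr_ge0 i)) Q3.
have t4 := ler_wpM2r (mulr_ge0 (exprn_ge0 3 k0) (exprn_ge0 3 i0)) Q4.
rewrite [leRHS]mulrDr [X in _ <= X + _]mulrDr [X in _ <= _ + X]mulrDr.
have e1' : 9 * (B4 * N ^+ 2 * i ^+ 2) <= 9 * B4 * K1 ^+ 2 * (k ^+ 2 * i ^+ 2).
  rewrite (_ : 9 * B4 * K1 ^+ 2 * (k ^+ 2 * i ^+ 2) = 9 * (B4 * (K1 ^+ 2 * k ^+ 2) * i ^+ 2)).
    by rewrite ler_wpM2l.
  by ring.
have e2' : 12 * (B4 * N ^+ 2 * (K2 * k) * i ^+ 3)
    <= 12 * B4 * K1 ^+ 2 * K2 * (k ^+ 3 * i ^+ 3).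
  rewrite (_ : 12 * B4 * K1 ^+ 2 * K2 * (k ^+ 3 * i ^+ 3)
    = 12 * (B4 * (K1 ^+ 2 * k ^+ 2) * (K2 * k) * i ^+ 3)).
    by rewrite ler_wpM2l.
  by ring.
have := le_trans e1' t3; have := le_trans e2' t4.
have : 3 * x ^+ 2 <= Q * rj ^+ 2.
  by apply: le_trans t2; rewrite -mulrA ler_wpM2l.
move: t1; rewrite (_ : 3 * (9 * B4 * i + x ^+ 2 + (3 * (B4 * N ^+ 2) * i ^+ 2 +
    4 * (B4 * N ^+ 2 * (K2 * k)) * i ^+ 3)) = 27 * B4 * i + 3 * x ^+ 2 +
    (9 * (B4 * N ^+ 2 * i ^+ 2) + 12 * (B4 * N ^+ 2 * (K2 * k) * i ^+ 3))); last by ring.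
by move=> h1 h2 h3 h4; apply: lerD; apply: lerD.
Qed.

(** The four terms are the variance of the linear part, the squared projection
    error, and the second and fourth order moments of the quadratic part. *)
Lemma max_risk_le : exists2 K : R, 0 <= K & forall (j : nat -> nat) n,
  (0 < n)%N -> (J0 <= j n)%N ->
  (max_risk W C1 C2 alpha beta M j n <=
   (K * (n%:R^-1 + (rho ^+ j n) ^+ 2
         + ((2 ^+ (j n * d)) ^+ 2 / n%:R ^+ 2 + (2 ^+ (j n * d)) ^+ 3 / n%:R ^+ 3)))%:E)%E.
Proof.
have [K1 K10 HK1] := card_idx_le W; have [K2 K20 HK2] := rphi_bound W.
have [D D0 HD] := proj_error W M ab0.
pose B := `|C1| + `|C2|.
exists (27 * B ^+ 4 + 3 * D ^+ 2 + 9 * B ^+ 4 * K1 ^+ 2 + 12 * B ^+ 4 * K1 ^+ 2 * K2).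
  have B40 : 0 <= B ^+ 4 by rewrite exprn_ge0// addr_ge0.
  have K1' := ltW K10; move: B40; move: (B ^+ 4) => b4 b40.
  by rewrite !addr_ge0 ?mulr_ge0 ?sqr_ge0.
move=> j n n0 J0j; pose k : R := 2 ^+ (j n * d); apply: ge_ereal_sup => _ [P [PX PAY [p cep [up Hp]] [b ceb [ub Hb]]] ->].
have bp : bm (res p) by have [mp _ _] := cep; exact: bm_reg.
have bb : bm (res b) by have [mb _ _] := ceb; exact: bm_reg.
apply: (le_trans (risk_le PX PAY cep ceb up ub J0j n0 (fun m x => HK2 _ m x J0j))).
rewrite lee_fin -/B -/k.
have nN : 0 < n%:R :> R by rewrite ltr0n.
have k0 : 0 <= k by rewrite exprn_ge0.
have B40 : 0 <= B ^+ 4 by rewrite exprn_ge0// addr_ge0.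
have rho0 : 0 <= rho ^+ j n by rewrite exprn_ge0// powR_ge0.
have HDj := HD p b (j n) bp bb Hp Hb J0j.
have := @bound_arith (B ^+ 4) D K1 K2 #|cdv_idx W (j n)|%:R k n%:R (rho ^+ j n)
  (ip (unif_cube R d) (res p) (res b) - phi_form W (j n) (res p) (res b))
  B40 D0 (ltW K10) K20 nN (ler0n _ _) k0 (HK1 _ J0j) rho0.
move=> H; apply: le_trans (H _); last first.
  by rewrite -real_normK ?num_real// ler_sqr ?nnegrE ?mulr_ge0.
rewrite le_eqVlt; apply/orP; left; apply/eqP; congr (3 * (_ + _ + (_ / _ + _ / _))); ring.
Qed.

End UpperBound.

(** * Laws with prescribed regression functions *)

Section Coin.
Context {R : realType}.

Definition coin : probability bool R := bernoulli_prob (2^-1 : R).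

Lemma coin_bm (f : bool -> R) : bm f.
Proof.
split => //; exists (`|f true| + `|f false|) => -[]; [rewrite lerDl|rewrite lerDr]; exact: normr_ge0.
Qed.

Lemma Ex_coin (f : bool -> R) : Ex coin f = (f true + f false) / 2.
Proof.
have mt : measurable [set true] by [].
have H : Ex coin (\1_[set true] : bool -> R) = 2^-1.
  apply: EFin_inj; rewrite Ex_indic//.
  rewrite -[LHS]/(bernoulli_prob (2^-1 : R) [set true]) bernoulli_probE; last first.
    by rewrite invr_ge0 ler0n invf_le1 ?ler1n ?ltr0n.
  by rewrite !diracE mem_set// memNset// mule1 mule0 adde0.
rewrite (eq_Ex _ (g := fun t => f false + (f true - f false) * \1_[set true] t)); last first.
  case; rewrite indicE; first by rewrite mem_set// mulr1 addrC subrK.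
  by rewrite memNset// mulr0 addr0.
rewrite ExD; [|exact: coin_bm..].
rewrite Ex_cst ExZ ?H; last exact: coin_bm.
by field.
Qed.

End Coin.

Section TwoPoint.
Context {R : realType} {d : nat}.
Notation V := (covariate R d).
Notation mu := (unif_cube R d).
Notation X := (@obsX R d).
Variables (p b : {mfun V >-> measurableTypeR R}) (sigma s : R).

(** When the boolean is a fair coin independent of the covariate, the regression functions are [p]
    and [b], and the conditional covariance is [s sigma ^ 2]: its sign can be
    chosen without changing the regression functions. *)
Definition two_point (t : V * bool) : obs R d :=
  let tau := if t.2 then sigma else - sigma in
  ((t.1, p t.1 + tau), b t.1 + s * tau).

Lemma measurable_two_point : measurable_fun [set: V * bool] two_point.
Proof.
have mtau : measurable_fun [set: V * bool]
    (fun t : V * bool => (if t.2 then sigma else - sigma) : measurableTypeR R).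
  by apply: (measurableT_comp (_ : measurable_fun [set: bool] (fun t : bool => if t then sigma else - sigma))).
have mpf (f : {mfun V >-> measurableTypeR R}) :
    measurable_fun [set: V * bool] (fun t : V * bool => f t.1 : R).
  exact: (measurableT_comp (@measurable_funPT _ _ _ _ f) measurable_fst).
apply: measurable_fun_pair; last first.
  by apply: measurable_funD => //; apply: measurable_funM.
by apply: measurable_fun_pair => //; apply: measurable_funD.
Qed.

HB.instance Definition _ := isMeasurableFun.Build _ _ _ _ two_point measurable_two_point.

Definition two_point_law : probability (obs R d) R := distribution (mu \x coin)%E two_point.

Lemma Ex_two_point_law (G : obs R d -> R) : bm G -> Ex two_point_law G
  = Ex mu (fun x => (G (two_point (x, true)) + G (two_point (x, false))) / 2).
Proof.
move=> bG; rewrite [LHS]Ex_distribution// Ex_prod; last exact: bm_comp bG measurable_two_point.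
by apply: eq_Ex => x; rewrite Ex_coin.
Qed.

Variables (C1 C2 : R).
Hypotheses (sigma0 : 0 <= sigma) (s1 : `|s| <= 1).
Hypotheses (p_in : forall x, C1 + sigma <= p x <= C2 - sigma)
  (b_in : forall x, C1 + sigma <= b x <= C2 - sigma).

Let tau (t : bool) : R := if t then sigma else - sigma.

Let tau_in (c t : R) : `|t| <= sigma -> C1 + sigma <= c <= C2 - sigma -> C1 <= c + t <= C2.
Proof. by rewrite ler_norml => /andP[t1 t2] /andP[c1 c2]; apply/andP; split; lra. Qed.

Let tau_le t : `|tau t| <= sigma.
Proof. by case: t; rewrite /tau ?normrN ger0_norm. Qed.

Let obsA_in t : C1 <= obsA (two_point t) <= C2.
Proof. exact: tau_in (tau_le _) (p_in _). Qed.

Let obsY_in t : C1 <= obsY (two_point t) <= C2.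
Proof.
apply: tau_in (b_in _); rewrite normrM -[leRHS]mul1r.
by apply: ler_pM => //; exact: tau_le.
Qed.

Let cA_two_point t : cA C1 C2 (two_point t) = p t.1 + tau t.2.
Proof. by rewrite /cA clip_id. Qed.

Let cY_two_point t : cY C1 C2 (two_point t) = b t.1 + s * tau t.2.
Proof. by rewrite /cY clip_id. Qed.

Let P := two_point_law.

Lemma two_point_lawX (B : set V) : measurable B -> P (X @^-1` B) = mu B.
Proof.
move=> mB; rewrite -[LHS]/((mu \x coin)%E (two_point @^-1` (X @^-1` B))).
rewrite (_ : two_point @^-1` _ = B `*` setT); last first.
  by apply/seteqP; split => -[x t]; rewrite /= /obsX/=; tauto.
by rewrite product_measure1E// [X in (_ * X)%E]probability_setT mule1.
Qed.

Lemma two_point_bounds : {ae P, forall z, C1 <= obsA z <= C2 /\ C1 <= obsY z <= C2}.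
Proof.
have mI (f : obs R d -> R) : measurable_fun [set: obs R d] f ->
    measurable [set z | C1 <= f z <= C2].
  move=> mf; rewrite -[X in measurable X]setTI.
  exact: (mf measurableT `[C1, C2]%classic (measurable_itv _)).
exists (~` ([set z : obs R d | C1 <= obsA z <= C2] `&` [set z | C1 <= obsY z <= C2])); split.
- by apply/measurableC/measurableI; apply: mI; [exact: measurable_obsA|exact: measurable_obsY].
- rewrite -[LHS]/((mu \x coin)%E (two_point @^-1` _)).
  rewrite (_ : two_point @^-1` _ = set0) ?measure0//.
  by apply/seteqP; split => t //=; apply; split; [exact: obsA_in|exact: obsY_in].
- by move=> z.
Qed.

Let bm_in (f : {mfun V >-> measurableTypeR R}) : (forall x, C1 + sigma <= f x <= C2 - sigma) ->
  bm (f : V -> R).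
Proof.
move=> fin; split; first exact: (@measurable_funPT _ _ _ _ f).
exists (`|C1| + `|C2|) => x.
rewrite -(@clip_id R C1 C2 (f x)) ?clip_bound//.
by rewrite -[f x]addr0; apply: tau_in (fin x); rewrite normr0.
Qed.

Let bm_p : bm (p : V -> R). Proof. exact: bm_in p_in. Qed.
Let bm_b : bm (b : V -> R). Proof. exact: bm_in b_in. Qed.

Let two_point_cond_exp (f cf : obs R d -> R) (g : {mfun V >-> measurableTypeR R}) :
  measurable_fun [set: obs R d] f -> bm cf -> {ae P, forall z, f z = cf z} ->
  bm (g : V -> R) ->
  (forall x, cf (two_point (x, true)) + cf (two_point (x, false)) = 2 * g x) ->
  is_cond_exp P f g.
Proof.
move=> mf bcf fcf bg H.
have bgX : bm (fun z => g (X z) : R) := bm_comp_obsX bg.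
split; [exact: (@measurable_funPT _ _ _ _ g)|exact: (bm_integrable P bgX)|].
move=> B mB; rewrite (integral_obsX_event mB mf bcf fcf).
rewrite (integral_obsX_event mB (proj1 bgX) bgX); last exact: aeW.
have bB : bm (fun z : obs R d => \1_B (X z) : R) := bm_comp_obsX (bm_indic mB).
congr (_%:E); rewrite !Ex_two_point_law; [|exact: bmM..].
apply: eq_Ex => x; rewrite -!mulrDr; congr (_ / 2).
by rewrite H /obsX/= mulr_natl mulr2n.
Qed.

Lemma two_point_regA : is_cond_exp P (@obsA R d) p.
Proof.
apply: (two_point_cond_exp (cf := cA C1 C2)) => //; [exact: measurable_obsA|exact: bm_cA| |].
  exact: cA_ae two_point_bounds.
by move=> x; rewrite !cA_two_point /tau/=; ring.
Qed.

Lemma two_point_regY : is_cond_exp P (@obsY R d) b.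
Proof.
apply: (two_point_cond_exp (cf := cY C1 C2)) => //; [exact: measurable_obsY|exact: bm_cY| |].
  exact: cY_ae two_point_bounds.
by move=> x; rewrite !cY_two_point /tau/=; ring.
Qed.

Lemma Ex_two_point_cov (N : V -> R) : bm N ->
  Ex P (fun z => cA C1 C2 z * cY C1 C2 z * N (X z))
  = Ex mu (fun x => p x * b x * N x) + s * sigma ^+ 2 * Ex mu N.
Proof.
move=> bN; have bNX := bm_comp_obsX bN.
have bA := @bm_cA R d C1 C2; have bY := @bm_cY R d C1 C2.
rewrite Ex_two_point_law; last by bm_tac.
rewrite -ExZ// -ExD; [|by bm_tac|by bm_tac].
apply: eq_Ex => x; rewrite !cA_two_point !cY_two_point /obsX/= /tau/=.
by field.
Qed.

End TwoPoint.

(** * Lower bound for the maximal risk *)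

Section BiasLowerBound.
Context {R : realType} {d S J0 : nat}.
Variable W : cdv_basis R d S J0.
Variables (C1 C2 alpha beta M : R).
Notation V := (covariate R d).
Notation mu := (unif_cube R d).
Notation Q := (@cube R d).

Definition kernel_diag j (x : V) : R := \sum_(m : cdv_idx W j) rphi m x ^+ 2.

Lemma bm_kernel_diag j : (J0 <= j)%N -> bm (kernel_diag j).
Proof. by move=> J0j; apply: bm_sum => m _; apply: bm_exp; exact: bm_rphi. Qed.

Lemma Ex_kernel_diag j : (J0 <= j)%N -> Ex mu (kernel_diag j) = #|cdv_idx W j|%:R.
Proof.
move=> J0j; rewrite Ex_sum; last by move=> m _; apply: bm_exp; exact: bm_rphi.
rewrite -sum1_card natr_sum; apply: eq_bigr => m _.
rewrite (eq_Ex _ (g := fun x => rphi m x * rphi m x)) => [|x]; last by rewrite expr2.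
by rewrite -[Ex mu _]/(ip mu (rphi m) (rphi m)) rphi_on// eqxx.
Qed.

(** The bias under a law with regression functions [f], [g] and conditional
    covariance [c]. *)
Definition nr_bias j n (c : R) (f g : V -> R) : R :=
  ip mu f g - phi_form W j f g
  - n%:R^-1 * (ip mu f (fun x => g x * kernel_diag j x) + c * #|cdv_idx W j|%:R
      - phi_form W j f g).

Lemma holder_ball_bm gamma f : holder_ball W gamma M f -> bm (res f).
Proof.
move=> [uf _]; apply: bm_res; first exact: unif_continuous_measurable.
exact: unif_continuous_bounded.
Qed.

Lemma eq_holder_ball gamma f g : (forall x, Q x -> f x = g x) ->
  holder_ball W gamma M f -> holder_ball W gamma M g.
Proof.
move=> fg [uf Hf]; split; last by rewrite -(eq_holder_norm W gamma fg).
move=> e e0; have [del del0 H] := uf e e0; exists del => // x y Qx Qy xy.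
by rewrite -!fg//; exact: H.
Qed.

(** The values of [p] and [b] outside the cube are arbitrary, perhaps not even
    measurable; the law is built from extensions that satisfy the bounds
    everywhere. *)
Lemma bias_le_max_risk (p b : V -> R) (sigma s : R) (j : nat -> nat) n :
  (0 < n)%N -> (J0 <= j n)%N -> 0 <= sigma -> `|s| <= 1 ->
  holder_ball W alpha M p -> holder_ball W beta M b ->
  (forall x, Q x -> C1 + sigma <= p x <= C2 - sigma) ->
  (forall x, Q x -> C1 + sigma <= b x <= C2 - sigma) ->
  ((nr_bias (j n) n (s * sigma ^+ 2) (res p) (res b) ^+ 2)%:E
   <= max_risk W C1 C2 alpha beta M j n)%E.
Proof.
move=> n0 J0j sigma0 s1 Hp Hb pin bin.
have bp := holder_ball_bm Hp; have bb := holder_ball_bm Hb.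
have C12 : C1 + sigma <= C2 - sigma.
  have Q0 : Q [tuple 0 | _ < d] by move=> i; rewrite tnth_mktuple lexx ler01.
  by have /andP[] := pin _ Q0; exact: le_trans.
pose ext (f : V -> R) (x : V) : measurableTypeR R := clip (C1 + sigma) (C2 - sigma) (res f x).
have ext_in f x : C1 + sigma <= ext f x <= C2 - sigma.
  by rewrite /ext /clip le_max lexx/= ge_max C12 ge_min lexx.
have extE f : (forall x, Q x -> C1 + sigma <= f x <= C2 - sigma) -> forall x, Q x -> f x = ext f x.
  by move=> fin x Qx; rewrite /ext res_in// clip_id//; exact: fin.
have mext f : bm (res f) -> measurable_fun [set: V] (ext f) by move=> [mf _]; have [] := bm_clip (C1 + sigma) (C2 - sigma) mf.
pose p' : {mfun V >-> measurableTypeR R} :=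
  HB.pack (ext p) (isMeasurableFun.Build _ _ _ _ (ext p) (mext p bp)).
pose b' : {mfun V >-> measurableTypeR R} :=
  HB.pack (ext b) (isMeasurableFun.Build _ _ _ _ (ext b) (mext b bb)).
have p'E : res p' = res p by apply: resP => x Qx; exact/esym/(extE _ pin).
have b'E : res b' = res b by apply: resP => x Qx; exact/esym/(extE _ bin).
have [up' Hp'] : holder_ball W alpha M p' := eq_holder_ball (extE _ pin) Hp.
have [ub' Hb'] : holder_ball W beta M b' := eq_holder_ball (extE _ bin) Hb.
have PX := @two_point_lawX R d p' b' sigma s.
have PB := @two_point_bounds R d p' b' sigma s C1 C2 sigma0 s1 (ext_in p) (ext_in b).
have PA := @two_point_regA R d p' b' sigma s C1 C2 sigma0 s1 (ext_in p) (ext_in b).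
have PY := @two_point_regY R d p' b' sigma s C1 C2 sigma0 s1 (ext_in p) (ext_in b).
have PC := @Ex_two_point_cov R d p' b' sigma s C1 C2 sigma0 s1 (ext_in p) (ext_in b)
  _ (bm_kernel_diag J0j).
apply: le_ereal_sup_tmp; eexists.
  exists (two_point_law p' b' sigma s); last by [].
  by split => //; [exists (p' : V -> R)|exists (b' : V -> R)].
have PR := @bias_le_risk R d S J0 W C1 C2 (two_point_law p' b' sigma s) PX PB p' b' PA PY up' ub' (j n) J0j n n0.
apply: le_trans PR.
rewrite PC Ex_kernel_diag// p'E b'E lee_fin /nr_bias le_eqVlt; apply/orP; left; apply/eqP.
congr ((_ - _ * (_ + _ - _)) ^+ 2).
rewrite -p'E -b'E; apply: eq_Ex => x.
have [Qx|nQ] := pselect (Q x); first by rewrite !res_in// mulrA.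
have K0 : kernel_diag (j n) x = 0.
  by rewrite /kernel_diag big1// => m _; rewrite /rphi res_out// expr0n.
by rewrite K0 !mulr0.
Qed.

End BiasLowerBound.

Section LowerBound.
Context {R : realType} {d S J0 : nat}.
Variable W : cdv_basis R d S J0.
Variables (C1 C2 alpha beta M : R).
Notation V := (covariate R d).
Notation mu := (unif_cube R d).
Notation Q := (@cube R d).
Notation bias := (nr_bias W).

(** The bias is bilinear in the regression functions, up to the constant coming
    from the conditional covariance. *)
Lemma bias_expand j n (c x y : R) (f g w : V -> R) : (J0 <= j)%N ->
  bm f -> bm g -> bm w ->
  bias j n c (fun t => f t + x * w t) (fun t => g t + y * w t)
  = bias j n c f g + y * bias j n 0 f w + x * bias j n 0 w g + x * y * bias j n 0 w w.
Proof.
move=> J0j bf bg bw; have bK := bm_kernel_diag W J0j.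
have bxw : bm (fun t => x * w t) by exact: bmZ.
have byw : bm (fun t => y * w t) by exact: bmZ.
have ipl (h : V -> R) : bm h -> ip mu (fun t => f t + x * w t) h = ip mu f h + x * ip mu w h.
  by move=> bh; rewrite ipDl// ipZl.
have ipr (h : V -> R) : bm h -> ip mu (fun t => g t + y * w t) h = ip mu g h + y * ip mu w h.
  by move=> bh; rewrite ipDl// ipZl.
pose gK := fun t => g t * kernel_diag W j t; pose wK := fun t => w t * kernel_diag W j t.
have bgK : bm gK by exact: bmM.
have bwK : bm wK by exact: bmM.
have E1 : ip mu (fun t => f t + x * w t) (fun t => g t + y * w t)
    = ip mu f g + y * ip mu f w + x * ip mu w g + x * y * ip mu w w.
  rewrite ipl; last exact: bmD.
  by rewrite ![ip mu _ (fun t => g t + _)]ipC !ipr// ![ip mu g _]ipC [ip mu w f]ipC; ring.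
have E2 : ip mu (fun t => f t + x * w t) (fun t => (g t + y * w t) * kernel_diag W j t)
    = ip mu f gK + y * ip mu f wK + x * ip mu w gK + x * y * ip mu w wK.
  rewrite (_ : (fun t => (g t + y * w t) * _) = (fun t => gK t + y * wK t)); last first.
    by apply/funext => t; rewrite mulrDl mulrA.
  have ipr' (h : V -> R) : bm h -> ip mu h (fun t => gK t + y * wK t) = ip mu h gK + y * ip mu h wK.
    move=> bh; rewrite ipC ipDl//; last exact: bmZ.
    by rewrite ipZl// ![ip mu _ h]ipC.
  rewrite ipr'; last exact: bmD.
  by rewrite !ipl//; ring.
have E3 : phi_form W j (fun t => f t + x * w t) (fun t => g t + y * w t)
    = phi_form W j f g + y * phi_form W j f w + x * phi_form W j w g
      + x * y * phi_form W j w w.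
  rewrite /phi_form !mulr_sumr -!big_split/=; apply: eq_bigr => m _.
  have bm_ : bm (rphi m) by exact: bm_rphi.
  by rewrite ipl// ipr//; ring.
rewrite /nr_bias E1 E2 E3 -/gK -/wK; ring.
Qed.

(** The part of the bias of order [k / n] is at most [1 / 8] when [k] is small
    compared with [n], half of the lower bound on the projection error of the wave. *)
Lemma bias_invisible j n (w : V -> R) : (J0 <= j)%N -> (0 < n)%N -> bm w ->
  (forall x, `|w x| <= 1) -> 4^-1 <= ip mu w w - phi_form W j w w ->
  8 * #|cdv_idx W j|%:R <= n%:R :> R -> 8^-1 <= bias j n 0 w w.
Proof.
move=> J0j n0 bw w1 wD Nn; have bK := bm_kernel_diag W J0j.
have n0' : 0 < n%:R :> R by rewrite ltr0n.
have H1 : ip mu w (fun x => w x * kernel_diag W j x) <= #|cdv_idx W j|%:R.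
  rewrite -Ex_kernel_diag//; apply: Ex_le => //; first by apply/bmM/bmM.
  move=> x; rewrite mulrA -expr2 -[leRHS]mul1r ler_wpM2r ?sumr_ge0//.
    by move=> m _; exact: sqr_ge0.
  by rewrite -real_normK ?num_real// expr_le1.
have H2 : 0 <= phi_form W j w w by apply: sumr_ge0 => m _; rewrite -expr2 sqr_ge0.
have : n%:R^-1 * (ip mu w (fun x => w x * kernel_diag W j x) + 0 * #|cdv_idx W j|%:R
    - phi_form W j w w) <= 8^-1.
  rewrite mulrC ler_pdivrMr// mul0r addr0.
  by move: H1 H2 Nn; move: (ip _ _ _) (phi_form _ _ _ _) (#|_|%:R) (n%:R) => x1 x2 x3 x4 *; lra.
rewrite /nr_bias; move: wD; move: (ip mu w w - _) (_ * _) => x1 x2 *; lra.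
Qed.

Hypotheses (hd : (0 < d)%N) (alpha0 : 0 < alpha) (beta0 : 0 < beta)
  (aS : alpha < S%:R) (bS : beta < S%:R).
Hypothesis nondeg : nondegenerate_model W C1 C2 alpha beta M.
Notation rho := (2 `^ (- (alpha + beta))).

Let sqr_le_abs (x y : R) (z : \bar R) : 0 <= x -> x <= `|y| ->
  ((y ^+ 2)%:E <= z)%E -> ((x ^+ 2)%:E <= z)%E.
Proof.
move=> x0 xy; apply: le_trans; rewrite lee_fin -[leRHS]real_normK ?num_real//.
by rewrite ler_sqr ?nnegrE.
Qed.

(** The first bound compares the two signs of the conditional covariance for
    the same regression functions; the second is the mixed second difference of
    the bias over the signs of the waves planted in [p] and in [b], which leaves
    only the value of the bilinear part on the wave. *)
Lemma max_risk_ge : exists c K : R, [/\ 0 < c, 0 < K & forall (j : nat -> nat) n,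
  (0 < n)%N -> (J0 <= j n)%N ->
  (((c * (2 ^+ (j n * d) / n%:R)) ^+ 2)%:E <= max_risk W C1 C2 alpha beta M j n)%E /\
  (K * 2 ^+ (j n * d) <= n%:R ->
    (((c * rho ^+ j n) ^+ 2)%:E <= max_risk W C1 C2 alpha beta M j n)%E)].
Proof.
have [c1 c10 Hw] := invisible_wave W hd.
have [ha [siga [ea [siga0 ea0 bha Ha]]]] :=
  planted_wave hd alpha0 aS c10 (nondeg (or_introl erefl)).
have [hb [sigb [eb [sigb0 eb0 bhb Hb]]]] :=
  planted_wave hd beta0 bS c10 (nondeg (or_intror erefl)).
have [K K0 HK] := card_idx_le W; have [k k0 Hk] := card_idx_ge W.
pose sig := Num.min siga sigb.
have sig0 : 0 < sig by rewrite lt_min siga0.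
have sigaP x : C1 + siga <= x <= C2 - siga -> C1 + sig <= x <= C2 - sig.
  have : sig <= siga by rewrite ge_min lexx.
  by move=> h /andP[x1 x2]; apply/andP; split; lra.
have sigbP x : C1 + sigb <= x <= C2 - sigb -> C1 + sig <= x <= C2 - sig.
  have : sig <= sigb by rewrite ge_min lexx orbT.
  by move=> h /andP[x1 x2]; apply/andP; split; lra.
pose c := Num.min (k * sig ^+ 2) (ea * eb / 8).
have c0 : 0 < c by rewrite lt_min !mulr_gt0// ?exprn_gt0// invr_gt0.
exists c, (8 * K); split => // [|j n n0 J0j]; first by rewrite mulr_gt0.
have n0' : 0 < n%:R :> R by rewrite ltr0n.
have [q [qc1 qD]] := Hw _ J0j.
pose w : V -> R := res (wave q 0).
have bwave : bm (wave q 0 : V -> R) by exact: bm_wave.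
have bw : bm w by exact: bm_res_bm.
have w1 x : `|w x| <= 1.
  have [Qx|nQ] := pselect (Q x); last by rewrite /w res_out// normr0.
  by rewrite /w res_in//; exact: cos_max.
have wE g : bm g -> ip mu w g = ip mu (wave q 0) g.
  by move=> bg; apply: ip_ae; [case: bw|case: bwave|case: bg|case: bg|exact: res_ae_id|exact: aeW].
have wD : 4^-1 <= ip mu w w - phi_form W (j n) w w.
  rewrite wE// ipC wE// (_ : phi_form _ _ _ _ = phi_form W (j n) (wave q 0) (wave q 0))//.
  by apply: eq_bigr => m _; rewrite !wE//; exact: bm_rphi.
pose xa s := s * ea * 2 `^ (- ((j n)%:R * alpha)).
pose xb s := s * eb * 2 `^ (- ((j n)%:R * beta)).
have main s t u : `|s| <= 1 -> `|t| <= 1 -> `|u| <= 1 ->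
  ((bias (j n) n (u * sig ^+ 2) (fun x => res ha x + xa s * w x)
      (fun x => res hb x + xb t * w x) ^+ 2)%:E
   <= max_risk W C1 C2 alpha beta M j n)%E.
  move=> s1 t1 u1.
  have [Hp pin] := Ha _ q s J0j qc1 s1; have [Hb' bin] := Hb _ q t J0j qc1 t1.
  have := bias_le_max_risk n0 J0j (ltW sig0) u1 Hp Hb'
    (fun x Qx => sigaP _ (pin x Qx)) (fun x Qx => sigbP _ (bin x Qx)).
  rewrite (_ : res (fun x => ha x + _) = fun x => res ha x + xa s * w x); last first.
    by apply/funext => x; rewrite resD resZ.
  rewrite (_ : res (fun x => hb x + _) = fun x => res hb x + xb t * w x)//.
  by apply/funext => x; rewrite resD resZ.
have one1 : `|1 : R| <= 1 by rewrite normr1.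
have onem1 : `|-1 : R| <= 1 by rewrite normrN normr1.
have zero1 : `|0 : R| <= 1 by rewrite normr0.
have E s t u := @bias_expand (j n) n (u * sig ^+ 2) (xa s) (xb t) (res ha) (res hb) w J0j bha bhb bw.
split.
- have := main 0 0 1 zero1 zero1 one1; have := main 0 0 (-1) zero1 zero1 onem1.
  rewrite !E /xa /xb !mul0r !addr0.
  set b1 := bias _ _ _ _ _; set b2 := bias _ _ _ _ _ => m1 m2.
  pose x := sig ^+ 2 * #|cdv_idx W (j n)|%:R / n%:R.
  (* hence one of the two biases is at least [x] in absolute value *)
  have b12 : b1 - b2 = 2 * x by rewrite /b1 /b2 /nr_bias /x; ring.
  have x0 : 0 <= x by rewrite /x divr_ge0// mulr_ge0// sqr_ge0.
  have cx : c * (2 ^+ (j n * d) / n%:R) <= x.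
    rewrite /x mulrA ler_wpM2r ?invr_ge0//.
    apply: (@le_trans _ _ (k * sig ^+ 2 * 2 ^+ (j n * d))).
      by rewrite ler_wpM2r ?exprn_ge0// ge_min lexx.
    by rewrite [k * _]mulrC -mulrA ler_wpM2l ?sqr_ge0//; exact: Hk.
  have cx0 : 0 <= c * (2 ^+ (j n * d) / n%:R).
    by rewrite mulr_ge0 ?divr_ge0 ?exprn_ge0// ltW.
  have [xb1|xb1] := lerP x `|b1|; first exact: sqr_le_abs cx0 (le_trans cx xb1) m1.
  apply: sqr_le_abs cx0 (le_trans cx _) m2.
  move: (ler_norm b1) (ler_norm (- b2)); rewrite normrN => h1 h2; lra.
move=> Kn.
have Nn : 8 * #|cdv_idx W (j n)|%:R <= n%:R :> R.
  by apply: le_trans Kn; rewrite -mulrA ler_wpM2l//; exact: HK.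
have B := bias_invisible J0j n0 bw w1 wD Nn.
have := main 1 1 0 one1 one1 zero1; have := main 1 (-1) 0 one1 onem1 zero1.
have := main (-1) 1 0 onem1 one1 zero1; have := main (-1) (-1) 0 onem1 onem1 zero1.
rewrite !E.
set b1 := _ + _; set b2 := _ + _; set b3 := _ + _; set b4 := _ + _ => m1 m2 m3 m4.
pose x := xa 1 * xb 1 * bias (j n) n 0 w w.
(* hence one of the four biases is at least [x] in absolute value *)
have bx : b1 - b2 - b3 + b4 = 4 * x.
  by rewrite /b1 /b2 /b3 /b4 /x /xa /xb !mulN1r !mul1r; ring.
have xab : xa 1 * xb 1 = ea * eb * rho ^+ j n.
  rewrite /xa /xb !mul1r mulrACA -powRD ?pnatr_eq0 ?implybT//.
  congr (_ * _).
  by rewrite -opprD -mulrDr -mulrN mulrC powRrM powR_mulrn ?powR_ge0.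
have r0 : 0 <= rho ^+ j n by rewrite exprn_ge0// powR_ge0.
have cx : c * rho ^+ j n <= x.
  apply: (@le_trans _ _ (ea * eb * rho ^+ j n / 8)).
    by rewrite mulrAC ler_wpM2r// ge_min lexx orbT.
  by rewrite /x xab ler_wpM2l// !mulr_ge0// ltW.
have cx0 : 0 <= c * rho ^+ j n by rewrite mulr_ge0// ltW.
have [xb1|xb1] := lerP x `|b1|; first exact: sqr_le_abs cx0 (le_trans cx xb1) m1.
have [xb2|xb2] := lerP x `|b2|; first exact: sqr_le_abs cx0 (le_trans cx xb2) m2.
have [xb3|xb3] := lerP x `|b3|; first exact: sqr_le_abs cx0 (le_trans cx xb3) m3.
apply: sqr_le_abs cx0 (le_trans cx _) m4.
move: (ler_norm b1) (ler_norm (- b2)) (ler_norm (- b3)) (ler_norm b4).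
by rewrite !normrN; move: bx xb1 xb2 xb3; clear; clearbody x b1 b2 b3 b4; lra.
Qed.

End LowerBound.

(** * Rates in the sample size *)

Section Rates.
Context {R : realType}.

Lemma npowE (e : R) n : npow e n = (n%:R `^ e)%:E. Proof. by []. Qed.

Lemma powR_mul_exp (a x : R) n : 0 <= a -> (a `^ x) ^+ n = a `^ (x * n%:R).
Proof. by move=> a0; rewrite powRrM powR_mulrn// powR_ge0. Qed.

Lemma powRN_le (a b t : R) : 0 < a -> a <= b -> 0 <= t -> b `^ (- t) <= a `^ (- t).
Proof.
move=> a0 ab t0; have b0 := lt_le_trans a0 ab.
rewrite !powRN lef_pV2 ?posrE ?powR_gt0//.
by apply: ge0_ler_powR => //; rewrite nnegrE ltW.
Qed.

Lemma level_decay (d j : nat) (s : R) : (0 < d)%N ->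
  (2 `^ (- s)) ^+ j = (2 ^+ (j * d)) `^ (- (s / d%:R)) :> R.
Proof.
move=> d0; have d0' : d%:R != 0 :> R by rewrite pnatr_eq0 -lt0n.
rewrite powR_mul_exp// -powR_mulrn// -powRrM; congr (_ `^ _).
by rewrite natrM; field.
Qed.

(** The two hypotheses on the resolution [x] bound [x / N] by [N ^ (- tau / 2)]
    and [x ^ (- 2 s / d)] by [N ^ (- tau)], up to constants. *)
Lemma rate_terms_le (d j : nat) (s tau C N : R) : (0 < d)%N -> 0 < s -> 0 <= tau <= 1 ->
  1 <= N -> 0 < C -> let x := 2 ^+ (j * d) in
  x <= C * N `^ (1 - tau / 2) -> N `^ (tau * d%:R / (2 * s)) <= C * x ->
  N^-1 + ((2 `^ (- s)) ^+ j) ^+ 2 + (x ^+ 2 / N ^+ 2 + x ^+ 3 / N ^+ 3)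
  <= (1 + C `^ (2 * s / d%:R) + C ^+ 2 + C ^+ 3) * N `^ (- tau).
Proof.
move=> d0 s0 /andP[t0 t1] N1 C0 x xle xge.
have N0 : 0 < N by exact: lt_le_trans N1.
have Nn0 : N != 0 by rewrite gt_eqF.
have x0 : 0 < x by rewrite exprn_gt0.
have C0' := ltW C0; have N0' := ltW N0; have x0' := ltW x0; have s0' := ltW s0.
have d0' : 0 < d%:R :> R by rewrite ltr0n.
have xN : x / N <= C * N `^ (- (tau / 2)).
  rewrite ler_pdivrMr// -mulrA -[X in _ * X](_ : N `^ (1 - tau / 2) = _)//.
  by rewrite addrC powRD ?Nn0 ?implybT// powRr1.
have xN0 : 0 <= x / N by rewrite divr_ge0.
have T1 : N^-1 <= N `^ (- tau).
  by rewrite -powR_inv1//; apply: ler_powR => //; rewrite lerN2.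
have T2 : ((2 `^ (- s)) ^+ j) ^+ 2 <= C `^ (2 * s / d%:R) * N `^ (- tau).
  rewrite (level_decay j s d0) -/x powR_mul_exp// mulNr.
  set u := s / d%:R * 2%:R; have u0 : 0 <= u by rewrite mulr_ge0// divr_ge0.
  apply: (@le_trans _ _ ((N `^ (tau * d%:R / (2 * s)) / C) `^ (- u))).
    apply: powRN_le => //; first by rewrite divr_gt0// powR_gt0.
    by rewrite ler_pdivrMr// [x * C]mulrC.
  rewrite powRM ?invr_ge0 ?powR_ge0//.
  rewrite [leLHS]mulrC -powR_inv1// -!powRrM.
  rewrite (_ : -1 * - u = 2 * s / d%:R); last by rewrite /u; field; rewrite gt_eqF.
  rewrite (_ : _ * - u = - tau)//; rewrite /u; field; rewrite !gt_eqF//.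
have T3 : x ^+ 2 / N ^+ 2 <= C ^+ 2 * N `^ (- tau).
  rewrite -expr_div_n; apply: le_trans (_ : (C * N `^ (- (tau / 2))) ^+ 2 <= _).
    by rewrite ler_sqr ?nnegrE// mulr_ge0 ?powR_ge0 ?ltW.
  rewrite exprMn powR_mul_exp// (_ : - (tau / 2) * 2%:R = - tau)//; by field.
have T4 : x ^+ 3 / N ^+ 3 <= C ^+ 3 * N `^ (- tau).
  rewrite -expr_div_n; apply: le_trans (_ : (C * N `^ (- (tau / 2))) ^+ 3 <= _).
    by apply: lerXn2r => //; rewrite nnegrE mulr_ge0 ?powR_ge0 ?ltW.
  rewrite exprMn powR_mul_exp// ler_wpM2l ?exprn_ge0//.
  by apply: ler_powR => //; lra.
rewrite [leRHS](_ : _ = N `^ (- tau) + C `^ (2 * s / d%:R) * N `^ (- tau)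
  + (C ^+ 2 * N `^ (- tau) + C ^+ 3 * N `^ (- tau))); last by ring.
by apply: lerD; apply: lerD.
Qed.

Lemma powR_unbounded (e C : R) n0 : 0 < e ->
  exists n : nat, [/\ (n0 <= n)%N, (0 < n)%N & C < n%:R `^ e].
Proof.
move=> e0; pose B := (`|C| + 1) `^ e^-1.
exists (maxn n0 (Num.truncn B).+1); split; [exact: leq_maxl|by rewrite leq_max orbT|].
have C1 : 0 < `|C| + 1 by rewrite ltr_wpDl.
have BC : B `^ e = `|C| + 1 by rewrite /B -powRrM mulVf ?gt_eqF// powRr1// ltW.
apply: (@lt_le_trans _ _ (B `^ e)).
  by rewrite BC; apply: le_lt_trans (ler_norm C) _; rewrite ltrDl.
apply: ge0_ler_powR; rewrite ?nnegrE ?powR_ge0 ?(ltW e0)//.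
apply: le_trans (ltW (truncnS_gt _)) _.
by rewrite ler_nat leq_maxr.
Qed.

Lemma npow_not_lesssim (e1 e2 : R) : e2 < e1 -> ~ lesssim (@npow R e1) (npow e2).
Proof.
move=> e12 [C C0 [n0 H]].
have e0 : 0 < e1 - e2 by rewrite subr_gt0.
have [n [n0n n1 Cn]] := powR_unbounded C n0 e0.
have := H n n0n; rewrite !npowE -EFinM lee_fin leNgt => /negP; apply.
have N0 : 0 < n%:R :> R by rewrite ltr0n.
rewrite -[e1](subrK e2) powRD; last by rewrite (gt_eqF N0) implybT.
by rewrite ltr_pM2r// powR_gt0.
Qed.

Lemma lesssim_trans (a b c : nat -> \bar R) : lesssim a b -> lesssim b c -> lesssim a c.
Proof.
move=> [C C0 [n0 H]] [D D0 [m0 H']]; exists (C * D); first exact: mulr_gt0.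
exists (maxn n0 m0) => n; rewrite geq_max => /andP[nn nm].
apply: le_trans (H n nn) _; rewrite EFinM -muleA.
by apply: lee_wpmul2l; [rewrite lee_fin ltW|exact: H'].
Qed.

End Rates.

Section RiskRates.
Context {R : realType} {d S J0 : nat}.
Variable W : cdv_basis R d S J0.
Variables (C1 C2 alpha beta M : R).
Hypotheses (hd : (0 < d)%N) (halpha : 0 < alpha) (hbeta : 0 < beta).
Notation s := (alpha + beta).
Notation mr := (max_risk W C1 C2 alpha beta M).

Let s0 : 0 < s. Proof. exact: addr_gt0. Qed.
Let d0 : 0 < d%:R :> R. Proof. by rewrite ltr0n. Qed.

(** For [tau = 1] the conditions say [n ^ (d / (2 s)) <= k <= n ^ (1 / 2)]; for
    [tau = 2 s / (s + d)] both bounds on [k] are [n ^ (d / (s + d))]. *)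
Lemma max_risk_rate (tau : R) (j : nat -> nat) : 0 <= tau <= 1 -> level_seq J0 j ->
  lesssim (@npow R (tau * d%:R / (2 * s))) (@resolution R d j) ->
  lesssim (@resolution R d j) (npow (1 - tau / 2)) ->
  lesssim (mr j) (npow (- tau)).
Proof.
move=> t01 Jj [A A0 [n1 H1]] [B B0 [n2 H2]].
have [K K0 HK] := @max_risk_le _ _ _ _ W C1 C2 alpha beta M s0.
(* the hypotheses hold eventually with two constants; one serves for both *)
pose C := Num.max A B.
have C0 : 0 < C by rewrite lt_max A0.
pose E := 1 + C `^ (2 * s / d%:R) + C ^+ 2 + C ^+ 3.
have E0 : 0 < E.
  by rewrite /E -!addrA ltr_wpDr// !addr_ge0 ?powR_ge0 ?exprn_ge0// ltW.
exists ((K + 1) * E); first by rewrite mulr_gt0// ltr_wpDl.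
exists (maxn 1 (maxn n1 n2)) => n; rewrite !geq_max => /and3P[n0 nn1 nn2].
apply: le_trans (HK j n n0 (Jj n)) _; rewrite npowE -EFinM lee_fin.
have x0 : 0 <= 2 ^+ (j n * d) :> R by rewrite exprn_ge0.
have P0 : 0 <= n%:R `^ (1 - tau / 2) :> R by exact: powR_ge0.
have N1 : 1 <= n%:R :> R by rewrite ler1n.
have G1 : 2 ^+ (j n * d) <= C * n%:R `^ (1 - tau / 2).
  have := H2 n nn2; rewrite npowE -EFinM lee_fin => /le_trans; apply.
  by rewrite ler_wpM2r// le_max lexx orbT.
have G2 : n%:R `^ (tau * d%:R / (2 * s)) <= C * 2 ^+ (j n * d).
  have := H1 n nn1; rewrite npowE -EFinM lee_fin => /le_trans; apply.
  by rewrite ler_wpM2r// le_max lexx.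
have G := rate_terms_le hd s0 t01 N1 C0 G1 G2.
apply: (@le_trans _ _ (K * (E * n%:R `^ (- tau)))); first exact: ler_wpM2l.
rewrite -mulrA; apply: ler_wpM2r; last by rewrite lerDl.
by rewrite mulr_ge0 ?powR_ge0// ltW.
Qed.

(** The bias is at least of order [k / n] and, unless [k] exceeds a multiple of
    [n], at least of order [k ^ (- s / d)].  The first is increasing and the second
    decreasing in [k], and they cross at [k = n ^ (d / (s + d))]. *)
Lemma rate_le_max_risk (j : nat -> nat) : alpha < S%:R -> beta < S%:R ->
  nondegenerate_model W C1 C2 alpha beta M -> level_seq J0 j ->
  lesssim (npow (- (2 * s / (s + d%:R)))) (mr j).
Proof.
move=> aS bS nd Jj.
have [c [K [c0 K0 H]]] := max_risk_ge hd halpha hbeta aS bS nd.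
pose c' := Num.min c (c / K).
have c'0 : 0 < c' by rewrite lt_min c0 divr_gt0.
exists (c' ^- 2); first by rewrite invr_gt0 exprn_gt0.
exists 1%N => n n0; have [Ha Hb] := H j n n0 (Jj n).
have N1 : 1 <= n%:R :> R by rewrite ler1n.
have N0 : 0 < n%:R :> R by rewrite ltr0n.
have N0' := ltW N0.
have sd0 : 0 < s + d%:R by exact: addr_gt0.
have sdn0 : s + d%:R != 0 by rewrite gt_eqF.
have dn0 : d%:R != 0 :> R by rewrite gt_eqF.
pose t := s / (s + d%:R).
have t0 : 0 <= t by rewrite divr_ge0 ?ltW.
pose u := n%:R `^ (- t) : R.
have u0 : 0 < u by rewrite powR_gt0.
suff main : ((((c' * u) ^+ 2)%:E <= mr j n))%E.
  rewrite npowE (_ : n%:R `^ _ = u ^+ 2); last first.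
    by rewrite powR_mul_exp//; congr (_ `^ _); rewrite /t; field.
  move: main; case: (mr j n) => [r| |] => [|_|].
  - rewrite -EFinM !lee_fin exprMn => h.
    by rewrite ler_pdivlMl ?exprn_gt0.
  - by rewrite gt0_muley ?leey// lte_fin invr_gt0 exprn_gt0.
  - by rewrite leeNy_eq.
have mono y : 0 <= y -> c' * u <= y -> ((y ^+ 2)%:E <= mr j n)%E ->
    (((c' * u) ^+ 2)%:E <= mr j n)%E.
  move=> y0 uy; apply: le_trans; rewrite lee_fin ler_sqr ?nnegrE//.
  by rewrite mulr_ge0 ?ltW.
set x := 2 ^+ (j n * d) in Ha Hb.
have x0 : 0 < x :> R by rewrite exprn_gt0.
have c'u a : 0 <= a -> u <= a -> c' * u <= c * a.
  move=> a0 ua; apply: ler_pM; [exact: ltW|exact: ltW|by rewrite ge_min lexx|by []].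
pose e := d%:R / (s + d%:R).
have [xe|xe] := lerP (n%:R `^ e) x.
  apply: mono Ha; first by rewrite mulr_ge0 ?divr_ge0// ltW.
  apply: c'u; first by rewrite divr_ge0// ltW.
  rewrite ler_pdivlMr//; apply: le_trans xe.
  rewrite -[X in _ * X]powRr1// /u -powRD; last by rewrite (gt_eqF N0) implybT.
  by rewrite (_ : - t + 1 = e)// /t /e; field.
(* when [k] exceeds a multiple of [n], the first bound is of order one *)
have [Kx|Kx] := lerP (K * x) n%:R.
  apply: mono (Hb Kx); first by rewrite mulr_ge0 ?exprn_ge0 ?powR_ge0// ltW.
  apply: c'u; first by rewrite exprn_ge0 ?powR_ge0.
  rewrite (level_decay (j n) s hd) -/x.
  apply: le_trans (powRN_le x0 (ltW xe) _); last by rewrite divr_ge0 ?ltW.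
  rewrite -powRrM (_ : e * _ = - t)// /t /e; field; by rewrite sdn0.
apply: mono Ha; first by rewrite mulr_ge0 ?divr_ge0// ltW.
have u1 : u <= 1.
  have tn : - t <= 0 by rewrite lerNl oppr0.
  by have := ler_powR N1 tn; rewrite powRr0.
apply: (@le_trans _ _ (c / K)).
  rewrite -[leRHS]mulr1; apply: ler_pM => //; [exact: ltW|exact: ltW|].
  by rewrite ge_min lexx orbT.
rewrite ler_pM2l// ler_pdivlMr// [leLHS]mulrC ler_pdivrMr// [x * K]mulrC; exact: ltW.
Qed.

Lemma dyadic_level (y : R) : 1 <= y ->
  exists l : nat, 2 ^+ l <= y <= 2 * 2 ^+ l.
Proof.
move=> y1; have y0 : 0 <= y by exact: le_trans y1.
pose m := Num.truncn y.
have m0 : (0 < m)%N by rewrite truncn_gt0.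
exists (trunc_log 2 m); apply/andP; split.
  apply: le_trans (_ : m%:R <= _); last by have /andP[] := truncn_itv y0.
  by rewrite -natrX ler_nat trunc_logP.
apply: le_trans (ltW (truncnS_gt y)) _.
rewrite -exprS -natrX ler_nat; exact: trunc_log_ltn.
Qed.

(** The largest power of two below [n ^ (1 / (s + d))], raised to the coarsest
    level when it is smaller, gives a resolution of the right order. *)
Lemma balanced_level : exists2 j, level_seq J0 j &
  asymp (@resolution R d j) (npow (d%:R / (s + d%:R))).
Proof.
pose y n : R := (maxn n 1)%:R `^ (s + d%:R)^-1.
have sd0 : 0 < s + d%:R by exact: addr_gt0.
have y1 n : 1 <= y n.
  have N1 : 1 <= (maxn n 1)%:R :> R by rewrite ler1n leq_max orbT.
  have i0 : 0 <= (s + d%:R)^-1 by rewrite invr_ge0 ltW.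
  by have := ler_powR N1 i0; rewrite powRr0.
pose l n := projT1 (cid (dyadic_level (y1 n))).
have lP n : 2 ^+ l n <= y n <= 2 * 2 ^+ l n by exact: projT2 (cid (dyadic_level (y1 n))).
have yE n : (0 < n)%N -> y n ^+ d = n%:R `^ (d%:R / (s + d%:R)).
  move=> n0; rewrite /y (maxn_idPl n0) powR_mul_exp//; congr (_ `^ _); exact: mulrC.
exists (fun n => maxn J0 (l n)) => [n|]; first exact: leq_maxl.
have y0 n : 0 <= y n by exact: le_trans (y1 n).
split.
  exists (2 ^+ (J0 * d)); first by rewrite exprn_gt0.
  exists 1%N => n n0; rewrite npowE -EFinM lee_fin -(yE n n0) !exprM -exprMn.
  apply: lerXn2r; rewrite ?nnegrE ?mulr_ge0 ?exprn_ge0//.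
  have /andP[ly _] := lP n.
  have [_|_] := leqP J0 (l n).
    apply: le_trans ly _; rewrite -[leLHS]mul1r ler_wpM2r//.
    by rewrite exprn_ege1// ler1n.
  by rewrite -[leLHS]mulr1 ler_wpM2l ?exprn_ge0.
exists (2 ^+ d); first by rewrite exprn_gt0.
exists 1%N => n n0; rewrite npowE -EFinM lee_fin -(yE n n0) exprM -exprMn.
apply: lerXn2r; rewrite ?nnegrE ?mulr_ge0 ?exprn_ge0//.
have /andP[_ ly] := lP n; apply: le_trans ly _.
by rewrite ler_wpM2l// ler_eXn2l ?ltr1n// leq_maxr.
Qed.

End RiskRates.

Theorem corollary13 (R : realType) (d S J0 : nat) (W : cdv_basis R d S J0)
    (C1 C2 alpha beta M : R)
    (hd : (0 < d)%N) (hS : (1 <= S)%N) (hJ0 : (S <= 2 ^ J0)%N)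
    (halpha : 0 < alpha) (hbeta : 0 < beta) (hM : 0 < M)
    (hSreg : Num.max alpha beta < S%:R) :
  (d%:R / 2 <= (alpha + beta) / 2 ->
     forall j : nat -> nat, level_seq J0 j ->
       lesssim (npow (d%:R / (2 * alpha + 2 * beta))) (@resolution R d j) ->
       lesssim (@resolution R d j) (fun n => (Num.sqrt n%:R)%:E) ->
       minimax_optimal W C1 C2 alpha beta M j)
  /\
  ((alpha + beta) / 2 < d%:R / 2 ->
     let r := npow (- ((2 * alpha + 2 * beta) / (alpha + beta + d%:R))) in
     (nondegenerate_model W C1 C2 alpha beta M ->
        (forall j : nat -> nat, level_seq J0 j ->
           ~ minimax_optimal W C1 C2 alpha beta M j)
        /\ best_rate W C1 C2 alpha beta M r)
     /\
     (forall j : nat -> nat, level_seq J0 j ->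
        asymp (@resolution R d j) (npow (d%:R / (alpha + beta + d%:R))) ->
        lesssim (max_risk W C1 C2 alpha beta M j) r)).
Proof.
have s0 : 0 < alpha + beta by exact: addr_gt0.
have d0 : 0 < d%:R :> R by rewrite ltr0n.
have aS : alpha < S%:R by apply: le_lt_trans hSreg; rewrite le_max lexx.
have bS : beta < S%:R by apply: le_lt_trans hSreg; rewrite le_max lexx orbT.
have sn0 : alpha + beta != 0 by rewrite gt_eqF.
have dn0 : d%:R != 0 :> R by rewrite gt_eqF.
have sdp : 0 < alpha + beta + d%:R by exact: addr_gt0.
have sd0 : alpha + beta + d%:R != 0 by rewrite gt_eqF.
split=> [sd j Jj klo khi|sd r].
  rewrite /minimax_optimal /minimax_rate ifT; last by move: sd d0; lra.
  apply: (@max_risk_rate _ _ _ _ W C1 C2 alpha beta M hd halpha hbeta 1) => //.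
  - by rewrite ler01 lexx.
  - by rewrite mul1r mulrDr.
  - have [C C0 [n0 H]] := khi; exists C => //; exists n0 => n /H; rewrite npowE -powR12_sqrt//.
    by rewrite (_ : 1 - 1 / 2 = 2^-1)//; field.
have rE : r = npow (- (2 * (alpha + beta) / (alpha + beta + d%:R))).
  by rewrite /r mulrDr.
pose tau := 2 * (alpha + beta) / (alpha + beta + d%:R).
have tau01 : 0 <= tau <= 1.
  apply/andP; split; first by rewrite divr_ge0 ?mulr_ge0 ?(ltW s0) ?(ltW sdp).
  by rewrite ler_pdivrMr// mul1r; move: sd; lra.
have balanced j : level_seq J0 j ->
    asymp (@resolution R d j) (npow (d%:R / (alpha + beta + d%:R))) ->
    lesssim (max_risk W C1 C2 alpha beta M j) r.
  move=> Jj [khi klo]; rewrite rE; apply: (max_risk_rate W C1 C2 M hd halpha hbeta tau01) => //.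
    rewrite (_ : tau * d%:R / _ = d%:R / (alpha + beta + d%:R))//.
    by rewrite /tau; field; rewrite sd0.
  rewrite (_ : 1 - tau / 2 = d%:R / (alpha + beta + d%:R))//.
  by rewrite /tau; field.
split=> // nd.
have lower j : level_seq J0 j -> lesssim r (max_risk W C1 C2 alpha beta M j).
  by move=> Jj; rewrite rE; exact: rate_le_max_risk.
split; last first.
  split=> //; have [j Jj kj] := @balanced_level _ d J0 alpha beta hd halpha hbeta.
  by exists j => //; exact: balanced.
move=> j Jj opt; have := lesssim_trans (lower j Jj) opt.
rewrite /minimax_rate; case: ifPn => _; rewrite rE; apply: npow_not_lesssim.
  rewrite ltrN2 ltr_pdivrMr// mul1r.
  by move: sd; lra.
rewrite ltrN2 ltr_pdivrMr// mulrAC ltr_pdivlMr; last by rewrite !addr_gt0// mulr_gt0.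
have := mulr_gt0 s0 d0; rewrite -!mulrDr; nra.
Qed.
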